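(* Let $q$ be a prime power, $G=PGL(3,\mathbb{F}_q(\!(t^{-1})\!))$, $\Gamma=PGL(3,\mathbb{F}_q[t])$, and let $M$ and $T_a\colon\Gamma\backslash G/M\to\Gamma\backslash G/M$ be as defined in the context. The type 1 discrete geodesic flow system $(\Gamma\backslash G/M,T_a)$ is strongly positive recurrent in the sense that $$\limsup_{n\to\infty}\frac{1}{n}\log f_n(o)<h_{T_a},$$ where $f_n(o)$ is the number of first return cycles at $o$ of length $n$ and $h_{T_a}$ is the Gurevich entropy of $T_a$.
   Context: Let $\mathbb{F}_q$ be the finite field of order $q$, $\mathbb{F}_q(\!(t^{-1})\!)$ the field of formal Laurent series in $t^{-1}$ (the completion of $\mathbb{F}_q(t)$ for the absolute value $\|g/h\|=q^{\deg g-\deg h}$), and $\mathcal{O}=\mathbb{F}_q[\![t^{-1}]\!]$ its valuation ring. Let $G=PGL(3,\mathbb{F}_q(\!(t^{-1})\!))$, $\Gamma=PGL(3,\mathbb{F}_q[t])$ and $K=PGL(3,\mathcal{O})$. Let $a\in G$ be the class of $\mathrm{diag}(t,1,1)$, and let $$M=\left\{m=\begin{pmatrix}k_{11} & 0 & 0 \\ 0 & k_{22} & k_{23} \\ 0 & k_{32} & k_{33} \end{pmatrix}\colon m\in K\right\},$$ a subgroup of $K$ whose elements commute with $a$. Define $T_a\colon \Gamma\backslash G/M\to \Gamma\backslash G/M$ by $T_a(\Gamma gM)=\Gamma gaM$. Let $\pi_K\colon \Gamma\backslash G/M\to \Gamma\backslash G/K$ be the natural projection and $o=\Gamma eK$ the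 identity double coset in $\Gamma\backslash G/K$. For $n\ge 1$ define $$f_n(o)=\#\big\{\mathbf{x}\in \Gamma\backslash G/M\colon \pi_K(\mathbf{x})=o,\ T_a^n(\mathbf{x})=\mathbf{x},\ n=\min \{k>0\colon \pi_K(T_a^k(\mathbf{x}))=o\}\big\},$$ and for $x\in\Gamma\backslash G/K$ $$g_n(x)=\#\{\mathbf{x}\in \Gamma\backslash G/M\colon \pi_K(\mathbf{x})=x,\ T_a^n(\mathbf{x})=\mathbf{x}\}.$$ The Gurevich entropy of $T_a$ is $$h_{T_a}=\lim_{n\to\infty}\frac{1}{3n}\log g_{3n}(x),$$ a value which does not depend on the choice of $x\in\Gamma\backslash G/K$ (so one may take $x=o$). The convention $\log 0=-\infty$ is used. *)

(* Defs.v *)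
From HB Require Import structures.
From mathcomp Require Import all_boot all_order all_algebra.
From mathcomp Require Import all_classical all_reals all_analysis.
From mathcomp Require Import zify.

Set Implicit Arguments.
Unset Strict Implicit.
Unset Printing Implicit Defensive.

Import Order.TTheory GRing.Theory Num.Theory.

Local Open Scope classical_set_scope.
Local Open Scope ring_scope.

(* [pcoef f n] is the coefficient of [t ^ - n]: series in the variable t^-1. *)
Record pseries (F : fieldType) := PSeries { pcoef : nat -> F }.

HB.instance Definition _ (F : fieldType) := gen_eqMixin (pseries F).
HB.instance Definition _ (F : fieldType) := gen_choiceMixin (pseries F).

Section PowerSeries.
Variable F : fieldType.
Implicit Types f g h : pseries F.

Lemma pseriesP f g : (forall n, pcoef f n = pcoef g n) -> f = g.
Proof. by case: f g => [f] [g] /= fg; congr PSeries; apply/funext. Qed.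

Definition ps_add f g := PSeries (fun n => pcoef f n + pcoef g n).
Definition ps_opp f := PSeries (fun n => - pcoef f n).
Definition ps_const (c : F) := PSeries (fun n => if n == 0%N then c else 0).
Definition ps_mul f g :=
  PSeries (fun n => \sum_(i < n.+1) pcoef f i * pcoef g (n - i)%N).

Fact ps_addA : associative ps_add.
Proof. by move=> f g h; apply: pseriesP => n /=; rewrite addrA. Qed.
Fact ps_addC : commutative ps_add.
Proof. by move=> f g; apply: pseriesP => n /=; rewrite addrC. Qed.
Fact ps_add0 : left_id (PSeries (fun=> 0)) ps_add.
Proof. by move=> f; apply: pseriesP => n /=; rewrite add0r. Qed.
Fact ps_addN : left_inverse (PSeries (fun=> 0)) ps_opp ps_add.
Proof. by move=> f; apply: pseriesP => n /=; rewrite addNr. Qed.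

HB.instance Definition _ :=
  GRing.isZmodule.Build (pseries F) ps_addA ps_addC ps_add0 ps_addN.

Definition ps_trunc n f : {poly F} := \poly_(i < n) pcoef f i.

Lemma ps_mul_trunc n k f g : (k < n)%N ->
  pcoef (ps_mul f g) k = (ps_trunc n f * ps_trunc n g)`_k.
Proof.
move=> kn; rewrite coefM /=; apply: eq_bigr => i _.
by rewrite !coef_poly !ifT//; have := ltn_ord i; lia.
Qed.

Lemma coefM_low (p p' q q' : {poly F}) k :
  (forall i, (i <= k)%N -> p`_i = p'`_i) ->
  (forall i, (i <= k)%N -> q`_i = q'`_i) -> (p * q)`_k = (p' * q')`_k.
Proof.
move=> pp qq; rewrite !coefM; apply: eq_bigr => i _.
by rewrite pp ?qq //; have := ltn_ord i; lia.
Qed.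

Lemma ps_trunc_mul n f g k : (k < n)%N ->
  (ps_trunc n (ps_mul f g))`_k = (ps_trunc n f * ps_trunc n g)`_k.
Proof. by move=> kn; rewrite coef_poly kn (ps_mul_trunc _ _ kn). Qed.

Fact ps_mulA : associative ps_mul.
Proof.
move=> f g h; apply: pseriesP => k; rewrite !(@ps_mul_trunc k.+1)//.
transitivity (ps_trunc k.+1 f * (ps_trunc k.+1 g * ps_trunc k.+1 h))`_k.
  by apply: coefM_low => // i ik; rewrite ps_trunc_mul.
by rewrite mulrA; apply: coefM_low => // i ik; rewrite ps_trunc_mul.
Qed.
Fact ps_mulC : commutative ps_mul.
Proof. by move=> f g; apply: pseriesP => k; rewrite !(@ps_mul_trunc k.+1)// mulrC. Qed.
Fact ps_mul1 : left_id (ps_const 1) ps_mul.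
Proof.
move=> f; apply: pseriesP => k /=; rewrite big_ord_recl /= mul1r subn0.
by rewrite big1 ?addr0// => i _; rewrite mul0r.
Qed.
Fact ps_mulDl : left_distributive ps_mul ps_add.
Proof.
move=> f g h; apply: pseriesP => k /=; rewrite -big_split /=.
by apply: eq_bigr => i _; rewrite mulrDl.
Qed.
Fact ps_1neq0 : ps_const 1 != 0.
Proof.
by apply/eqP => /(congr1 (fun f => pcoef f 0%N)) /= /eqP; rewrite oner_eq0.
Qed.

HB.instance Definition _ := GRing.Zmodule_isComNzRing.Build (pseries F)
  ps_mulA ps_mulC ps_mul1 ps_mulDl ps_1neq0.

Lemma pcoef0 n : pcoef (0 : pseries F) n = 0. Proof. by []. Qed.
Lemma pcoefD f g n : pcoef (f + g) n = pcoef f n + pcoef g n. Proof. by []. Qed.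
Lemma pcoefN f n : pcoef (- f) n = - pcoef f n. Proof. by []. Qed.
Lemma pcoef1 n : pcoef (1 : pseries F) n = (n == 0%N)%:R.
Proof. by rewrite /= ; case: eqP. Qed.
Lemma pcoefM f g n :
  pcoef (f * g) n = \sum_(i < n.+1) pcoef f i * pcoef g (n - i)%N.
Proof. by []. Qed.
Lemma pcoef_sum (I : Type) (r : seq I) (P : pred I) (G : I -> pseries F) n :
  pcoef (\sum_(i <- r | P i) G i) n = \sum_(i <- r | P i) pcoef (G i) n.
Proof. by elim/big_ind2: _ => // f a g b <- <-. Qed.

Lemma pcoef_exp_small h m n :
  pcoef h 0 = 0 -> (n < m)%N -> pcoef (h ^+ m) n = 0.
Proof.
move=> h0; elim: m n => // m IH n nm; rewrite exprS pcoefM big1// => -[i /= ilt] _.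
case: i ilt => [|i] ilt; first by rewrite h0 mul0r.
by rewrite IH ?mulr0//; lia.
Qed.

Definition ps_unit : {pred pseries F} := fun f => pcoef f 0%N != 0.

Lemma ps_inv_ex f : exists g, f \in ps_unit -> g * f = 1.
Proof.
have [f0|] := boolP (f \in ps_unit); last by exists 0.
pose c := pcoef f 0.
pose h : pseries F := 1 - ps_const c^-1 * f.
have h0 : pcoef h 0 = 0.
  by rewrite /h pcoefD pcoefN pcoefM big_ord1 /= mulVf ?subrr.
pose g : pseries F := PSeries (fun k => pcoef (\sum_(j < k.+1) h ^+ j) k).
exists (ps_const c^-1 * g) => _.
suff : (1 - h) * g = 1 by rewrite /h opprB addrC subrK mulrAC => <-; rewrite mulrAC.
apply: pseriesP => k.
have gE i : (i <= k)%N -> pcoef g i = pcoef (\sum_(j < k.+1) h ^+ j) i.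
  move=> ik /=; rewrite !pcoef_sum.
  rewrite -(big_mkord predT (fun j => pcoef (h ^+ j) i)).
  rewrite -(big_mkord predT (fun j => pcoef (h ^+ j) i)).
  rewrite [RHS](@big_cat_nat _ _ _ i.+1)//=.
  rewrite [X in _ = _ + X]big_nat_cond [X in _ = _ + X]big1 ?addr0//.
  by move=> j /andP[/andP[ij _] _]; exact: pcoef_exp_small.
transitivity (pcoef ((1 - h) * \sum_(j < k.+1) h ^+ j) k).
  by rewrite !pcoefM; apply: eq_bigr => i _; rewrite gE// leq_subr.
rewrite -opprB mulNr -subrX1 opprB pcoefD pcoefN pcoef_exp_small// subr0.
by [].
Qed.

Definition ps_inv f :=
  if f \in ps_unit then projT1 (cid (ps_inv_ex f)) else f.

Fact ps_mulV : {in ps_unit, left_inverse 1 ps_inv *%R}.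
Proof. by move=> f fu; rewrite /ps_inv; case: cid => /= g gP; rewrite fu gP. Qed.
Fact ps_unitPl f g : g * f = 1 -> ps_unit f.
Proof.
move=> /(congr1 (fun f => pcoef f 0%N)); rewrite pcoefM big_ord1 pcoef1 /=.
rewrite /ps_unit => e; apply: contra_eq_neq e => ->.
by rewrite mulr0 eq_sym oner_eq0.
Qed.
Fact ps_inv_out : {in [predC ps_unit], ps_inv =1 id}.
Proof. by move=> f; rewrite inE /ps_inv => fu; case: ifP => // fu1; rewrite fu1 in fu. Qed.

HB.instance Definition _ := GRing.ComNzRing_hasMulInverse.Build (pseries F)
  ps_mulV ps_unitPl ps_inv_out.

End PowerSeries.

(* [lcoef f n] is the coefficient of [t ^ n]; it vanishes for large [n]. *)
Record laurent (F : fieldType) := Laurent {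
  lcoef : int -> F;
  lcoef_bounded : exists N : int, forall n, N < n -> lcoef n = 0 }.

HB.instance Definition _ (F : fieldType) := gen_eqMixin (laurent F).
HB.instance Definition _ (F : fieldType) := gen_choiceMixin (laurent F).

Section LaurentSeries.
Variable F : fieldType.
Implicit Types f g h : laurent F.

Lemma laurentP f g : (forall n, lcoef f n = lcoef g n) -> f = g.
Proof.
case: f g => [f fP] [g gP] /= /funext fg; rewrite fg in fP *.
by congr Laurent; exact: Prop_irrelevance.
Qed.

Lemma fsum_int (G : int -> F) (e : nat -> int) k : injective e ->
    (forall i, (forall j, (j < k)%N -> i != e j) -> G i = 0) ->
  \sum_(i \in [set: int]) G i = \sum_(j < k) G (e j).
Proof.
move=> einj G0.
rewrite -(big_mkord predT (fun j => G (e j))) -(big_map e predT G).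
rewrite [RHS](@bigfs _ _ _ _ _ predT) ?map_inj_uniq ?iota_uniq //.
  by apply: eq_fsbigl; apply/seteqP; split.
move=> i _ ie; apply: G0 => j jk; apply: contraNneq ie => ->.
by rewrite map_f// mem_index_iota.
Qed.

Fact lmul_bounded f g : exists N : int, forall n, N < n ->
  \sum_(i \in [set: int]) lcoef f i * lcoef g (n - i) = 0.
Proof.
case: f g => [f [N fN]] [g [M gM]] /=; exists (N + M) => n nNM.
apply: fsbig1 => i _; have [iN|iN] := ltP N i; first by rewrite fN ?mul0r.
by rewrite gM ?mulr0//; lia.
Qed.
Fact ladd_bounded f g :
  exists N : int, forall n, N < n -> lcoef f n + lcoef g n = 0.
Proof.
case: f g => [f [N fN]] [g [M gM]] /=; exists (Num.max N M) => n.
by rewrite gt_max => /andP[Nn Mn]; rewrite fN ?gM ?addr0.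
Qed.
Fact lopp_bounded f : exists N : int, forall n, N < n -> - lcoef f n = 0.
Proof. by case: f => [f [N fN]] /=; exists N => n Nn; rewrite fN ?oppr0. Qed.
Fact lconst_bounded (c : F) :
  exists N : int, forall n, N < n -> (if n == 0 then c else 0) = 0.
Proof. by exists 0 => n; case: eqP => // ->; rewrite ltxx. Qed.

Definition l_add f g := Laurent (ladd_bounded f g).
Definition l_opp f := Laurent (lopp_bounded f).
Definition l_const c := Laurent (lconst_bounded c).
(* A finitely supported sum: [fsbigop] returns 0 on infinite support. *)
Definition l_mul f g := Laurent (lmul_bounded f g).

Fact l_addA : associative l_add.
Proof. by move=> f g h; apply: laurentP => n /=; rewrite addrA. Qed.
Fact l_addC : commutative l_add.
Proof. by move=> f g; apply: laurentP => n /=; rewrite addrC. Qed.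
Fact l_add0 : left_id (l_const 0) l_add.
Proof. by move=> f; apply: laurentP => n /=; case: ifP; rewrite add0r. Qed.
Fact l_addN : left_inverse (l_const 0) l_opp l_add.
Proof. by move=> f; apply: laurentP => n /=; case: ifP; rewrite addNr. Qed.

HB.instance Definition _ :=
  GRing.isZmodule.Build (laurent F) l_addA l_addC l_add0 l_addN.

(* [shift N p] is [t ^ N * p(t^-1)]. *)
Fact shift_bounded (N : int) (p : pseries F) : exists M : int, forall n, M < n ->
  (if n <= N then pcoef p `|(N - n)%R|%N else 0) = 0.
Proof. by exists N => n; rewrite ltNge => /negbTE ->. Qed.
Definition shift N p := Laurent (shift_bounded N p).

Lemma shift_exists f : exists N p, f = shift N p.
Proof.
case: (f) => [c [N cN]]; exists N, (PSeries (fun k => c (N - k%:Z))).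
apply: laurentP => n /=; case: leP => [nN|]; last exact: cN.
by congr c; lia.
Qed.

Lemma shiftD N p q : shift N (p + q) = shift N p + shift N q.
Proof. by apply: laurentP => n /=; case: leP; rewrite ?addr0. Qed.

Lemma shiftM N M p q : l_mul (shift N p) (shift M q) = shift (N + M) (p * q).
Proof.
apply: laurentP => n /=; case: leP => [nNM|nNM]; last first.
  apply: fsbig1 => i _; case: leP => [iN|]; last by rewrite mul0r.
  by case: leP => [?|]; [lia|rewrite mulr0].
rewrite (@fsum_int _ (fun j => N - j%:Z) `|(N + M - n)%R|%N.+1).
- apply: eq_bigr => -[j /= jlt] _; rewrite !ifT; [|lia..].
  by congr (pcoef _ _ * pcoef _ _); lia.
- by move=> i j ij; lia.
- move=> i ei; case: leP => [iN|]; last by rewrite mul0r.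
  case: leP => [niM|]; last by rewrite mulr0.
  have jlt : (`|(N - i)%R| < `|(N + M - n)%R|.+1)%N by lia.
  by move: (ei _ jlt) => /eqP; lia.
Qed.

Lemma shift1 : shift 0 1 = l_const 1.
Proof.
apply: laurentP => n /=; case: (eqVneq n 0) => [->//|n0].
by case: ifP => // nle; rewrite ifF//; apply/eqP; lia.
Qed.

Lemma shift_raise N (k : nat) p : exists q, shift N p = shift (N + k%:Z) q.
Proof.
exists (PSeries (fun j => if (k <= j)%N then pcoef p (j - k) else 0)).
apply: laurentP => n /=; case: leP => nN.
  rewrite !ifT; [|lia..].
  by congr (pcoef _ _); lia.
by case: leP => // nNk; rewrite ifF//; lia.
Qed.

Lemma shift_common f g : exists N p q, f = shift N p /\ g = shift N q.
Proof.
have [N [p ->]] := shift_exists f; have [M [q ->]] := shift_exists g.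
case: (leP N M) => NM.
  have [p' ->] := shift_raise N `|(M - N)%R|%N p.
  exists M, p', q; split=> //; congr shift; lia.
have [q' ->] := shift_raise M `|(N - M)%R|%N q.
exists N, p, q'; split=> //; congr shift; lia.
Qed.

Fact l_mulA : associative l_mul.
Proof.
move=> f g h; have [N [p ->]] := shift_exists f.
have [M [q ->]] := shift_exists g; have [L [r ->]] := shift_exists h.
by rewrite !shiftM addrA mulrA.
Qed.
Fact l_mulC : commutative l_mul.
Proof.
move=> f g; have [N [p ->]] := shift_exists f.
by have [M [q ->]] := shift_exists g; rewrite !shiftM addrC mulrC.
Qed.
Fact l_mul1 : left_id (l_const 1) l_mul.
Proof.
by move=> f; have [N [p ->]] := shift_exists f; rewrite -shift1 shiftM add0r mul1r.
Qed.
Fact l_mulDl : left_distributive l_mul l_add.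
Proof.
move=> f g h; have [N [p [q [-> ->]]]] := shift_common f g.
have [M [r ->]] := shift_exists h.
by rewrite -[l_add _ _]shiftD !shiftM mulrDl shiftD.
Qed.
Fact l_1neq0 : l_const 1 != 0.
Proof.
by apply/eqP => /(congr1 (fun f => lcoef f 0)) /= /eqP; rewrite oner_eq0.
Qed.

HB.instance Definition _ := GRing.Zmodule_isComNzRing.Build (laurent F)
  l_mulA l_mulC l_mul1 l_mulDl l_1neq0.

Lemma lcoefD f g n : lcoef (f + g) n = lcoef f n + lcoef g n. Proof. by []. Qed.
Lemma lcoefN f n : lcoef (- f) n = - lcoef f n. Proof. by []. Qed.
Lemma lcoef0 n : lcoef (0 : laurent F) n = 0. Proof. by rewrite /=; case: ifP. Qed.
Lemma lcoef1 n : lcoef (1 : laurent F) n = (n == 0)%:R.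
Proof. by rewrite /=; case: ifP. Qed.
Lemma lcoefM f g n :
  lcoef (f * g) n = \sum_(i \in [set: int]) lcoef f i * lcoef g (n - i).
Proof. by []. Qed.

Lemma l_inv_ex f : exists g, f != 0 -> g * f = 1.
Proof.
have [->|f0] := eqVneq f 0; first by exists 0.
have [N [p fE]] := shift_exists f.
have [k pk] : exists k, pcoef p k != 0.
  apply: contrapT => /forallNP p0; move/eqP: f0; apply; rewrite fE.
  apply: laurentP => n; rewrite lcoef0 /=.
  by case: leP => // _; apply/eqP; apply: contrapT => /negP; exact: p0.
have kex : exists k, pcoef p k != 0 by exists k.
pose m := ex_minn kex.
have [pm mmin] : pcoef p m != 0 /\ forall j, (j < m)%N -> pcoef p j = 0.
  rewrite /m; case: ex_minnP => i pi imin; split=> // j ji.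
  by apply/eqP; apply: contrapT => /negP /imin; lia.
have {}fE : f = shift (N - m%:Z) (PSeries (fun j => pcoef p (j + m)%N)).
  rewrite fE; apply: laurentP => n /=; case: leP => nN.
    case: leP => [nNm|nNm]; first by congr (pcoef _ _); lia.
    by apply: mmin; lia.
  by rewrite ifF//; lia.
set q := PSeries _ in fE.
have qu : q \is a GRing.unit by rewrite /in_mem /= /ps_unit /= add0n.
exists (shift (m%:Z - N) q^-1) => _; rewrite fE [LHS]shiftM mulVr//.
by rewrite addrA subrK subrr; exact: shift1.
Qed.

Definition l_inv f := if f == 0 then 0 else sval (cid (l_inv_ex f)).

Fact l_mulV f : f != 0 -> l_inv f * f = 1.
Proof.
move=> f0; have := svalP (cid (l_inv_ex f)) f0.
by rewrite /l_inv ifN.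
Qed.
Fact l_inv0 : l_inv 0 = 0. Proof. by rewrite /l_inv ifT. Qed.

HB.instance Definition _ :=
  GRing.ComNzRing_isField.Build (laurent F) l_mulV l_inv0.

End LaurentSeries.

Section Embeddings.
Variable F : fieldType.

Fact laurent_of_pseries_bounded (p : pseries F) : exists N : int,
  forall n, N < n -> (if n <= 0 then pcoef p `|n|%N else 0) = 0.
Proof. by exists 0 => n; rewrite ltNge => /negbTE ->. Qed.
Definition laurent_of_pseries p := Laurent (laurent_of_pseries_bounded p).

Lemma laurent_of_pseriesE p : laurent_of_pseries p = shift 0 p.
Proof.
by apply: laurentP => n /=; case: leP => // n0; congr (pcoef _ _); lia.
Qed.

Fact laurent_of_pseries_zmod_morphism : zmod_morphism laurent_of_pseries.
Proof.
move=> p q; apply: laurentP => n; rewrite lcoefD lcoefN /=.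
by case: leP; rewrite ?subr0.
Qed.
Fact laurent_of_pseries_monoid_morphism : monoid_morphism laurent_of_pseries.
Proof.
split=> [|p q]; first by rewrite laurent_of_pseriesE; exact: shift1.
by rewrite !laurent_of_pseriesE [RHS]shiftM addr0.
Qed.
HB.instance Definition _ := GRing.isZmodMorphism.Build (pseries F) (laurent F)
  laurent_of_pseries laurent_of_pseries_zmod_morphism.
HB.instance Definition _ := GRing.isMonoidMorphism.Build (pseries F) (laurent F)
  laurent_of_pseries laurent_of_pseries_monoid_morphism.

Fact laurent_of_poly_bounded (p : {poly F}) : exists N : int,
  forall n, N < n -> (if n is Posz k then p`_k else 0) = 0.
Proof.
exists (size p)%:Z => -[k|//]; rewrite ltz_nat => pk.
by rewrite nth_default// ltnW.
Qed.
Definition laurent_of_poly p := Laurent (laurent_of_poly_bounded p).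

Fact laurent_of_poly_zmod_morphism : zmod_morphism laurent_of_poly.
Proof.
move=> p q; apply: laurentP => n; rewrite lcoefD lcoefN /=.
by case: n => k; rewrite ?coefB ?subr0.
Qed.
Fact laurent_of_poly_monoid_morphism : monoid_morphism laurent_of_poly.
Proof.
split=> [|p q]; apply: laurentP => n.
  by rewrite lcoef1 /=; case: n => // k; rewrite coef1.
rewrite lcoefM; case: n => k; last first.
  by rewrite [RHS]fsbig1// => -[i|i] _ /=; rewrite ?mul0r//= NegzE;
    case E: (_ - _) => [j|j]; rewrite ?mulr0//; lia.
rewrite (@fsum_int _ _ Posz k.+1).
- rewrite /= coefM; apply: eq_bigr => -[i /= ik] _.
  by rewrite subzn.
- by move=> i j [].
- move=> [i|i] ei; last by rewrite mul0r.
  rewrite /=; case E: (_ - _) => [j|j]; rewrite ?mulr0//.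
  by have /ei/eqP : (i < k.+1)%N by lia.
Qed.
HB.instance Definition _ := GRing.isZmodMorphism.Build {poly F} (laurent F)
  laurent_of_poly laurent_of_poly_zmod_morphism.
HB.instance Definition _ := GRing.isMonoidMorphism.Build {poly F} (laurent F)
  laurent_of_poly laurent_of_poly_monoid_morphism.

Definition laurent_t : laurent F := laurent_of_poly 'X.

Lemma laurent_t_neq0 : laurent_t != 0.
Proof.
apply/eqP => /(congr1 (fun f => lcoef f 1)); rewrite lcoef0 /= coefX.
by move/eqP; rewrite oner_eq0.
Qed.

End Embeddings.

Record GL (n : nat) (R : comUnitRingType) :=
  MkGL { gl_mx :> 'M[R]_n; gl_unit : gl_mx \in unitmx }.

HB.instance Definition _ n R := [isSub for @gl_mx n R].
HB.instance Definition _ n R := [Choice of GL n R by <:].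

Section GLGroup.
Variables (n : nat) (R : comUnitRingType).
Implicit Types A B C : GL n R.

Fact gl_mul_unit A B : gl_mx A *m gl_mx B \in unitmx.
Proof. by rewrite unitmx_mul !gl_unit. Qed.
Fact gl_inv_unit A : invmx (gl_mx A) \in unitmx.
Proof. by rewrite unitmx_inv gl_unit. Qed.

Definition gl_one : GL n R := MkGL (unitmx1 R n).
Definition gl_mul A B := MkGL (gl_mul_unit A B).
Definition gl_inv A := MkGL (gl_inv_unit A).

Fact gl_mulA : associative gl_mul.
Proof. by move=> A B C; apply: val_inj; rewrite /= mulmxA. Qed.
Fact gl_mul1 : left_id gl_one gl_mul.
Proof. by move=> A; apply: val_inj; rewrite /= mul1mx. Qed.
Fact gl_mulr1 : right_id gl_one gl_mul.
Proof. by move=> A; apply: val_inj; rewrite /= mulmx1. Qed.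
Fact gl_mulV : left_inverse gl_one gl_inv gl_mul.
Proof. by move=> A; apply: val_inj; rewrite /= mulVmx ?gl_unit. Qed.
Fact gl_mulrV : right_inverse gl_one gl_inv gl_mul.
Proof. by move=> A; apply: val_inj; rewrite /= mulmxV ?gl_unit. Qed.

HB.instance Definition _ :=
  isGroup.Build (GL n R) gl_mulA gl_mul1 gl_mulr1 gl_mulV gl_mulrV.

Definition pgl_equiv A B : bool :=
  `[< exists2 c : R, c \is a GRing.unit & gl_mx B = c *: gl_mx A >].

Fact pgl_equiv_refl : reflexive pgl_equiv.
Proof. by move=> A; apply/asboolP; exists 1; rewrite ?unitr1 ?scale1r. Qed.
Fact pgl_equiv_sym : symmetric pgl_equiv.
Proof.
move=> A B; apply/idP/idP => /asboolP[c cu AB]; apply/asboolP;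
  by exists c^-1; rewrite ?unitrV// AB scalerA mulVr// scale1r.
Qed.
Fact pgl_equiv_trans : transitive pgl_equiv.
Proof.
move=> B A C /asboolP[c cu AB] /asboolP[d du BC]; apply/asboolP.
by exists (d * c); rewrite ?unitrMl// BC AB scalerA.
Qed.
Canonical pgl_equiv_rel :=
  EquivRel pgl_equiv pgl_equiv_refl pgl_equiv_sym pgl_equiv_trans.

Definition PGL : Type := {eq_quot pgl_equiv_rel}%qT.
HB.instance Definition _ := Choice.on PGL.
HB.instance Definition _ := EqQuotient.on PGL.

Definition pgl A : PGL := (\pi_PGL A)%qT.

Lemma pglP A B :
  pgl A = pgl B <-> exists2 c : R, c \is a GRing.unit & gl_mx B = c *: gl_mx A.
Proof. by split=> [/eqmodP/asboolP//|AB]; apply/eqmodP/asboolP. Qed.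

Lemma pgl_repr (x : PGL) : pgl (repr x) = x.
Proof. exact: reprK. Qed.

Definition pgl_mul (x y : PGL) : PGL := pgl (repr x * repr y)%g.
Definition pgl_inv (x : PGL) : PGL := pgl (repr x)^-1%g.

Lemma pgl_mulE A B : pgl_mul (pgl A) (pgl B) = pgl (A * B)%g.
Proof.
have [c cu /= cE] := (pglP _ _).1 (pgl_repr (pgl A)).
have [d du /= dE] := (pglP _ _).1 (pgl_repr (pgl B)).
apply/pglP; exists (c * d); first by rewrite unitrMl.
by rewrite /= cE dE -scalemxAl -scalemxAr scalerA.
Qed.
Lemma pgl_invE A : pgl_inv (pgl A) = pgl A^-1%g.
Proof.
have [c cu /= cE] := (pglP _ _).1 (pgl_repr (pgl A)).
apply/pglP; exists c^-1; first by rewrite unitrV.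
by rewrite /= cE invmxZ// -cE gl_unit.
Qed.

Fact pgl_mulA : associative pgl_mul.
Proof.
move=> x y z; rewrite -(pgl_repr x) -(pgl_repr y) -(pgl_repr z) !pgl_mulE.
by rewrite mulgA.
Qed.
Fact pgl_mul1 : left_id (pgl 1%g) pgl_mul.
Proof. by move=> x; rewrite -(pgl_repr x) pgl_mulE mul1g. Qed.
Fact pgl_mulr1 : right_id (pgl 1%g) pgl_mul.
Proof. by move=> x; rewrite -(pgl_repr x) pgl_mulE mulg1. Qed.
Fact pgl_mulV : left_inverse (pgl 1%g) pgl_inv pgl_mul.
Proof. by move=> x; rewrite -(pgl_repr x) pgl_invE pgl_mulE mulVg. Qed.
Fact pgl_mulrV : right_inverse (pgl 1%g) pgl_inv pgl_mul.
Proof. by move=> x; rewrite -(pgl_repr x) pgl_invE pgl_mulE mulgV. Qed.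

HB.instance Definition _ :=
  isGroup.Build PGL pgl_mulA pgl_mul1 pgl_mulr1 pgl_mulV pgl_mulrV.

Lemma pgl1 : pgl 1%g = 1%g. Proof. by []. Qed.
Lemma pglM A B : pgl (A * B)%g = (pgl A * pgl B)%g.
Proof. by rewrite -pgl_mulE. Qed.
Lemma pglV A : pgl A^-1%g = (pgl A)^-1%g.
Proof. by rewrite -pgl_invE. Qed.

End GLGroup.

Section PGLMap.
Variables (n : nat) (R S : comUnitRingType) (f : {rmorphism R -> S}).

Fact gl_map_unit (A : GL n R) : map_mx f (gl_mx A) \in unitmx.
Proof. by rewrite unitmxE det_map_mx rmorph_unit// -unitmxE gl_unit. Qed.
Definition gl_map (A : GL n R) : GL n S := MkGL (gl_map_unit A).

Lemma gl_mapM A B : gl_map (A * B)%g = (gl_map A * gl_map B)%g.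
Proof. by apply: val_inj; rewrite /= map_mxM. Qed.
Lemma gl_map1 : gl_map 1%g = 1%g.
Proof. by apply: val_inj; rewrite /= map_mx1. Qed.

Definition pgl_map (x : PGL n R) : PGL n S := pgl (gl_map (repr x)).

Lemma pgl_mapE A : pgl_map (pgl A) = pgl (gl_map A).
Proof.
have [c cu /= cE] := (pglP _ _).1 (pgl_repr (pgl A)).
apply/pglP; exists (f c); first exact: rmorph_unit.
by rewrite /= cE map_mxZ.
Qed.
Lemma pgl_map1 : pgl_map 1%g = 1%g.
Proof. by rewrite -pgl1 pgl_mapE gl_map1. Qed.
Lemma pgl_mapM x y : pgl_map (x * y)%g = (pgl_map x * pgl_map y)%g.
Proof.
by rewrite -(pgl_repr x) -(pgl_repr y) -pglM !pgl_mapE gl_mapM pglM.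
Qed.
Lemma pgl_mapV x : pgl_map x^-1%g = (pgl_map x)^-1%g.
Proof. by apply: (mulgI (pgl_map x)); rewrite -pgl_mapM !mulgV pgl_map1. Qed.

End PGLMap.

Section DoubleCosets.
Local Open Scope group_scope.
Variable G : groupType.
Implicit Types (a g x y : G) (H K M : set G).

Definition is_subgroup H :=
  [/\ H 1, forall x y, H x -> H y -> H (x * y) & forall x, H x -> H x^-1].

Definition dcoset H K g : set G := [set h * g * k | h in H & k in K].

(* [H \ G / K], as the set of the subsets [H g K] of [G]. *)
Definition dcosets H K : Type := range (dcoset H K).
HB.instance Definition _ H K := Choice.on (dcosets H K).

Definition to_dcosets H K g : dcosets H K :=
  SigSub (mem_set (imageT (dcoset H K) g)).

Lemma to_dcosets_surj H K (x : dcosets H K) : exists g, x = to_dcosets H K g.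
Proof.
by case: x => X /[dup] /set_mem [g _ gX] XP; exists g; exact: val_inj.
Qed.

Definition dcosets_repr H K (x : dcosets H K) : G :=
  sval (cid (to_dcosets_surj x)).

Lemma dcosets_reprK H K (x : dcosets H K) : to_dcosets H K (dcosets_repr x) = x.
Proof. by rewrite /dcosets_repr; case: cid. Qed.

Lemma to_dcosets_eq H K g g' : is_subgroup H -> is_subgroup K ->
  to_dcosets H K g = to_dcosets H K g' <->
  exists h k, [/\ H h, K k & g' = h * g * k].
Proof.
move=> [H1 HM HV] [K1 KM KV]; split=> [/(congr1 val)/= e|[h [k [Hh Kk ->]]]].
  have : dcoset H K g' g' by exists 1 => //; exists 1 => //; rewrite mul1g mulg1.
  by rewrite -e => -[h Hh [k Kk <-]]; exists h, k.
apply: val_inj; apply/seteqP; split=> /= x [a Ha [b Kb <-]].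
  exists (a * h^-1); first by apply: HM => //; exact: HV.
  exists (k^-1 * b); first by apply: KM => //; exact: KV.
  by rewrite !mulgA mulgVK mulgK.
exists (a * h); first exact: HM.
by exists (k * b); [exact: KM|rewrite !mulgA].
Qed.

(* Meant for [M] contained in [K]: see [dcosets_projE]. *)
Definition dcosets_proj H M K (x : dcosets H M) : dcosets H K :=
  to_dcosets H K (dcosets_repr x).

Lemma dcosets_projE H M K g : is_subgroup H -> is_subgroup M -> is_subgroup K ->
  M `<=` K -> dcosets_proj K (to_dcosets H M g) = to_dcosets H K g.
Proof.
move=> sH sM sK MK; apply/(to_dcosets_eq _ _ sH sK).
have /(to_dcosets_eq _ _ sH sM)[h [m [Hh Mm {1}->]]] :=
  dcosets_reprK (to_dcosets H M g).
by exists h, m; split=> //; exact: MK.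
Qed.

(* Meant for [a] centralised by [M]: see [dcosets_rmulE]. *)
Definition dcosets_rmul H M a (x : dcosets H M) : dcosets H M :=
  to_dcosets H M (dcosets_repr x * a).

Lemma dcosets_rmulE H M a g : is_subgroup H -> is_subgroup M ->
  (forall m, M m -> m * a = a * m) ->
  dcosets_rmul a (to_dcosets H M g) = to_dcosets H M (g * a).
Proof.
move=> sH sM Ma; apply/(to_dcosets_eq _ _ sH sM).
have /(to_dcosets_eq _ _ sH sM)[h [m [Hh Mm {1}->]]] :=
  dcosets_reprK (to_dcosets H M g).
by exists h, m; split=> //; rewrite -(mulgA _ m a) (Ma m)// !mulgA.
Qed.

End DoubleCosets.

Section GeodesicFlow.
Variable F : fieldType.

Definition G3 := PGL 3 (laurent F).
HB.instance Definition _ := Group.on G3.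

Definition Gamma : set G3 := range (pgl_map (@laurent_of_poly F)).
Definition K3 : set G3 := range (pgl_map (@laurent_of_pseries F)).

(* The matrices with zero entries (0,1), (0,2), (1,0), (2,0). *)
Definition block_shape (R : nzRingType) (A : 'M[R]_3) :=
  forall i j, (i == 0) != (j == 0) -> A i j = 0.

Definition M3 : set G3 :=
  [set pgl_map (@laurent_of_pseries F) (pgl A) | A in
    [set A : GL 3 (pseries F) | block_shape A]].

Definition a_mx : 'M[laurent F]_3 :=
  diag_mx (\row_(i < 3) if i == 0 then laurent_t F else 1).

Fact a_mx_unit : a_mx \in unitmx.
Proof.
rewrite unitmxE det_diag unitfE; apply/prodf_neq0 => i _.
by rewrite mxE; case: ifP => _; rewrite ?laurent_t_neq0 ?oner_neq0.
Qed.

Definition a_elt : G3 := pgl (MkGL a_mx_unit).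

Lemma Gamma_subgroup : is_subgroup Gamma.
Proof.
split.
- by exists 1%g => //; rewrite pgl_map1.
- by move=> _ _ [x _ <-] [y _ <-]; exists (x * y)%g; rewrite ?pgl_mapM.
- by move=> _ [x _ <-]; exists x^-1%g; rewrite ?pgl_mapV.
Qed.

Lemma K3_subgroup : is_subgroup K3.
Proof.
split.
- by exists 1%g => //; rewrite pgl_map1.
- by move=> _ _ [x _ <-] [y _ <-]; exists (x * y)%g; rewrite ?pgl_mapM.
- by move=> _ [x _ <-]; exists x^-1%g; rewrite ?pgl_mapV.
Qed.

Lemma M3_sub_K3 : M3 `<=` K3.
Proof. by move=> _ [A _ <-]; exists (pgl A). Qed.

Lemma block_shapeP (R : comUnitRingType) (A : 'M[R]_3) :
  block_shape A <-> A *m delta_mx 0 0 = delta_mx 0 0 *m A.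
Proof.
pose e : 'rV[R]_3 := \row_i (i == 0)%:R.
have -> : delta_mx 0 0 = diag_mx e.
  apply/matrixP => i j; rewrite !mxE.
  have [->|ij] := eqVneq i j; first by rewrite andbb.
  by case: eqP => // i0; case: eqP => // j0; rewrite i0 j0 eqxx in ij.
rewrite mul_mx_diag mul_diag_mx; split=> [Ash|/matrixP AE i j ij].
  apply/matrixP => i j; rewrite !mxE.
  have [ij|/eqP/eqP ij] := eqVneq (i == 0) (j == 0); first by rewrite ij mulrC.
  by rewrite Ash// mulr0 mul0r.
have := AE i j; rewrite !mxE; move: ij.
by case: (i == 0); case: (j == 0) => //= _; rewrite !(mulr1, mul1r, mulr0, mul0r).
Qed.

Lemma M3_subgroup : is_subgroup M3.
Proof.
split.
- exists 1%g; last by rewrite pgl1 pgl_map1.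
  by apply/block_shapeP; rewrite mul1mx mulmx1.
- move=> _ _ [A /block_shapeP Ash <-] [B /block_shapeP Bsh <-].
  exists (A * B)%g; last by rewrite pglM pgl_mapM.
  by apply/block_shapeP; rewrite -mulmxA Bsh !mulmxA Ash.
- move=> _ [A /block_shapeP Ash <-]; exists A^-1%g; last by rewrite pglV pgl_mapV.
  apply/block_shapeP; have Au := gl_unit A.
  have /esym := congr1 (fun B => invmx A *m B *m invmx A) Ash.
  by rewrite mulKmx// -(mulmxA (invmx A)) mulmxK.
Qed.

Lemma M3_centralises_a m : M3 m -> (m * a_elt = a_elt * m)%g.
Proof.
move=> [A Ash <-]; rewrite pgl_mapE -!pglM; congr pgl; apply: val_inj => /=.
apply/matrixP => i j; rewrite mul_mx_diag mul_diag_mx !mxE.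
have [ij|/eqP/eqP ij] := eqVneq (i == 0) (j == 0); first by rewrite ij mulrC.
by rewrite Ash// rmorph0 mulr0 mul0r.
Qed.

Definition flow_space := dcosets Gamma M3.
Definition vertex_space := dcosets Gamma K3.
HB.instance Definition _ := Choice.on flow_space.
HB.instance Definition _ := Choice.on vertex_space.

Definition T_a : flow_space -> flow_space := dcosets_rmul a_elt.
Definition pi_K : flow_space -> vertex_space := @dcosets_proj _ Gamma M3 K3.
Definition origin : vertex_space := to_dcosets Gamma K3 1%g.

Lemma T_aE g : T_a (to_dcosets Gamma M3 g) = to_dcosets Gamma M3 (g * a_elt)%g.
Proof.
exact: (dcosets_rmulE _ Gamma_subgroup M3_subgroup M3_centralises_a).
Qed.
Lemma pi_KE g : pi_K (to_dcosets Gamma M3 g) = to_dcosets Gamma K3 g.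
Proof.
exact: (dcosets_projE _ Gamma_subgroup M3_subgroup K3_subgroup M3_sub_K3).
Qed.

Definition is_min (P : nat -> Prop) (n : nat) :=
  P n /\ forall k, P k -> (n <= k)%N.

Definition first_return_cycles (n : nat) : set flow_space :=
  [set x | [/\ pi_K x = origin, iter n T_a x = x &
    is_min (fun k => (0 < k)%N /\ pi_K (iter k T_a x) = origin) n]].

Definition cycles (n : nat) (v : vertex_space) : set flow_space :=
  [set x | pi_K x = v /\ iter n T_a x = x].

Section Entropy.
Variable R : realType.
Local Open Scope ereal_scope.

Definition nb_first_return_cycles (n : nat) : \bar R := counting (first_return_cycles n).
Definition nb_cycles (n : nat) (v : vertex_space) : \bar R := counting (cycles n v).

Definition gurevich_entropy (v : vertex_space) : \bar R :=
  limn (fun n => ((3 * n)%:R^-1)%:E * lne (nb_cycles (3 * n) v)).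

End Entropy.
End GeodesicFlow.

(* Main.v *)
(** Write [t] for the variable, [E] for [diag(1,0,0)] and [Pi] for
[diag(0,1,1)].  A cycle at the base point of length [n] exists only for
[n = 3 k]: it is an element of [GL_3(F[t])] conjugate, by some [kappa] in
[GL_3(O)], to [(t^(2k) E + t^-k Pi) m] with [m] in [M], and it determines
[kappa M].  Its inverse has degree [<= k] with leading matrix conjugate to
[m^-1 Pi], so up to constant matrices cycles correspond to the elements of
[SB_k], the set of [B] in [SL_3(F[t])] of degree [<= k] with leading matrix
[Pi]; conversely each such [B] gives a cycle by lifting the idempotent [E].

The union of the [SB_k] is a free graded monoid, and a factorization
[B = B2 B1] means that the cycle of [B] meets the base point earlier, so first
return cycles correspond to indecomposable elements.  If
[|SB_(k+1)| = lambda |SB_k|] for [k >= 1], the renewal equation of the free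
monoid shows that the indecomposables of degree [k] number
[s_1 (lambda - s_1)^(k-1)], where [s_1 = |SB_1| > 0].

This exact geometric growth holds with [lambda = q^6].  Taking the first row of
[B^-1] identifies [SB_k] with the rows [w] of degree [2k] with leading vector
[e_1] that are orthogonal to no nonzero vector of degree [< k].  Such [w] are
primitive, and a bad primitive [w] is orthogonal to a unique normalized
primitive vector of degree [a < k]; counting these pairs gives
[|SB_k| = q^(6k-3) (q-1)^2 (q+1)].  Hence the entropy is [2 log q] and the
first return cycles grow at rate [log(q^5 + q^4 - q^3) / 3]. *)

Require Import Defs.
From HB Require Import structures.
From mathcomp Require Import all_boot all_order all_algebra.
From mathcomp Require Import all_classical all_reals all_analysis.
From mathcomp Require Import finmap zify ring lra.
(* [mathcomp.analysis] also has a [pseries]. *)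
Import Defs.

Set Implicit Arguments.
Unset Strict Implicit.
Unset Printing Implicit Defensive.

Import Order.TTheory GRing.Theory Num.Theory.

Local Open Scope classical_set_scope.
Local Open Scope ring_scope.

(** * Cardinals of finite sets *)
Section Counting.
Implicit Types T U : choiceType.

(** Infinite sets get the value 0, as [fset_set] sends them to the empty set; hence the finiteness
    carried by the counting lemmas. *)
Definition nb T (A : set T) : nat := #|` fset_set A|%fset.

Lemma nb_card T U (A : set T) (B : set U) :
  finite_set A -> (A #= B)%card -> nb A = nb B.
Proof.
move=> /finite_setP[n An] AB; rewrite /nb (card_fset_set An).
have Bn : (B #= `I_n)%card by apply: card_eq_trans An; rewrite card_eq_sym.
by rewrite (card_fset_set Bn).
Qed.

Lemma nb_le T (A B : set T) : finite_set B -> A `<=` B -> (nb A <= nb B)%N.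
Proof.
move=> Bf AB; apply: fsubset_leq_card; rewrite -fset_set_sub//.
exact: sub_finite_set Bf.
Qed.

Lemma nb_image T U (f : T -> U) (A : set T) : finite_set A ->
  (forall x y, A x -> A y -> f x = f y -> x = y) -> nb (f @` A) = nb A.
Proof.
move=> Af finj; apply: nb_card; first exact: finite_image.
by apply: inj_card_eq => x y /set_mem Ax /set_mem Ay; exact: finj.
Qed.

Lemma nb_inj T U (f : T -> U) (A : set T) (B : set U) : finite_set B ->
  (forall x, A x -> B (f x)) ->
  (forall x y, A x -> A y -> f x = f y -> x = y) ->
  finite_set A /\ (nb A <= nb B)%N.
Proof.
move=> Bf AB finj.
have sAB : f @` A `<=` B by move=> _ [x Ax <-]; exact: AB.
have Af : finite_set A.
  rewrite -(@eq_finite_set _ _ (f @` A)); first exact: sub_finite_set Bf.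
  by apply: inj_card_eq => x y /set_mem Ax /set_mem Ay; exact: finj.
by split=> //; rewrite -(nb_image Af finj) nb_le.
Qed.

Lemma nb_bij T U (f : T -> U) (A : set T) (B : set U) : finite_set A ->
  (forall x, A x -> B (f x)) ->
  (forall x y, A x -> A y -> f x = f y -> x = y) ->
  (forall y, B y -> exists2 x, A x & f x = y) -> nb A = nb B.
Proof.
move=> Af AB finj fsurj; rewrite -(nb_image Af finj); congr nb.
by apply/seteqP; split=> [_ [x Ax <-]|y /fsurj[x Ax <-]]; [exact: AB|exists x].
Qed.

Lemma nbX T U (A : set T) (B : set U) : finite_set A -> finite_set B ->
  nb (A `*` B) = (nb A * nb B)%N.
Proof.
move=> Af Bf; rewrite /nb fset_setX// -(size_allpairs pair); apply: perm_size.
apply: uniq_perm => [||u]; first exact: fset_uniq.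
  by apply: allpairs_uniq => [||[x y] [x' y']]; rewrite ?fset_uniq.
rewrite in_fsetM; apply/andP/allpairsP => [[u1 u2]|[[x y] /= [xA yB ->]]] //.
by exists u; rewrite u1 u2; case: u {u1 u2}.
Qed.

Lemma nbD T (A B : set T) : finite_set B -> A `<=` B ->
  nb B = (nb A + nb (B `\` A))%N.
Proof.
move=> Bf AB; have Af := sub_finite_set AB Bf.
rewrite /nb fset_setD// cardfsDS ?subnKC//; last by rewrite -fset_set_sub.
by apply: fsubset_leq_card; rewrite -fset_set_sub.
Qed.

Lemma nbU T (A B : set T) : finite_set A -> finite_set B -> A `&` B `<=` set0 ->
  nb (A `|` B) = (nb A + nb B)%N.
Proof.
move=> Af Bf AB; rewrite (@nbD _ A); last 2 first.
- by rewrite finite_setU.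
- exact: subsetUl.
congr (_ + nb _)%N; apply/seteqP; split=> [x [[]//]|x Bx].
by split; [right|move=> Ax; exact: (AB x)].
Qed.

Lemma nb0 T : nb (@set0 T) = 0%N.
Proof. by rewrite /nb fset_set0 cardfs0. Qed.

Lemma nb1 T (x : T) : nb [set x] = 1%N.
Proof. by rewrite /nb fset_set1 cardfs1. Qed.

Lemma nb_gt0 T (A : set T) x : finite_set A -> A x -> (0 < nb A)%N.
Proof.
by move=> Af Ax; rewrite -(nb1 x) nb_le// => _ ->.
Qed.

Lemma nb_bigcup T (A : nat -> set T) n : (forall j, (j < n)%N -> finite_set (A j)) ->
  (forall i j, (i < j < n)%N -> A i `&` A j `<=` set0) ->
  finite_set [set x | exists2 j, (j < n)%N & A j x] /\
  nb [set x | exists2 j, (j < n)%N & A j x] = (\sum_(j < n) nb (A j))%N.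
Proof.
elim: n => [|n IH] Af dis.
  rewrite (_ : mkset _ = set0); first by rewrite big_ord0 nb0.
  by apply/seteqP; split=> x // [].
have [fin nbE] : _ /\ _ := IH (fun j jn => Af j (ltnW jn))
  (fun i j ijn => dis i j ltac:(lia)).
rewrite big_ord_recr/= -nbE (_ : mkset _ = [set x | exists2 j, (j < n)%N & A j x] `|` A n).
  split; first by rewrite finite_setU; split=> //; exact: Af.
  rewrite nbU//; first exact: Af.
  by move=> x [[j jn Ajx] Anx]; apply: (dis j n) => //; lia.
apply/seteqP; split=> [x [j]|x [[j jn Ajx]|Anx]].
- by rewrite ltnS leq_eqVlt => /predU1P[->|]; [right|left; exists j].
- by exists j => //; lia.
- by exists n.
Qed.

Lemma nb_setT (T : finType) (A : {pred T}) : nb [set` A] = #|A|.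
Proof.
rewrite /nb -card_finset; congr (#|` _|); apply/fsetP => x.
rewrite in_fset_set; last exact: finite_finpred.
rewrite mem_setE inE. by [].
Qed.

(** Pigeonhole: the complement of the image has cardinal 0. In [row_good_solve] it turns injectivity
    of a linear form into solvability. *)
Lemma nb_inj_surj T U (f : T -> U) (A : set T) (B : set U) :
  finite_set B -> (nb B <= nb A)%N -> (forall x, A x -> B (f x)) ->
  (forall x y, A x -> A y -> f x = f y -> x = y) ->
  forall y, B y -> exists2 x, A x & f x = y.
Proof.
move=> Bf BA AB finj.
have [Af _] := nb_inj Bf AB finj.
have fAB : f @` A `<=` B by move=> _ [x Ax <-]; exact: AB.
have := nbD Bf fAB; rewrite (nb_image Af finj) => nbE.
have D0 : B `\` f @` A = set0.
  have [//|/set0P[y Dy]] := eqVneq (B `\` f @` A) set0.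
  by have := nb_gt0 (finite_setD _ Bf) Dy; lia.
move=> y By; apply: contrapT => nfy.
have : (B `\` f @` A) y by split=> // -[x Ax fxy]; apply: nfy; exists x.
by rewrite D0.
Qed.

End Counting.

(** * Degrees of polynomial matrices *)
Section MatrixDegree.
Variable F : fieldType.

Lemma coefM_top (p q : {poly F}) d e : (size p <= d.+1)%N -> (size q <= e.+1)%N ->
  (size (p * q)%R <= (d + e).+1)%N /\ (p * q)`_(d + e) = p`_d * q`_e.
Proof.
move=> pd qe; split.
  by apply: leq_trans (size_polyMleq _ _) _; lia.
have dlt : (d < (d + e).+1)%N by lia.
rewrite coefM (bigD1 (Ordinal dlt))//= addKn big1 ?addr0// => i.
rewrite -val_eqE /= => id.
have [di|di] := ltnP d i.
  by rewrite (_ : p`_i = 0) ?mul0r//; apply/leq_sizeP: di; exact: pd.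
have pos : (i < d)%N by rewrite ltn_neqAle id.
by rewrite [q`_(_ - _)]nth_default ?mulr0//; apply: leq_trans qe _; lia.
Qed.

(** Sizes rather than degrees: [mxsz k.+1] means degree at most [k], and [mxsz 0] forces the zero
    matrix. *)
Definition mxsz m n (d : nat) (A : 'M[{poly F}]_(m, n)) : Prop :=
  forall i j, (size (A i j) <= d)%N.

Definition mxcoef m n (d : nat) (A : 'M[{poly F}]_(m, n)) : 'M[F]_(m, n) :=
  map_mx (fun p : {poly F} => p`_d) A.

Lemma mxszW m n d e (A : 'M[{poly F}]_(m, n)) : (d <= e)%N -> mxsz d A -> mxsz e A.
Proof. by move=> de Ad i j; apply: leq_trans (Ad i j) de. Qed.

Lemma mxszD m n d (A B : 'M[{poly F}]_(m, n)) : mxsz d A -> mxsz d B -> mxsz d (A + B).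
Proof.
move=> Ad Bd i j; rewrite mxE; apply: leq_trans (size_polyD _ _) _.
by rewrite geq_max Ad Bd.
Qed.

Lemma mxszN m n d (A : 'M[{poly F}]_(m, n)) : mxsz d A -> mxsz d (- A).
Proof. by move=> Ad i j; rewrite mxE size_polyN. Qed.

Lemma mxszB m n d (A B : 'M[{poly F}]_(m, n)) : mxsz d A -> mxsz d B -> mxsz d (A - B).
Proof. by move=> Ad Bd; apply: mxszD => //; exact: mxszN. Qed.

Lemma mxcoefD m n d (A B : 'M[{poly F}]_(m, n)) : mxcoef d (A + B) = mxcoef d A + mxcoef d B.
Proof. by apply/matrixP => i j; rewrite !mxE coefD. Qed.

Lemma mxcoefN m n d (A : 'M[{poly F}]_(m, n)) : mxcoef d (- A) = - mxcoef d A.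
Proof. by apply/matrixP => i j; rewrite !mxE coefN. Qed.

Lemma mxcoefB m n d (A B : 'M[{poly F}]_(m, n)) : mxcoef d (A - B) = mxcoef d A - mxcoef d B.
Proof. by rewrite mxcoefD mxcoefN. Qed.

Lemma mxszM m n p d e (A : 'M[{poly F}]_(m, n)) (B : 'M[{poly F}]_(n, p)) :
  mxsz d.+1 A -> mxsz e.+1 B -> mxsz (d + e).+1 (A *m B).
Proof.
move=> Ad Be i j; rewrite mxE; apply: (leq_trans (size_sum _ _ _)).
by apply/bigmax_leqP => l _; have [] := coefM_top (Ad i l) (Be l j).
Qed.

Lemma mxcoefM m n p d e (A : 'M[{poly F}]_(m, n)) (B : 'M[{poly F}]_(n, p)) :
  mxsz d.+1 A -> mxsz e.+1 B -> mxcoef (d + e) (A *m B) = mxcoef d A *m mxcoef e B.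
Proof.
move=> Ad Be; apply/matrixP => i j; rewrite !mxE coef_sum.
by apply: eq_bigr => l _; have [_ ->] := coefM_top (Ad i l) (Be l j); rewrite !mxE.
Qed.

Lemma mxcoef_default m n d e (A : 'M[{poly F}]_(m, n)) : mxsz d A -> (d <= e)%N ->
  mxcoef e A = 0.
Proof.
move=> Ad de; apply/matrixP => i j; rewrite !mxE nth_default//.
exact: leq_trans (Ad i j) de.
Qed.

Lemma mxsz_coef0 m n d (A : 'M[{poly F}]_(m, n)) : mxsz d.+1 A -> mxcoef d A = 0 -> mxsz d A.
Proof.
move=> Ad /matrixP A0 i j; apply/leq_sizeP => l; rewrite leq_eqVlt => /predU1P[<-|dl].
  by have := A0 i j; rewrite !mxE.
by rewrite nth_default//; exact: leq_trans (Ad i j) dl.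
Qed.

Lemma mxsz0P m n (A : 'M[{poly F}]_(m, n)) : mxsz 0 A -> A = 0.
Proof.
by move=> A0; apply/matrixP => i j; apply/eqP; rewrite mxE -size_poly_leq0.
Qed.

Lemma mxsz_ex m n (A : 'M[{poly F}]_(m, n)) : exists d, mxsz d A.
Proof.
exists (\max_i \max_j size (A i j)) => i j.
by apply: leq_trans (leq_bigmax _) ; exact: (@leq_bigmax _ (fun j => size (A i j))).
Qed.

Lemma mx_lead m n (A : 'M[{poly F}]_(m, n)) : A != 0 ->
  exists2 d, mxsz d.+1 A & mxcoef d A != 0.
Proof.
have [d] := mxsz_ex A; elim: d => [/mxsz0P ->|d IH Ad A0]; first by rewrite eqxx.
have [c0|] := eqVneq (mxcoef d A) 0; last by exists d.
by apply: IH => //; exact: mxsz_coef0.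
Qed.

Lemma mxszZX m n d k (A : 'M[{poly F}]_(m, n)) : mxsz d A -> mxsz (k + d) ('X^k *: A).
Proof.
move=> Ad i j; rewrite mxE; have [->|A0] := eqVneq (A i j) 0.
  by rewrite mulr0 size_poly0.
by rewrite mulrC size_mulXn// leq_add2l.
Qed.

Lemma mxcoefZX m n d k (A : 'M[{poly F}]_(m, n)) : mxcoef (k + d) ('X^k *: A) = mxcoef d A.
Proof.
by apply/matrixP => i j; rewrite !mxE mulrC coefMXn ltnNge leq_addr/= addKn.
Qed.

Definition cstmx m n (A : 'M[F]_(m, n)) : 'M[{poly F}]_(m, n) := map_mx polyC A.

Lemma mxsz_cst m n (A : 'M[F]_(m, n)) : mxsz 1 (cstmx A).
Proof. by move=> i j; rewrite mxE size_polyC; case: eqP. Qed.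

Lemma mxcoef_cst m n (A : 'M[F]_(m, n)) : mxcoef 0 (cstmx A) = A.
Proof. by apply/matrixP => i j; rewrite !mxE coefC. Qed.

Lemma mxsz_Xcst m n d (A : 'M[F]_(m, n)) : mxsz d.+1 ('X^d *: cstmx A).
Proof. by rewrite -addn1; apply: mxszZX; exact: mxsz_cst. Qed.

Lemma mxcoef_Xcst m n d (A : 'M[F]_(m, n)) : mxcoef d ('X^d *: cstmx A) = A.
Proof. by rewrite -{1}(addn0 d) mxcoefZX mxcoef_cst. Qed.

Lemma mxsz_cstP m n (A : 'M[{poly F}]_(m, n)) : mxsz 1 A -> A = cstmx (mxcoef 0 A).
Proof. by move=> A1; apply/matrixP => i j; rewrite !mxE; exact: size1_polyC. Qed.

Lemma cstmxM m n p (A : 'M[F]_(m, n)) (B : 'M[F]_(n, p)) :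
  cstmx (A *m B) = cstmx A *m cstmx B.
Proof. exact: map_mxM. Qed.

Lemma cstmx1 n : cstmx 1%:M = 1%:M :> 'M[{poly F}]_n.
Proof. exact: map_mx1. Qed.

End MatrixDegree.

(** * Counting polynomial matrices by degree and leading matrix *)

Section CountMatrices.
Variable F : finFieldType.
Local Notation q := #|F|.

Lemma nb_mxsz m n d :
  finite_set [set A : 'M[{poly F}]_(m, n) | mxsz d A] /\
  nb [set A : 'M[{poly F}]_(m, n) | mxsz d A] = (q ^ (d * (m * n)))%N.
Proof.
pose f (M : 'M['rV[F]_d]_(m, n)) : 'M[{poly F}]_(m, n) := map_mx rVpoly M.
have fE : [set A : 'M[{poly F}]_(m, n) | mxsz d A] = f @` [set: 'M['rV[F]_d]_(m, n)].
  apply/seteqP; split=> [A Ad|_ [M _ <-] i j]; last by rewrite mxE; exact: size_poly.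
  exists (map_mx poly_rV A) => //; apply/matrixP => i j.
  by rewrite !mxE; exact: poly_rV_K.
rewrite fE; split; first by apply: finite_image; exact: finite_finset.
rewrite nb_image; [|exact: finite_finset|].
  rewrite (_ : setT = [set` 'M['rV[F]_d]_(m, n)]); last by apply/seteqP; split.
  by rewrite nb_setT !card_mx mul1n -expnM.
move=> M N _ _ /matrixP MN; apply/matrixP => i j.
by have := MN i j; rewrite !mxE => /(can_inj rVpolyK).
Qed.

(** Subtracting the term of degree [d] leaves an arbitrary matrix of lower degree, independent of
    the leading one. *)
Lemma nb_lead m n d (L : set 'M[F]_(m, n)) :
  finite_set [set A | mxsz d.+1 A /\ L (mxcoef d A)] /\
  nb [set A | mxsz d.+1 A /\ L (mxcoef d A)] = (nb L * q ^ (d * (m * n)))%N.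
Proof.
have [fin nbE] := nb_mxsz m n d.
have Lf : finite_set L by exact: finite_finset.
split.
  apply: sub_finite_set (nb_mxsz m n d.+1).1 => A; exact: proj1.
rewrite -nbE -nbX//; apply/esym.
pose f (x : 'M[F]_(m, n) * 'M[{poly F}]_(m, n)) := 'X^d *: cstmx x.1 + x.2.
have fc x : mxsz d x.2 -> mxcoef d (f x) = x.1.
  by move=> x2; rewrite mxcoefD mxcoef_Xcst (mxcoef_default x2)// addr0.
apply: (@nb_bij _ _ f).
- exact: finite_setX.
- move=> x [/= Lx xd]; split; last by rewrite fc.
  by apply: mxszD; [exact: mxsz_Xcst|exact: mxszW xd].
- move=> x y [_ xd] [_ yd] xy.
  have e1 : x.1 = y.1 by rewrite -(fc x)// -(fc y)// xy.
  by case: x y {xd yd} xy e1 => [x1 x2] [y1 y2] xy /= e1; move: xy; rewrite /f /= e1 => /addrI ->.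
- move=> A [Ad LA]; exists (mxcoef d A, A - 'X^d *: cstmx (mxcoef d A)).
    split=> //=; apply: mxsz_coef0.
      by apply: mxszB => //; exact: mxsz_Xcst.
    by rewrite mxcoefB mxcoef_Xcst subrr.
  by rewrite /f /= addrC subrK.
Qed.

End CountMatrices.

(** * The graded monoid *)
Lemma det_mx22 (R : comNzRingType) (M : 'M[R]_2) :
  \det M = M 0 0 * M 1 1 - M 0 1 * M 1 0.
Proof.
rewrite (expand_det_row _ 0) !big_ord_recl big_ord0 addr0 /cofactor !det_mx11 !mxE.
rewrite /= expr0 mul1r add0n expr1 mulN1r mulrN; congr (_ * M _ _ - M _ _ * M _ _);
  by apply/val_inj.
Qed.

Section BlockIdempotents.
Variable R : comNzRingType.

Definition E0 : 'M[R]_3 := delta_mx 0 0.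
Definition Pi0 : 'M[R]_3 := 1%:M - E0.

Lemma E0E : E0 *m E0 = E0.
Proof. by rewrite /E0 mul_delta_mx. Qed.
Lemma E0Pi0 : E0 *m Pi0 = 0.
Proof. by rewrite mulmxBr mulmx1 E0E subrr. Qed.
Lemma Pi0E0 : Pi0 *m E0 = 0.
Proof. by rewrite mulmxBl mul1mx E0E subrr. Qed.
Lemma Pi0Pi0 : Pi0 *m Pi0 = Pi0.
Proof. by rewrite {1}/Pi0 mulmxBl mul1mx E0Pi0 subr0. Qed.
Lemma Pi0DE0 : Pi0 + E0 = 1%:M.
Proof. by rewrite subrK. Qed.

Lemma adj_Pi0 : \adj Pi0 = E0.
Proof.
apply/matrixP => i j; rewrite !mxE /cofactor det_mx22 !mxE.
case: i => [[|[|[|//]]] ?]; case: j => [[|[|[|//]]] ?] /=;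
by rewrite ?(mulr0, mul0r, subr0, sub0r, subrr, mulr1, oppr0, expr0, mulr1n, mulr0n).
Qed.
End BlockIdempotents.

Arguments E0 {R}.
Arguments Pi0 {R}.

Section Monoid.
Variable F : fieldType.
Implicit Types B C : 'M[{poly F}]_3.

(** The entries of the adjugate are signed 2 by 2 minors, so they are quadratic in the entries of
    [B]: the degree doubles and the top coefficient is the same minor of the leading matrix. *)
Lemma mxcoef_adj k B : mxsz k.+1 B ->
  mxsz (k + k).+1 (\adj B) /\ mxcoef (k + k) (\adj B) = \adj (mxcoef k B).
Proof.
move=> Bk.
have key i j : (size (\adj B i j) <= (k + k).+1)%N /\
    (\adj B i j)`_(k + k) = \adj (mxcoef k B) i j.
  rewrite !mxE /cofactor !det_mx22 !mxE.
  set s := (j + i)%N.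
  have sE (p : {poly F}) : (-1) ^+ s * p = ((-1) ^+ s)%:P * p.
    by rewrite polyC_exp polyCN.
  set a := B _ _; set b := B _ _; set c := B _ _; set d := B _ _.
  have [ab1 ab2] := coefM_top (Bk _ _ : size a <= k.+1)%N (Bk _ _ : size b <= k.+1)%N.
  have [cd1 cd2] := coefM_top (Bk _ _ : size c <= k.+1)%N (Bk _ _ : size d <= k.+1)%N.
  rewrite sE; split; last by rewrite coefCM coefB ab2 cd2.
  rewrite mul_polyC; apply: leq_trans (size_scale_leq _ _) _.
  apply: leq_trans (size_polyD _ _) _; rewrite size_polyN.
  by rewrite geq_max ab1 cd1.
split=> [i j|]; first by case: (key i j).
by apply/matrixP => i j; rewrite mxE; case: (key i j).
Qed.

Definition SB k : set 'M[{poly F}]_3 :=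
  [set B | [/\ mxsz k.+1 B, mxcoef k B = Pi0 & \det B = 1]].

Lemma SB_adj k B : SB k B -> [/\ mxsz (k + k).+1 (\adj B),
  mxcoef (k + k) (\adj B) = E0, B *m \adj B = 1%:M & \adj B *m B = 1%:M].
Proof.
move=> [Bk Bc Bd]; have [ak ac] := mxcoef_adj Bk.
by split=> //; rewrite ?mul_mx_adj ?mul_adj_mx ?Bd// ac Bc adj_Pi0.
Qed.

Lemma SBM j k B C : SB j B -> SB k C -> SB (j + k) (B *m C).
Proof.
move=> [Bj Bc Bd] [Ck Cc Cd]; split; first exact: mxszM.
  by rewrite (mxcoefM Bj Ck) Bc Cc Pi0Pi0.
by rewrite det_mulmx Bd Cd mulr1.
Qed.

(* Two factorizations of one element are nested: the matrix [N] below is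
   monic, and [(B1' B1^-1) N] has small degree since
   [(B1' B1^-1) B1 = B1'] and [(B1' B1^-1) B2^-1 = B2'^-1]. *)
Lemma SB_nested j k j' k' B1 B2 B1' B2' : (j <= j')%N -> (j + k = j' + k')%N ->
  SB j B1 -> SB k B2 -> SB j' B1' -> SB k' B2' -> B2 *m B1 = B2' *m B1' ->
  exists C, [/\ B1' = C *m B1, mxsz (j' - j).+1 C,
    j = j' -> C = 1%:M & (j < j')%N -> SB (j' - j) C].
Proof.
move=> jj' jk S1 S2 S1' S2' BB.
have [sA1 cA1 rA1 lA1] := SB_adj S1; have [sA2 cA2 rA2 lA2] := SB_adj S2.
have [sA2' cA2' rA2' lA2'] := SB_adj S2'.
case: (S1) => [s1 c1 d1]; case: (S1') => [s1' c1' d1'].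
pose C := B1' *m \adj B1; exists C.
have CB1 : C *m B1 = B1' by rewrite -mulmxA lA1 mulmx1.
have CA2 : C *m \adj B2 = \adj B2'.
  rewrite -[LHS]mul1mx -lA2' -mulmxA -[RHS]mulmx1; congr (_ *m _).
  by rewrite !mulmxA -BB -[_ *m B1 *m _]mulmxA rA1 mulmx1 rA2.
pose m := (k + k + j)%N.
(* The [Pi0] columns of [B1] have leading matrix [Pi0] in degree [j], the [E0] column of the inverse
   of [B2] has leading matrix [E0] in degree [k + k]; the two powers of ['X] align both at degree
   [m], where they add up to the identity. *)
pose N : 'M[{poly F}]_3 := 'X^(k + k) *: (B1 *m cstmx Pi0) + 'X^j *: (\adj B2 *m cstmx E0).
have cP := mxcoef_cst (Pi0 : 'M[F]_3); have sP := mxsz_cst (Pi0 : 'M[F]_3).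
have cE := mxcoef_cst (E0 : 'M[F]_3); have sE := mxsz_cst (E0 : 'M[F]_3).
have NS : mxsz m.+1 N.
  apply: mxszD.
    by rewrite /m -addnS; apply: mxszZX; have := mxszM s1 sP; rewrite addn0.
  by rewrite /m addnC -addnS; apply: mxszZX; have := mxszM sA2 sE; rewrite addn0.
have NC : mxcoef m N = 1%:M.
  rewrite mxcoefD {1}/m mxcoefZX /m addnC mxcoefZX.
  have := mxcoefM s1 sP; rewrite addn0 => ->; have := mxcoefM sA2 sE; rewrite addn0 => ->.
  by rewrite c1 cP cA2 cE Pi0Pi0 E0E Pi0DE0.
have CN : C *m N = 'X^(k + k) *: (B1' *m cstmx Pi0) + 'X^j *: (\adj B2' *m cstmx E0).
  by rewrite mulmxDr -!scalemxAr !mulmxA CB1 CA2.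
pose d := (j' - j)%N.
have P1s : mxsz (d + m).+1 ('X^(k + k) *: (B1' *m cstmx Pi0)).
  rewrite (_ : (d + m).+1 = (k + k + j'.+1)%N); last by rewrite /d /m; lia.
  by apply: mxszZX; have := mxszM s1' sP; rewrite addn0.
have P1c : mxcoef (d + m) ('X^(k + k) *: (B1' *m cstmx Pi0)) = Pi0.
  rewrite (_ : (d + m) = (k + k + j'))%N; last by rewrite /d /m; lia.
  by rewrite mxcoefZX; have := mxcoefM s1' sP; rewrite addn0 c1' cP Pi0Pi0.
have P2s : mxsz (j + (k' + k').+1) ('X^j *: (\adj B2' *m cstmx E0)).
  by apply: mxszZX; have := mxszM sA2' sE; rewrite addn0.
have P2c : mxcoef (j + (k' + k')) ('X^j *: (\adj B2' *m cstmx E0)) = E0.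
  by rewrite mxcoefZX; have := mxcoefM sA2' sE; rewrite addn0 cA2' cE E0E.
have CNs : mxsz (d + m).+1 (C *m N).
  by rewrite CN; apply: mxszD => //; apply: mxszW P2s; rewrite /d /m; lia.
(* Multiplying by the monic [N] cannot cancel the leading matrix of [C], so the degree of [C *m N]
   bounds that of [C]. *)
have Cs : mxsz d.+1 C.
  have [->|C0] := eqVneq C 0; first by move=> a b; rewrite mxE size_poly0.
  have [e Ce Cne] := mx_lead C0.
  have [ed|de] := leqP e d; first exact: mxszW Ce.
  have := mxcoefM Ce NS; rewrite NC mulmx1 (mxcoef_default CNs); last by lia.
  by move=> ce0; rewrite -ce0 eqxx in Cne.
have Cc : mxcoef d C = mxcoef (d + m) (C *m N) by rewrite (mxcoefM Cs NS) NC mulmx1.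
have Cdet : \det C = 1.
  by have := congr1 determinant CB1; rewrite det_mulmx d1 d1' mulr1.
(* The [E0] summand of [C *m N] has degree [j + 2 k'], which falls short of [d + m] by [3 (j' - j)].
   It reaches the top degree exactly when [j = j'], giving leading matrix 1; otherwise only [Pi0]
   remains. *)
split=> // [jj|jj].
- move: Cs Cc; rewrite CN mxcoefD P1c (_ : d = 0)%N; last by rewrite /d; lia.
  rewrite (_ : (0 + m) = (j + (k' + k')))%N; last by rewrite /m; lia.
  by rewrite P2c Pi0DE0 => Cs Cc; rewrite (mxsz_cstP Cs) Cc cstmx1.
- split=> //; rewrite -/d Cc CN mxcoefD P1c (mxcoef_default P2s) ?addr0//.
  by rewrite /d /m; lia.
Qed.

(** In degree 0 the matrix would be the constant [Pi0], which is singular because [Pi0 *m E0 = 0]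
    with [E0] its adjugate. *)
Lemma SB_neq0 B : SB 0 B -> False.
Proof.
move=> [B0 Bc Bd]; have := Bd; rewrite (mxsz_cstP B0) Bc det_map_mx.
have -> : \det (Pi0 : 'M[F]_3) = 0; last by rewrite rmorph0 => /esym/eqP; rewrite oner_eq0.
have /matrixP/(_ 0 0) := mul_mx_adj (Pi0 : 'M[F]_3).
by rewrite adj_Pi0 Pi0E0 !mxE eqxx mulr1n.
Qed.

End Monoid.

(** * Renewal *)
Section Renewal.
Variable F : finFieldType.
Implicit Types B C : 'M[{poly F}]_3.

Lemma finite_SB k : finite_set (@SB F k).
Proof. by apply: sub_finite_set (nb_mxsz F 3 3 k.+1).1 => B []. Qed.

Definition indec k : set 'M[{poly F}]_3 :=
  [set B | SB k B /\ forall j B1 B2, (0 < j < k)%N ->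
     SB j B1 -> SB (k - j) B2 -> B <> B2 *m B1].

Lemma finite_indec k : finite_set (indec k).
Proof. by apply: sub_finite_set (finite_SB k) => B []. Qed.

Lemma indec_gt0 k B : indec k B -> (0 < k)%N.
Proof. by case: k => // -[/SB_neq0]. Qed.

(** A decomposable element is split at its right factor of least degree. That factor is
    indecomposable, and [SB_nested] makes it the only indecomposable right factor, so the products
    over different [j] are disjoint and each is counted once. *)
Lemma nb_SB_renewal k :
  nb (@SB F k) = (nb (indec k) + \sum_(j < k) nb (indec j) * nb (@SB F (k - j)))%N.
Proof.
pose f (x : 'M[{poly F}]_3 * 'M[{poly F}]_3) := x.2 *m x.1.
pose A j := f @` (indec j `*` SB (k - j)).
have fin j : finite_set (indec j `*` @SB F (k - j)).
  by apply: finite_setX; [exact: finite_indec|exact: finite_SB].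
have Af j : finite_set (A j) by exact: finite_image.
have nbA j : (j < k)%N -> nb (A j) = (nb (indec j) * nb (@SB F (k - j)))%N.
  move=> jk; rewrite /A nb_image//; last first.
    move=> [B1 B2] [B1' B2'] [/= [S1 _] S2] [/= [S1' _] S2'] BB.
    have [C [CB _ C1 _]] := SB_nested (leqnn j) (erefl _) S1 S2 S1' S2' BB.
    have B11 : B1' = B1 by rewrite CB C1// mul1mx.
    congr pair; first by rewrite B11.
    have [_ _ AB _] := SB_adj S1.
    have := congr1 (fun X => X *m \adj B1) BB.
    by rewrite /f /= B11 -!mulmxA AB !mulmx1.
  by rewrite nbX//; [exact: finite_indec|exact: finite_SB].
(* If indecomposable right factors of degrees [i < j] divided the same element, [SB_nested] would
   factor the longer one. *)
have dis i j : (i < j < k)%N -> A i `&` A j `<=` set0.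
  move=> /andP[ij jk] _ [[[B1 B2] [/= I1 S2] <-] [[B1' B2'] [/= I1' S2'] BB]].
  have [S1 _] := I1; have [S1' N1'] := I1'.
  have ijk : (i + (k - i) = j + (k - j))%N by lia.
  have [C [CB _ _ Sc]] := SB_nested (ltnW ij) ijk S1 S2 S1' S2' (esym BB).
  by apply: (N1' i B1 C) => //; [rewrite (indec_gt0 I1)|exact: Sc].
have [Uf UE] := nb_bigcup (fun j _ => Af j) dis.
rewrite (@nbD _ (indec k) (SB k)); [|exact: finite_SB|by move=> B []].
congr addn; transitivity (\sum_(j < k) nb (A j))%N; last first.
  by apply: eq_bigr => j _; exact: nbA.
rewrite -UE; congr nb; apply/seteqP; split=> [B [SkB nB]|B [j jk [[B1 B2] [/= I1 S2] <-]]].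
  pose P j := `[< exists B1 B2, [/\ (0 < j < k)%N, SB j B1, SB (k - j) B2 & B = B2 *m B1] >].
  have exP : exists j, P j.
    apply: contrapT => nP; apply: nB; split=> // j B1 B2 jk S1 S2 BE.
    by apply: nP; exists j; apply/asboolP; exists B1, B2.
  case: (ex_minnP exP) => j /asboolP[B1 [B2 [jk S1 S2 BE]]] jmin.
  exists j; first by lia.
  exists (B1, B2) => //; split=> //; split=> //= i C1 C2 ij SC1 SC2 B1E.
  (* A factorization of [B1] regroups into one of [B] with a right factor of smaller degree, against
     minimality of [j]. *)
  suff /jmin : P i by lia.
  apply/asboolP; exists C1, (B2 *m C2); split=> //; first by lia.
    by rewrite (_ : (k - i = (k - j) + (j - i))%N); [exact: SBM|lia].
  by rewrite BE B1E mulmxA.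
have [S1 _] := I1; have j0 := indec_gt0 I1; split.
  by rewrite -(subnK (ltnW jk)); exact: SBM.
by move=> [_ /(_ j B1 B2)]; apply => //; rewrite j0.
Qed.

(** Compare the renewal equation at [k.+1] with [lam] times the one at [k]: all terms of index below
    [k] agree, which leaves a recursion of depth one. *)
Lemma nb_indecS (lam : nat) : (forall k, (0 < k)%N -> nb (@SB F k.+1) = (lam * nb (@SB F k))%N) ->
  forall k, (0 < k)%N ->
  (nb (indec k.+1) + nb (@SB F 1) * nb (indec k) = lam * nb (indec k))%N.
Proof.
move=> sS k k0; have := nb_SB_renewal k.+1; rewrite sS// big_ord_recr/=.
rewrite {1}(nb_SB_renewal k) mulnDr big_distrr/= subSnn.
rewrite (eq_bigr (fun j : 'I_k => nb (indec j) * nb (@SB F (k.+1 - j)))%N); first by lia.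
by move=> j _; rewrite subSn ?(ltnW (ltn_ord j))// sS ?subn_gt0//; lia.
Qed.

Lemma nb_indecE (lam : nat) : (forall k, (0 < k)%N -> nb (@SB F k.+1) = (lam * nb (@SB F k))%N) ->
  (nb (@SB F 1) <= lam)%N ->
  forall k, nb (indec k.+1) = (nb (@SB F 1) * (lam - nb (@SB F 1)) ^ k)%N.
Proof.
move=> sS s1 ; elim=> [|k IH].
  by rewrite muln1 (nb_SB_renewal 1) big_ord1 (_ : nb (indec 0) = 0)%N ?mul0n ?addn0//;
  rewrite (_ : indec 0 = set0) ?nb0//; apply/seteqP; split=> // B /indec_gt0.
have := nb_indecS sS (ltn0Sn k); rewrite IH expnS => e.
rewrite mulnCA mulnBl -e; lia.
Qed.

End Renewal.

(** * First rows of inverses *)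
Section FirstRow.
Variable F : finFieldType.
Local Notation q := #|F|.

Definition row_good k : set 'rV[{poly F}]_3 :=
  [set w | [/\ mxsz (k + k).+1 w, mxcoef (k + k) w = row 0 E0 &
    forall c : 'cV[{poly F}]_3, mxsz k c -> w *m c = 0 -> c = 0]].

Lemma mxsz_row m n d i (A : 'M[{poly F}]_(m, n)) : mxsz d A -> mxsz d (row i A).
Proof. by move=> Ad a b; rewrite mxE. Qed.
Lemma mxcoef_row m n d i (A : 'M[{poly F}]_(m, n)) : mxcoef d (row i A) = row i (mxcoef d A).
Proof. by apply/matrixP => a b; rewrite !mxE. Qed.

(** Multiplication by [w] maps columns of degree [< k] injectively into polynomials of degree
    [< 3 k]; both sets have [q ^ (3 k)] elements, so it is onto. *)
Lemma row_good_solve k w (p : {poly F}) : (0 < k)%N -> row_good k w -> (size p <= 3 * k)%N ->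
  exists2 c : 'cV[{poly F}]_3, mxsz k c & w *m c = p%:M.
Proof.
move=> k0 [ws wc winj] ps.
have [fA nA] := nb_mxsz F 3 1 k; have [fB nB] := nb_mxsz F 1 1 (3 * k).
apply: (@nb_inj_surj _ _ (fun c : 'cV_3 => w *m c) _ _ fB).
- by rewrite nA nB; rewrite leq_eqVlt; apply/orP; left; apply/eqP; congr (_ ^ _)%N; lia.
- move=> c ck; rewrite /mkset (_ : 3 * k = (k + k + k.-1).+1)%N; last by lia.
  by apply: mxszM => //; rewrite prednK.
- move=> c c' ck ck' cc'; apply/eqP; rewrite -subr_eq0; apply/eqP.
  by apply: winj; [exact: mxszB|rewrite mulmxBr cc' subrr].
- by move=> i j; rewrite !ord1 mxE mulr1n.
Qed.

(** If the first row of the inverse kills [c], then [c = B *m d] where [d] has first entry 0. The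
    leading matrix [Pi0] of [B] fixes that of [d], so [c] has degree at least [k] unless [d = 0]. *)
Lemma SB_row_good k B : SB k B -> row_good k (row 0 (\adj B)).
Proof.
move=> SkB; have [sA cA rA lA] := SB_adj SkB; have [sB cB dB] := SkB.
split; [exact: mxsz_row|by rewrite mxcoef_row cA|].
move=> c ck wc; pose d := \adj B *m c.
have cE : c = B *m d by rewrite mulmxA rA mul1mx.
have d0 : E0 *m d = 0.
  apply/matrixP => i j; rewrite mxE [RHS]mxE big1// => l _; rewrite mxE.
  case: eqP => [_|]; last by rewrite mul0r.
  case: eqP => [->|]; last by rewrite mul0r.
  by rewrite mul1r; have /matrixP/(_ 0 j) := wc; rewrite -row_mul !mxE => ->.
have [d00|dn0] := eqVneq d 0; first by rewrite cE d00 mulmx0.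
have [e de dne] := mx_lead dn0.
have d0c : E0 *m mxcoef e d = 0.
  have := mxcoefM (mxsz_cst E0) de; rewrite mxcoef_cst => <-.
  by rewrite /cstmx map_delta_mx -/E0 d0; apply/matrixP => i j; rewrite !mxE coef0.
have := mxcoefM sB de; rewrite -cE cB (mxcoef_default ck) ?leq_addr//.
rewrite mulmxBl mul1mx d0c subr0 => e0; by rewrite -e0 eqxx in dne.
Qed.

(** Two matrices with the same first row of the inverse differ by a matrix of degree [< k] killed by
    a good row, hence are equal. Conversely, a good [w] determines [B] by solving
    [w *m B = row 0 E0] column by column. *)
Lemma nb_SB_row_good k : (0 < k)%N -> nb (@SB F k) = nb (row_good k).
Proof.
move=> k0; apply: (@nb_bij _ _ (fun B => row 0 (\adj B))).
- exact: finite_SB.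
- exact: SB_row_good.
- move=> B B' SkB SkB' ww.
  have [_ _ winj] := SB_row_good SkB.
  have [_ _ _ lA] := SB_adj SkB; have [_ _ _ lA'] := SB_adj SkB'.
  have [sB cB _] := SkB; have [sB' cB' _] := SkB'.
  have Bs : mxsz k (B - B').
    by apply: mxsz_coef0; [exact: mxszB|rewrite mxcoefB cB cB' subrr].
  have wB : row 0 (\adj B) *m (B - B') = 0.
    by rewrite mulmxBr {2}ww -!row_mul lA lA' subrr.
  apply/eqP; rewrite -subr_eq0; apply/eqP; apply/matrixP => i j.
  have /winj : mxsz k (col j (B - B')) by move=> a b; rewrite mxE.
  rewrite colE mulmxA wB mul0mx => /(_ erefl)/matrixP/(_ i 0).
  by rewrite -colE !mxE.
- move=> w wg; have [ws wc _] := wg.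
  have w0 : w 0 0 \is monic /\ size (w 0 0) = (k + k).+1.
    have c0 : (w 0 0)`_(k + k) = 1 by have /matrixP/(_ 0 0) := wc; rewrite !mxE eqxx.
    have s0 : size (w 0 0) = (k + k).+1.
      apply/eqP; rewrite eqn_leq ws ltnNge; apply/negP => /leq_sizeP/(_ _ (leqnn _)).
      by rewrite c0 => /eqP; rewrite oner_eq0.
    by rewrite monicE lead_coefE s0 /= c0 eqxx.
  have wlow j : j != 0 -> (size (w 0%R j) <= k + k)%N.
    move=> j0; apply/leq_sizeP => l; rewrite leq_eqVlt => /predU1P[<-|kl].
      by have /matrixP/(_ 0 j) := wc; rewrite !mxE eqxx (negbTE j0).
    by rewrite nth_default//; exact: leq_trans (ws 0 j) kl.
  (* With the top part ['X^k Pi0] of [B] prescribed, [rhs j] is what the lower part of column [j]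
     must contribute. It has degree [< 3 k] because only the first entry of [w] reaches degree
     [2 k]. *)
  pose rhs j : {poly F} := if j == 0 :> 'I_3 then 1 else - ('X^k * w 0 j).
  have rhss j : (size (rhs j) <= 3 * k)%N.
    rewrite /rhs; case: eqP => [_|/eqP j0]; first by rewrite size_poly1; lia.
    rewrite size_polyN mulrC; have [->|wj0] := eqVneq (w 0 j) 0.
      by rewrite mul0r size_poly0.
    rewrite size_mulXn// (_ : 3 * k = k + (k + k))%N; last by lia.
    by rewrite leq_add2l; exact: wlow.
  have /choice[c cP] j : exists c : 'cV[{poly F}]_3, mxsz k c /\ w *m c = (rhs j)%:M.
    by have [c ? ?] := row_good_solve k0 wg (rhss j); exists c.
  pose B : 'M[{poly F}]_3 := 'X^k *: cstmx Pi0 + \matrix_(i, j) c j i 0.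
  have Cs : mxsz k (\matrix_(i, j) c j i 0).
    by move=> i j; rewrite mxE; have [] := cP j.
  have Bs : mxsz k.+1 B by apply: mxszD; [exact: mxsz_Xcst|exact: mxszW Cs].
  have Bc : mxcoef k B = Pi0 by rewrite mxcoefD mxcoef_Xcst (mxcoef_default Cs)// addr0.
  have wB : w *m B = row 0 E0.
    rewrite mulmxDr -scalemxAr; apply/matrixP => i j; rewrite !ord1 !mxE.
    have [_ /matrixP/(_ 0 0)] := cP j; rewrite !mxE mulr1n => cj.
    under [in X in _ + X]eq_bigr do rewrite mxE.
    rewrite cj /cstmx map_mxB map_mx1 map_delta_mx.
    have -> : \sum_l w 0 l * (1%:M - delta_mx 0 0) l j = if j == 0 then 0 else w 0 j.
      rewrite (bigD1 j)//= big1 ?addr0 => [|l lj].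
        by rewrite !mxE eqxx andbb mulr1n; case: eqP; rewrite ?subrr ?mulr0// subr0 mulr1.
      rewrite !mxE (negbTE lj) mulr0n; case: eqP => [l0|]; last by rewrite subr0 mulr0.
      by case: eqP => [j0|]; rewrite ?subr0 ?mulr0//; rewrite l0 j0 eqxx in lj.
    by rewrite /rhs eqxx; case: eqP => _; rewrite ?mulr0 ?add0r// subrr.
  have [aBs aBc] := mxcoef_adj Bs.
  (* The corner entries of [w] and of the adjugate are both monic of degree [2 k]; comparing them in
     this identity forces determinant 1. *)
  have wdet : \det B *: w = row 0 (\adj B).
    have := congr1 (mulmx^~ (\adj B)) wB; rewrite -mulmxA mul_mx_adj mul_mx_scalar => ->.
    rewrite -row_mul; apply/matrixP => i j; rewrite !mxE (bigD1 0)//= big1 ?addr0.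
      by rewrite !mxE !eqxx mul1r.
    by move=> l l0; rewrite mxE (negbTE l0) andbF mul0r.
  have detc : \det B * w 0 0 \is monic /\ size (\det B * w 0 0) = (k + k).+1.
    have e : \det B * w 0 0 = \adj B 0 0 by have /matrixP/(_ 0 0) := wdet; rewrite !mxE.
    rewrite e.
    have c0 : (\adj B 0 0)`_(k + k) = 1.
      by have /matrixP/(_ 0 0) := aBc; rewrite Bc adj_Pi0 !mxE.
    have s0 : size (\adj B 0 0) = (k + k).+1.
      apply/eqP; rewrite eqn_leq aBs ltnNge; apply/negP => /leq_sizeP/(_ _ (leqnn _)).
      by rewrite c0 => /eqP; rewrite oner_eq0.
    by rewrite monicE lead_coefE s0 /= c0 eqxx.
  have det1 : \det B = 1.
    have [w0m w0s] := w0; have [dm ds] := detc.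
    have dm' : \det B \is monic by move: dm; rewrite monicMr.
    have dB1 : size (\det B) = 1.
      have := ds; rewrite size_proper_mul; last first.
        by rewrite (monicP dm') (monicP w0m) mulr1 oner_eq0.
      by rewrite w0s; lia.
    have := monicP dm'; rewrite lead_coefE dB1 => d0.
    by rewrite (size1_polyC (eq_leq dB1)) d0.
  exists B => //; by rewrite -wdet det1 scale1r.
Qed.

End FirstRow.

(** * Primitive vectors *)
Lemma scalemxI (R : idomainType) m n (a : R) : a != 0 ->
  injective (fun A : 'M[R]_(m, n) => a *: A).
Proof.
move=> a0 A B /matrixP AB; apply/matrixP => i j; have := AB i j.
by rewrite !mxE; apply: mulfI.
Qed.

Section Primitive.
Variables (F : fieldType) (n : nat).
Implicit Types v w : 'rV[{poly F}]_n.

(** Unimodularity; over [{poly F}] this is coprimality of the entries. *)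
Definition prim v := exists u : 'cV[{poly F}]_n, v *m u = 1%:M.

(** Bezout: a monic value [v *m u] of least size divides every entry, since a nonzero remainder
    would be, up to scaling, a smaller such value. *)
Lemma prim_part_ex v : v != 0 -> exists g w, [/\ g \is monic, prim w & v = g *: w].
Proof.
move=> v0.
pose P s := `[< exists u : 'cV[{poly F}]_n, (v *m u) 0 0 \is monic /\ size ((v *m u) 0 0) = s >].
have PE (u : 'cV[{poly F}]_n) : (v *m u) 0 0 != 0 -> P (size ((v *m u) 0 0)).
  set g := _ 0 0 => g0; have l0 : lead_coef g != 0 by rewrite lead_coef_eq0.
  apply/asboolP; exists ((lead_coef g)^-1%:P *: u).
  have -> : (v *m ((lead_coef g)^-1%:P *: u)) 0 0 = (lead_coef g)^-1 *: g.
    by rewrite -scalemxAr mxE mul_polyC.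
  by rewrite monicE lead_coefZ mulVf// size_scale// invr_eq0.
have dE i : (v *m (delta_mx i 0 : 'cV_n)) 0 0 = v 0 i by rewrite -colE mxE.
have exP : exists s, P s.
  have [i vi0] : exists i, v 0 i != 0.
    apply: contrapT => /forallNP vi; move/eqP: v0; apply; apply/rowP => i; rewrite mxE.
    by apply/eqP; apply: contrapT => /negP; exact: vi.
  by exists (size (v 0 i)); rewrite -dE; apply: PE; rewrite dE.
case: (ex_minnP exP) => s /asboolP[u [gm gs]] smin.
set g := (v *m u) 0 0 in gm gs.
have g0 : g != 0 by exact: monic_neq0.
have gdvd i : g %| v 0 i.
  rewrite /dvdp; apply: contrapT => /negP r0.
  have rE : (v *m (delta_mx i 0 - (v 0 i %/ g) *: u)) 0 0 = v 0 i %% g.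
    transitivity (v 0 i - (v 0 i %/ g) * g); last first.
      by apply/eqP; rewrite subr_eq addrC; apply/eqP; exact: divp_eq.
    rewrite mulmxBr -scalemxAr -[X in _ = X - _](dE i) /g.
    by move: (v *m delta_mx i 0) (v *m u) => a b; rewrite !mxE.
  move: (PE (delta_mx i 0 - (v 0 i %/ g) *: u)); rewrite rE => /(_ r0) /smin.
  by rewrite -gs leqNgt ltn_modp g0.
exists g, (\row_i (v 0 i %/ g)).
have vE : v = g *: \row_i (v 0 i %/ g).
  by apply/rowP => i; rewrite !mxE mulrC divpK.
split=> //; exists u; apply: (scalemxI g0); rewrite scalemxAl -vE.
by apply/matrixP => i j; rewrite !ord1 -/g [RHS]mxE [in RHS]mxE mulr1n mulr1.
Qed.

Lemma prim_neq0 v : prim v -> v != 0.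
Proof.
move=> [u vu]; apply/eqP => v0; have /matrixP/(_ 0 0) := vu.
by rewrite v0 mul0mx !mxE => /esym/eqP; rewrite oner_eq0.
Qed.

Lemma prim_dvdp v w g h : prim v -> g *: v = h *: w -> h %| g.
Proof.
move=> [u vu] vw; apply/dvdpP; exists ((w *m u) 0 0).
have /matrixP/(_ 0 0) := congr1 (mulmx^~ u) vw; rewrite -!scalemxAl vu.
by move: (w *m u) => a; rewrite !mxE mulr1n mulr1 mulrC.
Qed.

Lemma prim_uniq v w g h : g \is monic -> h \is monic -> prim v -> prim w ->
  g *: v = h *: w -> g = h /\ v = w.
Proof.
move=> gm hm pv pw vw.
have gh : g = h.
  apply/eqP; rewrite -eqp_monic// /eqp (prim_dvdp pw (esym vw)).
  exact: prim_dvdp pv vw.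
by split=> //; apply: (scalemxI (monic_neq0 gm)); rewrite vw gh.
Qed.

Lemma mxsz_monic_scale g v d : g \is monic -> mxsz d (g *: v) ->
  mxsz (d - (size g).-1) v.
Proof.
move=> gm gv i j; have := gv i j; rewrite mxE.
have [->|v0] := eqVneq (v i j) 0; first by rewrite size_poly0.
rewrite size_monicM//; have : (0 < size g)%N by rewrite size_poly_gt0 monic_neq0.
by set a := size g; set b := size (v i j); lia.
Qed.

End Primitive.

Section CountPrimitive.
Variables (F : finFieldType) (n : nat).
Local Notation q := #|F|.
Implicit Types v w : 'rV[{poly F}]_n.

(* [(s, g v') |-> (t g + s) v'], with [v'] primitive and [g] monic, enumerates
   the imprimitive vectors of the next degree. *)
Lemma nb_prim (L : set 'rV[F]_n) (Q : set 'rV[{poly F}]_n) m :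
  ~ L 0 -> (forall g v, g \is monic -> Q (g *: v) <-> Q v) ->
  let N m := [set v | [/\ mxsz m.+1 v, L (mxcoef m v) & Q v]] in
  nb (N m.+1) = (nb (N m.+1 `&` @prim F n) + q * nb (N m))%N.
Proof.
move=> L0 Qg N.
have finN d : finite_set (N d).
  by apply: sub_finite_set (nb_mxsz F 1 n d.+1).1 => v [].
have Nn0 d v : N d v -> v != 0.
  move=> [_ Lv _]; apply/eqP => v0; apply: L0; move: Lv; rewrite v0.
  by rewrite (_ : mxcoef d 0 = 0)//; apply/matrixP => i j; rewrite !mxE coef0.
(* [pr v] is the primitive part; its value at [v = 0] is irrelevant because [N] contains no zero
   vector. *)
have /choice[pr prP] v : exists w, v != 0 -> exists g, [/\ g \is monic, prim w & v = g *: w].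
  have [->|v0] := eqVneq v 0; first by exists 0.
  by have [g [w gw]] := prim_part_ex v0; exists w => _; exists g.
have XsM (g : {poly F}) s : g \is monic -> 'X * g + s%:P \is monic.
  move=> gm; rewrite monicE lead_coefDl; first by rewrite lead_coefM lead_coefX mul1r -monicE.
  rewrite size_polyC mulrC size_mulX ?monic_neq0//.
  by have := monic_neq0 gm; rewrite -size_poly_gt0; case: eqP.
rewrite (@nbD _ (N m.+1 `&` @prim F n) (N m.+1)); [|exact: finN|by move=> v []].
congr addn; apply/esym.
rewrite -(nb_setT (T := F)) -nbX; [|exact: finite_finpred|exact: finN].
pose f (x : F * 'rV[{poly F}]_n) := 'X *: x.2 + x.1%:P *: pr x.2.
have fE s v g : v = g *: pr v -> f (s, v) = ('X * g + s%:P) *: pr v.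
  by move=> vE; rewrite /f /= {1}vE scalerA -scalerDl.
apply: (@nb_bij _ _ f).
- by apply: finite_setX; [exact: finite_finpred|exact: finN].
- move=> [s v] [_ /= Nv]; have [sv Lv Qv] := Nv.
  have [g [gm pv vE]] := prP v (Nn0 _ _ Nv).
  have spv : mxsz m.+1 (pr v).
    by apply: mxszW (mxsz_monic_scale gm _); [exact: leq_subr|rewrite -vE].
  have sspv : mxsz m.+1 (s%:P *: pr v).
    move=> i j; rewrite mxE mul_polyC; apply: leq_trans (size_scale_leq _ _) _; exact: spv.
  split; first split.
  + by apply: mxszD; [exact: (mxszZX 1 sv)|exact: mxszW sspv].
  + by rewrite mxcoefD (mxcoefZX m 1) (mxcoef_default sspv)// addr0.
  + rewrite (fE _ _ _ vE); apply/(Qg _ _ (XsM _ _ gm)); apply/(Qg _ _ gm).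
    by rewrite -vE.
  (* The image is not primitive: its content ['X * g + s] would have to divide 1, but it is not
     constant. *)
  + move=> [_ [u fu]]; have := XsM _ s gm; move=> hm.
    have : 'X * g + s%:P %| 1.
      by apply: (prim_dvdp (v := f (s, v)) (w := pr v)); [exists u|rewrite scale1r (fE _ _ _ vE)].
    rewrite dvdp1 size_polyDl.
      rewrite mulrC size_mulX ?monic_neq0//.
      by have := monic_neq0 gm; rewrite -size_poly_gt0; case: (size g).
    rewrite mulrC size_mulX ?monic_neq0// size_polyC.
    by have := monic_neq0 gm; rewrite -size_poly_gt0; case: (size g) => // ? _; case: eqP.
- move=> [s v] [r w] [_ /= Nv] [_ /= Nw] vw.
  have [g [gm pv vE]] := prP v (Nn0 _ _ Nv).
  have [h [hm pw wE]] := prP w (Nn0 _ _ Nw).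
  move: vw; rewrite (fE _ _ _ vE) (fE _ _ _ wE).
  case/(prim_uniq (XsM _ s gm) (XsM _ r hm) pv pw) => gh pvw.
  have sr : s = r.
    have /(congr1 (fun p : {poly F} => p`_0)) := gh.
    by rewrite !coefD !coefXM !coefC !eqxx !add0r.
  have : g = h.
    by move: gh; rewrite sr => /addIr; apply: mulfI; rewrite polyX_eq0.
  by move=> e; rewrite sr vE wE pvw e.
- move=> u [Nu npu]; have [su Lu Qu] := Nu.
  have [h [u' [hm pu uE]]] := prim_part_ex (Nn0 _ _ Nu).
  have hne1 : h != 1.
    by apply/eqP => h1; apply: npu; split=> //; rewrite uE h1 scale1r.
  (* Division of the content [h] by ['X]; the quotient is monic because a monic [h] different from 1
     is not constant. *)
  have [g [s [hE gm]]] : exists g s, h = 'X * g + s%:P /\ g \is monic.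
    elim/poly_ind: h hm hne1 {uE} => [|g s _].
      by rewrite monicE lead_coef0 eq_sym oner_eq0.
    have [->|g0] := eqVneq g 0.
      by rewrite mul0r add0r monicE lead_coefC => /eqP ->; rewrite eqxx.
    move=> hm _; exists g, s; split; first by rewrite mulrC.
    move: hm; rewrite !monicE lead_coefDl ?lead_coefMX//.
    rewrite size_polyC size_mulX//; move: g0; rewrite -size_poly_gt0.
    by case: (size g) => // ? _; case: eqP.
  have hs : (size h).-1 = size g.
    rewrite hE size_polyDl mulrC size_mulX ?monic_neq0//.
    have := monic_neq0 gm; rewrite -size_poly_gt0 size_polyC.
    by case: (size g) => // ? _; case: eqP.
  have g0 : (0 < size g)%N by rewrite size_poly_gt0 monic_neq0.
  have su' : mxsz m.+1 u'.
    apply: mxszW (mxsz_monic_scale hm _); last by rewrite -uE.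
    by rewrite hs; lia.
  have XE : 'X *: (g *: u') = u - s%:P *: u'.
    by rewrite uE hE scalerDl scalerA addrK.
  have ssu' : mxsz m.+1 (s%:P *: u').
    move=> i j; rewrite mxE mul_polyC; apply: leq_trans (size_scale_leq _ _) _; exact: su'.
  have gn0 : g *: u' != 0.
    apply: contra_neq (prim_neq0 pu) => gu0.
    by apply: (scalemxI (monic_neq0 gm)); rewrite /= gu0 scaler0.
  have sv : mxsz m.+1 (g *: u').
    have := @mxsz_monic_scale _ _ 'X (g *: u') m.+2 (monicX _).
    rewrite size_polyX subn1; apply; rewrite XE; apply: mxszB => //; exact: mxszW ssu'.
  have Lv : mxcoef m (g *: u') = mxcoef m.+1 u.
    rewrite -(mxcoefZX m 1) XE mxcoefB (mxcoef_default ssu')// subr0.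
    by [].
  have Qv : Q (g *: u').
    by apply/(Qg _ _ gm); apply/(Qg _ _ hm); rewrite -uE.
  have Nv : N m (g *: u') by split=> //; rewrite Lv.
  exists (s, g *: u') => //.
  have [g' [g'm pp vE]] := prP _ gn0.
  have [_ prE] := prim_uniq g'm gm pp pu (esym vE).
  by rewrite /f /= prE XE subrK.
Qed.

End CountPrimitive.

Lemma nb_fibers (T U : choiceType) (X : set T) (Y : T -> set U) p :
  finite_set X -> (forall x, X x -> finite_set (Y x)) ->
  (forall x, X x -> nb (Y x) = p) ->
  (forall x x' y, X x -> X x' -> Y x y -> Y x' y -> x = x') ->
  finite_set [set y | exists2 x, X x & Y x y] /\
  nb [set y | exists2 x, X x & Y x y] = (nb X * p)%N.
Proof.
move=> Xf Yf Yp Yd; pose s := enum_fset (fset_set X).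
have sX x : (x \in s) = `[< X x >] by rewrite /s in_fset_set// inE.
have us : uniq s by exact: fset_uniq.
have [[x0 Xx0]|X0] := pselect (exists x, X x); last first.
  have -> : X = set0 by apply/seteqP; split=> // x Xx; apply: X0; exists x.
  rewrite (_ : mkset _ = set0) ?nb0; first by split=> //; exact: finite_set0.
  by apply/seteqP; split=> // y [].
have sn j : (j < size s)%N -> X (nth x0 s j).
  by move=> js; have := mem_nth x0 js; rewrite sX => /asboolP.
have fin j : (j < size s)%N -> finite_set (Y (nth x0 s j)) by move=> /sn; exact: Yf.
have dis i j : (i < j < size s)%N -> Y (nth x0 s i) `&` Y (nth x0 s j) `<=` set0.
  move=> /andP[ij js] y [Yi Yj]; have is' := ltn_trans ij js.
  have /eqP := Yd _ _ _ (sn _ is') (sn _ js) Yi Yj.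
  by rewrite nth_uniq// ltn_eqF.
have [Uf UE] := nb_bigcup fin dis.
have E : [set y | exists2 x, X x & Y x y] = [set y | exists2 j, (j < size s)%N & Y (nth x0 s j) y].
  apply/seteqP; split=> [y [x Xx Yxy]|y [j js Yj]]; last by exists (nth x0 s j) => //; exact: sn.
  have xs : x \in s by rewrite sX; exact/asboolP.
  by exists (index x s); rewrite ?index_mem// nth_index.
rewrite E; split=> //; rewrite UE (eq_bigr (fun=> p)); last by move=> j _; rewrite Yp//; exact: sn.
by rewrite sum_nat_const card_ord.
Qed.

Lemma card_gt0_finField (F : finFieldType) : (0 < #|F|)%N.
Proof. exact: ltnW (card_finNzRing_gt1 F). Qed.

(** * Rows orthogonal to a primitive vector *)

Section Orthogonal.
Variable F : finFieldType.
Local Notation q := #|F|.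
Implicit Types c w : 'rV[{poly F}]_3.

(** Start from a Bezout solution and reduce all entries but one modulo an entry [c 0 i0] of full
    degree [a]. The remaining entry absorbs the quotients, and the equation itself bounds its
    degree. *)
Lemma prim_solve c a m (p : {poly F}) : prim c -> mxsz a.+1 c -> mxcoef a c != 0 ->
  (a <= m)%N -> (size p <= m + a)%N ->
  exists2 w, mxsz m w & w *m c^T = p%:M.
Proof.
move=> [u cu] ca c0 am ps.
have [i0 ci0] : exists i, mxcoef a c 0 i != 0.
  apply: contrapT => /forallNP ci; move/eqP: c0; apply; apply/rowP => i; rewrite [RHS]mxE.
  by apply/eqP; apply: contrapT => /negP; exact: ci.
have si0 : size (c 0 i0) = a.+1.
  apply/eqP; rewrite eqn_leq ca ltnNge; apply/negP => /leq_sizeP/(_ _ (leqnn _)).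
  by move: ci0; rewrite mxE => /eqP.
have cn0 : c 0 i0 != 0 by rewrite -size_poly_gt0 si0.
pose r i := (u i 0 * p) %% c 0 i0.
pose w0 := u i0 0 * p + \sum_(i | i != i0) ((u i 0 * p) %/ c 0 i0) * c 0 i.
pose w : 'rV[{poly F}]_3 := \row_i if i == i0 then w0 else r i.
have cuE : \sum_i c 0 i * u i 0 = 1.
  by have /matrixP/(_ 0 0) := cu; rewrite !mxE.
have wc : \sum_i w 0 i * c 0 i = p.
  rewrite (bigD1 i0)//= mxE eqxx /w0 mulrDl mulr_suml -addrA -big_split/=.
  rewrite -[RHS]mul1r -cuE mulr_suml [in RHS](bigD1 i0)//=; congr (_ + _); first by ring.
  apply: eq_bigr => i ii0; rewrite mxE (negbTE ii0) /r.
  transitivity ((u i 0 * p) * c 0 i); last by ring.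
  rewrite [X in _ = X * _](divp_eq (u i 0 * p) (c 0 i0)); ring.
exists w; last first.
  by apply/matrixP => i j; rewrite !ord1 [RHS]mxE mulr1n -[RHS]wc mxE; apply: eq_bigr => l _; rewrite [c^T _ _]mxE.
have rs i : (size (r i) <= a)%N by rewrite -ltnS -si0 ltn_modp.
move=> i j; rewrite !ord1 mxE; case: eqP => [_|_]; last exact: leq_trans (rs j) am.
have w0E : w0 * c 0 i0 = p - \sum_(i | i != i0) r i * c 0 i.
  apply/eqP; rewrite eq_sym subr_eq -wc (bigD1 i0)//= mxE eqxx; apply/eqP; congr (_ + _).
  by apply: eq_bigr => l li0; rewrite mxE (negbTE li0).
have [->|w00] := eqVneq w0 0; first by rewrite size_poly0.
have : (size (w0 * c 0 i0)%R <= m + a)%N.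
  rewrite w0E; apply: leq_trans (size_polyD _ _) _; rewrite size_polyN geq_max ps /=.
  apply: leq_trans (size_sum _ _ _) _; apply/bigmax_leqP => l _.
  apply: leq_trans (size_polyMleq _ _) _.
  have := rs l; have := ca 0 l; set x := size _; set y := size _; lia.
by rewrite size_mul// si0 addnS /= leq_add2r.
Qed.

Definition e1 : 'rV[F]_3 := row 0 E0.

Definition perp c m : set 'rV[{poly F}]_3 :=
  [set w | [/\ mxsz m.+1 w, mxcoef m w = e1 & w *m c^T = 0]].

Lemma finite_perp c m : finite_set (perp c m).
Proof. by apply: sub_finite_set (nb_mxsz F 1 3 m.+1).1 => w []. Qed.

(** By [prim_solve] the map [w] to [w *m c^T] sends rows of size [m] onto polynomials of size
    [m + a], and [perp c m] corresponds to one fibre; hence the quotient of [q ^ (3 m)] by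
    [q ^ (m + a)]. *)
Lemma nb_perp c a m : prim c -> mxsz a.+1 c -> mxcoef a c != 0 ->
  mxcoef a c 0 0 = 0 -> (a <= m)%N -> nb (perp c m) = (q ^ (2 * m - a))%N.
Proof.
move=> pc ca c0 c00 am.
have [fA nA] := nb_mxsz F 1 3 m; have [fB nB] := nb_mxsz F 1 1 (m + a).
have /choice[sg sgP] y : exists w, mxsz (m + a) y -> mxsz m w /\ w *m c^T = y.
  have [sy|?] := pselect (mxsz (m + a) y); last by exists 0.
  have [w sw wE] := prim_solve pc ca c0 am (sy 0 0).
  exists w => _; split=> //; rewrite wE; apply/matrixP => i j.
  by rewrite !ord1 mxE mulr1n.
pose b : 'rV[{poly F}]_3 := 'X^m *: cstmx e1.
(* The term of degree [m + a] is [e1] times the leading vector of [c], which vanishes by the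
   hypothesis on its first entry. *)
have bc : mxsz (m + a) (b *m c^T).
  have ce : mxsz a.+1 c^T by move=> i j; rewrite mxE; exact: ca.
  apply: mxsz_coef0; first exact: (mxszM (mxsz_Xcst m e1) ce).
  rewrite (mxcoefM (mxsz_Xcst m e1) ce) mxcoef_Xcst.
  apply/matrixP => i j; rewrite !ord1 !mxE big1// => l _; rewrite !mxE eqxx.
  by case: eqP => [->|_]; rewrite ?mul0r// mul1r; move: c00; rewrite mxE.
have cTm w : mxsz m w -> mxsz (m + a) (w *m c^T).
  have ce : mxsz a.+1 c^T by move=> i j; rewrite mxE; exact: ca.
  case: (m) => [/mxsz0P ->|m' sw]; last by rewrite addSn; exact: mxszM.
  by rewrite mul0mx => i j; rewrite mxE size_poly0.
suff : (nb (perp c m) * q ^ (m + a) = q ^ (2 * m - a) * q ^ (m + a))%N.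
  by move=> e; apply/eqP; rewrite -(@eqn_pmul2r (q ^ (m + a))) ?e// expn_gt0 card_gt0_finField.
rewrite -expnD (_ : 2 * m - a + (m + a) = m * (1 * 3))%N; last by lia.
rewrite -nA (_ : m + a = (m + a) * (1 * 1))%N; last by lia.
rewrite -nB -nbX//; last exact: finite_perp.
apply: (@nb_bij _ _ (fun x => (x.1 - b) + sg x.2)).
- by apply: finite_setX => //; exact: finite_perp.
- move=> [w y] [/= [sw wc _] sy]; apply: mxszD; last by have [] := sgP y sy.
  apply: mxsz_coef0; first by apply: mxszB => //; exact: mxsz_Xcst.
  by rewrite mxcoefB wc mxcoef_Xcst subrr.
- move=> [w y] [w' y'] [/= [sw wc wp] sy] [/= [sw' wc' wp'] sy'] ww.
  have := congr1 (mulmx^~ c^T) ww; rewrite !mulmxDl mulNmx wp wp' add0r.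
  move/addrI; have [_ ->] := sgP y sy; have [_ ->] := sgP y' sy' => yy.
  by move: ww; rewrite yy => /addIr/addIr ->.
- move=> x sx; exists (x - sg (x *m c^T + b *m c^T) + b, x *m c^T + b *m c^T); last first.
    by rewrite /= addrK subrK.
  have sy : mxsz (m + a) (x *m c^T + b *m c^T) by apply: mxszD => //; exact: cTm.
  have [ssg sgE] := sgP _ sy.
  split=> //; split.
  + apply: mxszD; last exact: mxsz_Xcst.
    by apply: (@mxszW _ _ _ m) => //; exact: mxszB.
  + by rewrite mxcoefD mxcoef_Xcst (mxcoef_default (mxszB sx ssg))// add0r.
  + by rewrite mulmxDl mulmxBl sgE opprD addNKr addNr.
Qed.

(** One representative for each point of the projective line of vectors orthogonal to [e1],
    normalized by its first nonzero entry. *)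
Definition norm_lead : set 'rV[F]_3 :=
  [set l | l 0 0 = 0 /\ (l 0 1 = 1 \/ l 0 1 = 0 /\ l 0 2%:R = 1)].

Lemma norm_lead_neq0 l : norm_lead l -> l != 0.
Proof.
move=> [_ l1]; apply/eqP => l0; case: l1 => [|[_]]; rewrite l0 mxE => /esym/eqP;
by rewrite oner_eq0.
Qed.

Lemma row3P (R : nzRingType) (u v : 'rV[R]_3) : u 0 0 = v 0 0 -> u 0 1 = v 0 1 ->
  u 0 2%:R = v 0 2%:R -> u = v.
Proof.
move=> h0 h1 h2; apply/rowP => -[[|[|[|//]]] ilt].
- by rewrite (_ : Ordinal ilt = 0)//; exact/val_inj.
- by rewrite (_ : Ordinal ilt = 1)//; exact/val_inj.
- by rewrite (_ : Ordinal ilt = 2%:R)//; exact/val_inj.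
Qed.

Lemma nb_norm_lead : nb norm_lead = q.+1.
Proof.
pose f (s : F) : 'rV[F]_3 := \row_i if i == 0 then 0 else if i == 1 then 1 else s.
pose z : 'rV[F]_3 := \row_i (i == 2%:R)%:R.
have -> : norm_lead = f @` [set` F] `|` [set z].
  apply/seteqP; split=> [l [l0 [l1|[l1 l2]]]|_ [[s _ <-]| ->]].
  - by left; exists (l 0 2%:R) => //; rewrite /f; apply: row3P; rewrite mxE ?l0 ?l1.
  - by right; rewrite /= /z; apply: row3P; rewrite mxE ?l0 ?l1 ?l2.
  - by split; [rewrite mxE|left; rewrite mxE].
  - by split; [rewrite mxE|right; split; rewrite mxE].
rewrite nbU; last 3 first.
- by apply: finite_image; exact: finite_finpred.
- exact: finite_set1.
- move=> _ [[s _ <-]] /rowP/(_ 1); rewrite !mxE /= => /eqP; by rewrite oner_eq0.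
rewrite nb1 nb_image; [|exact: finite_finpred|].
  by rewrite nb_setT addn1.
by move=> s r _ _ /rowP/(_ 2%:R); rewrite !mxE.
Qed.

Lemma norm_lead_scale (l : 'rV[F]_3) : l != 0 -> l 0 0 = 0 ->
  exists2 s, s != 0 & norm_lead (s *: l).
Proof.
move=> l0 l00; have [l1|l1] := eqVneq (l 0 1) 0; last first.
  exists (l 0 1)^-1; first by rewrite invr_eq0.
  by split; [rewrite mxE l00 mulr0|left; rewrite mxE mulVf].
have l2 : l 0 2%:R != 0.
  by apply: contra_neq l0 => l2; apply: row3P; rewrite mxE ?l1 ?l2.
exists (l 0 2%:R)^-1; first by rewrite invr_eq0.
split; first by rewrite mxE l00 mulr0.
by right; rewrite !mxE l1 mulr0 mulVf.
Qed.

Lemma norm_lead_inj (s : F) l : norm_lead l -> norm_lead (s *: l) -> s = 1.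
Proof.
move=> [_ [l1|[l1 l2]]] [_]; rewrite !mxE l1 ?mulr1 ?mulr0.
  case=> // -[s0]; rewrite s0 mul0r => /esym/eqP; by rewrite oner_eq0.
rewrite l2 mulr1; case=> [/esym/eqP|[]//]; by rewrite oner_eq0.
Qed.

End Orthogonal.

(** * Counting primitive rows with prescribed leading vector *)

Section CountRows.
Variable F : finFieldType.
Local Notation q := #|F|.
Implicit Types c w : 'rV[{poly F}]_3.
Local Notation e1 := (@e1 F).

Lemma e1_neq0 : e1 != 0.
Proof. by apply/eqP => /rowP/(_ 0); rewrite !mxE eqxx => /eqP; rewrite oner_eq0. Qed.

Definition lead_e1 m : set 'rV[{poly F}]_3 := [set w | mxsz m.+1 w /\ mxcoef m w = e1].

Definition lead_norm a : set 'rV[{poly F}]_3 :=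
  [set c | mxsz a.+1 c /\ norm_lead (mxcoef a c)].

Lemma finite_lead_e1 m : finite_set (lead_e1 m).
Proof. exact: (nb_lead m [set e1]).1. Qed.

Lemma finite_lead_norm m : finite_set (lead_norm m).
Proof. exact: (nb_lead m (@norm_lead F)).1. Qed.

Lemma nb_lead_e1_prim m :
  (nb (lead_e1 m.+1 `&` @prim F 3) + q * q ^ (m * 3) = q ^ (m.+1 * 3))%N.
Proof.
have L0 : ~ [set e1] 0 by move=> e0; have /eqP := e1_neq0; rewrite /= e0.
have /= := @nb_prim F 3 [set e1] setT m L0 _.
have E d : [set v | [/\ mxsz d.+1 v, mxcoef d v = e1 & True]] = lead_e1 d.
  by apply/seteqP; split=> v [] //.
rewrite !E => h.
have nbE d : nb (lead_e1 d) = (q ^ (d * 3))%N.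
  by have [_] := nb_lead d [set e1]; rewrite nb1 mul1n.
by rewrite -!nbE -h.
Qed.

Lemma nb_lead_norm_prim a :
  (nb (lead_norm a.+1 `&` @prim F 3) + q * (q.+1 * q ^ (a * 3)) = q.+1 * q ^ (a.+1 * 3))%N.
Proof.
have L0 : ~ @norm_lead F 0 by move=> /norm_lead_neq0; rewrite eqxx.
have /= := @nb_prim F 3 (@norm_lead F) setT a L0 _.
have E d : [set v | [/\ mxsz d.+1 v, norm_lead (mxcoef d v) & True]] = lead_norm d.
  by apply/seteqP; split=> v [] //.
rewrite !E => h.
have nbE d : nb (lead_norm d) = (q.+1 * q ^ (d * 3))%N.
  by have [_] := nb_lead d (@norm_lead F); rewrite nb_norm_lead mul1n.
by rewrite -!nbE -h.
Qed.

Lemma nb_lead_norm_prim0 : nb (lead_norm 0 `&` @prim F 3) = q.+1.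
Proof.
have -> : lead_norm 0 `&` @prim F 3 = lead_norm 0.
  apply/seteqP; split=> [c []//|c [sc nc]]; split=> //.
  have [i ci] : exists i, mxcoef 0 c 0 i = 1.
    by case: nc => _ [|[_]] ?; [exists 1|exists 2%:R].
  exists (delta_mx i 0); rewrite -colE; apply/matrixP => r s; rewrite !ord1 !mxE.
  by move: ci; rewrite mxE (size1_polyC (sc 0 i)) coefC /= => ->.
by have [_] := nb_lead 0 (@norm_lead F); rewrite nb_norm_lead muln1.
Qed.

(** This is [nb_prim] with orthogonality to [c] as the side condition, which scaling by a monic
    polynomial preserves. *)
Lemma nb_perp_prim a m c : (lead_norm a `&` @prim F 3) c -> (a <= m)%N ->
  (nb (perp c m.+1 `&` @prim F 3) + q ^ (2 * m - a).+1 = q ^ (2 * m - a).+2)%N.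
Proof.
move=> [[sc nc] pc] am; have c0 := norm_lead_neq0 nc.
have c00 : mxcoef a c 0 0 = 0 by case: nc.
have L0 : ~ [set e1] 0 by move=> e0; have /eqP := e1_neq0; rewrite /= e0.
have /= := @nb_prim F 3 [set e1] [set w | w *m c^T = 0] m L0 _.
have -> : [set v | [/\ mxsz m.+2 v, mxcoef m.+1 v = e1 & v *m c^T = 0]] = perp c m.+1 by [].
have -> : [set v | [/\ mxsz m.+1 v, mxcoef m v = e1 & v *m c^T = 0]] = perp c m by [].
rewrite (nb_perp pc sc c0 c00 am) (nb_perp pc sc c0 c00 (leqW am)) => h.
rewrite expnS (_ : (2 * m - a).+2 = 2 * m.+1 - a)%N; last by lia.
rewrite -h// => g v gm; rewrite -scalemxAl; split=> [|->]; last by rewrite scaler0.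
  by move=> gv; apply: (scalemxI (monic_neq0 gm)); rewrite /= gv scaler0.
Qed.

Lemma lead_uniq n (A : 'rV[{poly F}]_n) a b : mxsz a.+1 A -> mxsz b.+1 A ->
  mxcoef a A != 0 -> mxcoef b A != 0 -> a = b.
Proof.
move=> sa sb ca cb; apply/eqP; rewrite eqn_leq; apply/andP; split; rewrite leqNgt.
- by apply/negP => ba; rewrite (mxcoef_default sb ba) eqxx in ca.
- by apply/negP => ab; rewrite (mxcoef_default sa ab) eqxx in cb.
Qed.

(* Two vectors of degree [< k] orthogonal to [w] have a cross product parallel
   to [w] of degree [< 2 k], hence zero. *)
Lemma perp_uniq k a a' c c' w : (a < k)%N -> (a' < k)%N ->
  (lead_norm a `&` @prim F 3) c -> (lead_norm a' `&` @prim F 3) c' ->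
  perp c (k + k) w -> perp c' (k + k) w -> prim w -> a = a' /\ c = c'.
Proof.
move=> ak ak' [[sc nc] [v cv]] [[sc' nc'] pc'] [sw ew wc] [_ _ wc'] [u wu].
pose i0 : 'I_3 := 0; pose i1 : 'I_3 := 1; pose i2 : 'I_3 := 2%:R.
have sum3 (f : 'I_3 -> {poly F}) : \sum_i f i = f i0 + f i1 + f i2.
  rewrite !big_ord_recl big_ord0 addr0 addrA.
  by congr (f _ + f _ + f _); apply/val_inj.
have all3 (P : 'I_3 -> Prop) : P i0 -> P i1 -> P i2 -> forall i, P i.
  move=> p0 p1 p2 [[|[|[|//]]] ilt].
  - by rewrite (_ : Ordinal ilt = i0)//; exact/val_inj.
  - by rewrite (_ : Ordinal ilt = i1)//; exact/val_inj.
  - by rewrite (_ : Ordinal ilt = i2)//; exact/val_inj.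
have {}wc : w 0 i0 * c 0 i0 + w 0 i1 * c 0 i1 + w 0 i2 * c 0 i2 = 0.
  by have /matrixP/(_ 0 0) := wc; rewrite mxE sum3 !mxE.
have {}wc' : w 0 i0 * c' 0 i0 + w 0 i1 * c' 0 i1 + w 0 i2 * c' 0 i2 = 0.
  by have /matrixP/(_ 0 0) := wc'; rewrite mxE sum3 !mxE.
have {}wu : w 0 i0 * u i0 0 + w 0 i1 * u i1 0 + w 0 i2 * u i2 0 = 1.
  by have /matrixP/(_ 0 0) := wu; rewrite mxE sum3 !mxE.
have {}cv : c 0 i0 * v i0 0 + c 0 i1 * v i1 0 + c 0 i2 * v i2 0 = 1.
  by have /matrixP/(_ 0 0) := cv; rewrite mxE sum3 !mxE.
pose x0 := c 0 i1 * c' 0 i2 - c 0 i2 * c' 0 i1.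
pose x1 := c 0 i2 * c' 0 i0 - c 0 i0 * c' 0 i2.
pose x2 := c 0 i0 * c' 0 i1 - c 0 i1 * c' 0 i0.
(* [(x0, x1, x2)] is the cross product of [c] and [c']. It is parallel to the primitive [w], and
   pairing it with the Bezout vector [u] of [w] gives the factor [y]. *)
pose y := x0 * u i0 0 + x1 * u i1 0 + x2 * u i2 0.
have w01 : w 0 i0 * x1 = w 0 i1 * x0.
  apply/eqP; rewrite -subr_eq0; apply/eqP.
  transitivity (c 0 i2 * (w 0 i0 * c' 0 i0 + w 0 i1 * c' 0 i1 + w 0 i2 * c' 0 i2) -
    c' 0 i2 * (w 0 i0 * c 0 i0 + w 0 i1 * c 0 i1 + w 0 i2 * c 0 i2)).
    by rewrite /x0 /x1; ring.
  by rewrite wc wc' !mulr0 subr0.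
have w02 : w 0 i0 * x2 = w 0 i2 * x0.
  apply/eqP; rewrite -subr_eq0; apply/eqP.
  transitivity (c' 0 i1 * (w 0 i0 * c 0 i0 + w 0 i1 * c 0 i1 + w 0 i2 * c 0 i2) -
    c 0 i1 * (w 0 i0 * c' 0 i0 + w 0 i1 * c' 0 i1 + w 0 i2 * c' 0 i2)).
    by rewrite /x0 /x2; ring.
  by rewrite wc wc' !mulr0 subr0.
have w12 : w 0 i1 * x2 = w 0 i2 * x1.
  apply/eqP; rewrite -subr_eq0; apply/eqP.
  transitivity (c 0 i0 * (w 0 i0 * c' 0 i0 + w 0 i1 * c' 0 i1 + w 0 i2 * c' 0 i2) -
    c' 0 i0 * (w 0 i0 * c 0 i0 + w 0 i1 * c 0 i1 + w 0 i2 * c 0 i2)).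
    by rewrite /x1 /x2; ring.
  by rewrite wc wc' !mulr0 subr0.
have x0E : x0 = w 0 i0 * y.
  transitivity (w 0 i0 * x0 * u i0 0 + w 0 i1 * x0 * u i1 0 + w 0 i2 * x0 * u i2 0).
    by rewrite -[LHS]mul1r -wu; ring.
  by rewrite -w01 -w02 /y; ring.
have x1E : x1 = w 0 i1 * y.
  transitivity (w 0 i0 * x1 * u i0 0 + w 0 i1 * x1 * u i1 0 + w 0 i2 * x1 * u i2 0).
    by rewrite -[LHS]mul1r -wu; ring.
  by rewrite w01 -w12 /y; ring.
have x2E : x2 = w 0 i2 * y.
  transitivity (w 0 i0 * x2 * u i0 0 + w 0 i1 * x2 * u i1 0 + w 0 i2 * x2 * u i2 0).
    by rewrite -[LHS]mul1r -wu; ring.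
  by rewrite w02 w12 /y; ring.
(* The first entry of [w] has degree [2 k], above that of [x0 = w 0 i0 * y]. *)
have y0 : y = 0.
  apply/eqP; apply: contraT => y0.
  have sw0 : (k + k < size (w 0%R i0))%N.
    rewrite ltnNge; apply/negP => /leq_sizeP/(_ _ (leqnn _)).
    have /rowP/(_ i0) := ew; rewrite !mxE !eqxx => -> /eqP; by rewrite oner_eq0.
  have w00 : w 0 i0 != 0 by rewrite -size_poly_gt0; exact: leq_ltn_trans sw0.
  have sx0 : (size x0 <= k + k)%N.
    apply: leq_trans (size_polyD _ _) _; rewrite size_polyN geq_max.
    apply/andP; split; apply: leq_trans (size_polyMleq _ _) _.
      have := sc 0 i1; have := sc' 0 i2; set s1 := size _; set s2 := size _; lia.
    have := sc 0 i2; have := sc' 0 i1; set s1 := size _; set s2 := size _; lia.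
  move: sx0; rewrite x0E size_mul//; move: sw0 y0; rewrite -size_poly_gt0.
  set s1 := size _; set s2 := size _; lia.
move: x0E x1E x2E; rewrite y0 !mulr0 => /subr0_eq x00 /subr0_eq x10 /subr0_eq x20.
(* With zero cross product, the Bezout vector [v] of [c] gives [c' = f *: c]; [f] is a constant
   because [c'] is primitive, and it is 1 by the normalization of leading vectors. *)
pose f := c' 0 i0 * v i0 0 + c' 0 i1 * v i1 0 + c' 0 i2 * v i2 0.
have c'E : c' = f *: c.
  apply/rowP; apply: all3; rewrite [RHS]mxE.
  - transitivity (c 0 i0 * c' 0 i0 * v i0 0 + c 0 i1 * c' 0 i0 * v i1 0 + c 0 i2 * c' 0 i0 * v i2 0).
      by rewrite -[LHS]mul1r -cv; ring.
    by rewrite -x20 x10 /f; ring.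
  - transitivity (c 0 i0 * c' 0 i1 * v i0 0 + c 0 i1 * c' 0 i1 * v i1 0 + c 0 i2 * c' 0 i1 * v i2 0).
      by rewrite -[LHS]mul1r -cv; ring.
    by rewrite x20 -x00 /f; ring.
  - transitivity (c 0 i0 * c' 0 i2 * v i0 0 + c 0 i1 * c' 0 i2 * v i1 0 + c 0 i2 * c' 0 i2 * v i2 0).
      by rewrite -[LHS]mul1r -cv; ring.
    by rewrite -x10 x00 /f; ring.
have : f %| 1 by apply: (prim_dvdp pc' (w := c)); rewrite scale1r.
rewrite dvdp1 => /eqP f1.
pose s := f`_0; have fE : f = s%:P by apply: size1_polyC; rewrite f1.
have coefE d : mxcoef d c' = s *: mxcoef d c.
  by rewrite c'E fE; apply/rowP => i; rewrite !mxE coefCM.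
have s0 : s != 0 by apply/eqP => s0; move: f1; rewrite fE s0 size_poly0.
have sac' : mxsz a.+1 c'.
  by move=> i j; rewrite c'E fE mxE mul_polyC; apply: leq_trans (size_scale_leq _ _) _; exact: sc.
have aa : a = a'.
  apply: (lead_uniq sac' sc'); last exact: norm_lead_neq0.
  by rewrite coefE scaler_eq0 (negbTE s0) norm_lead_neq0.
split=> //; move: nc'; rewrite coefE -aa => /(norm_lead_inj nc) s1.
by rewrite c'E fE s1 scale1r.
Qed.

End CountRows.

(** * Counting bad rows, good rows and the graded monoid *)

Section CountSB.
Variable F : finFieldType.
Local Notation q := #|F|.
Implicit Types c w : 'rV[{poly F}]_3.

Definition row_bad k : set 'rV[{poly F}]_3 :=
  [set w | exists2 a, (a < k)%N & exists2 c, (lead_norm a `&` @prim F 3) c &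
    (perp c (k + k) `&` @prim F 3) w].

(** By [perp_uniq] a bad row has only one witness [(a, c)], so the count is the sum over [a] of the
    number of witnesses times the number of primitive rows orthogonal to one. *)
Lemma nb_row_bad k : finite_set (row_bad k.+1) /\
  nb (row_bad k.+1) = ((q - 1) * (q + 1) * q ^ (6 * k + 3))%N.
Proof.
pose C a := lead_norm a `&` @prim F 3.
pose m := (k + k).+1.
have mE : (k.+1 + k.+1 = m.+1)%N by rewrite /m; lia.
pose p a := (q ^ (2 * m - a).+1 * (q - 1))%N.
have q0 := card_gt0_finField F.
have finC a : finite_set (C a).
  by apply: sub_finite_set (finite_lead_norm F a) => c [].
have fP c : finite_set (perp c (k.+1 + k.+1) `&` @prim F 3).
  by apply: sub_finite_set (finite_perp c (k.+1 + k.+1)) => w [].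
have fib a : (a < k.+1)%N ->
    finite_set [set w | exists2 c, C a c & (perp c (k.+1 + k.+1) `&` @prim F 3) w] /\
    nb [set w | exists2 c, C a c & (perp c (k.+1 + k.+1) `&` @prim F 3) w] = (nb (C a) * p a)%N.
  move=> ak; apply: nb_fibers => // [c Cc|c c' w Cc Cc' [pw pr] [pw' _]].
    have am : (a <= m)%N by rewrite /m; lia.
    by have := nb_perp_prim Cc am; rewrite -mE /p mulnBr muln1 -expnSr => <-; rewrite addnK.
  by have [] := perp_uniq ak ak Cc Cc' pw pw' pr.
have [||fin nbE] := @nb_bigcup _ (fun a => [set w | exists2 c, C a c & (perp c (k.+1 + k.+1) `&` @prim F 3) w]) k.+1.
- by move=> a /fib[].
- move=> a a' /andP[aa' ak'] w [[c Cc [pw pr]] [c' Cc' [pw' _]]].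
  have [e _] := perp_uniq (ltn_trans aa' ak') ak' Cc Cc' pw pw' pr.
  by rewrite e ltnn in aa'.
split; first exact: fin.
rewrite [LHS]nbE (eq_bigr (fun a : 'I_k.+1 => nb (C a) * p a)%N); last first.
  by move=> a _; have [] := fib a (ltn_ord a).
have nC a : nb (C a.+1) = ((q + 1) * q ^ (3 * a + 1) * ((q - 1) * (q + 1)))%N.
  have := nb_lead_norm_prim F a; rewrite -/(C _).
  rewrite (_ : a.+1 * 3 = (3 * a + 1).+2)%N; last by lia.
  rewrite (_ : a * 3 = 3 * a)%N; last by lia.
  rewrite addn1 !expnS; set x := (q ^ _)%N; nia.
(* The partial sums have a closed form: each new term is [q ^ 2 - 1] times the sum so far. *)
suff key j : (j <= k)%N ->
    (\sum_(a < j.+1) nb (C a) * p a = (q - 1) * (q + 1) * q ^ (4 * k + 3 + 2 * j))%N.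
  by rewrite key//; congr (_ * _ ^ _)%N; lia.
elim: j => [_|j IH jk].
  rewrite big_ord1 /p {1}/C nb_lead_norm_prim0 subn0 muln0 addn0.
  rewrite (_ : (2 * m).+1 = 4 * k + 3)%N; last by rewrite /m; lia.
  by set x := (q ^ _)%N; nia.
rewrite big_ord_recr /= IH; last by lia.
rewrite nC /p (_ : 4 * k + 3 + 2 * j.+1 = (4 * k + 3 + 2 * j).+2)%N; last by lia.
have -> : (4 * k + 3 + 2 * j = (3 * j + 1) + (2 * m - j.+1).+1)%N by rewrite /m; lia.
move: (3 * j + 1)%N (2 * m - j.+1)%N => d e; rewrite !(expnS, expnD).
move: (q ^ d)%N (q ^ e)%N => x y.
by have [r ->] : exists r, q = r.+1 by [exists q.-1; rewrite prednK]; rewrite subn1 /=; ring.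
Qed.

(** A nonzero small vector killed by [w] can be replaced by its primitive part and rescaled to a
    normalized leading vector. Conversely, a good row is primitive because [row_good_solve] solves
    [w *m c = 1]. *)
Lemma row_good_badE k : (0 < k)%N ->
  @lead_e1 F (k + k) `&` @prim F 3 `\` row_bad k = @row_good F k.
Proof.
move=> k0; apply/seteqP; split=> [w [[[sw ew] pw] nb]|w wg].
  split=> // c sc wc; apply/eqP; apply: contraT => c0; exfalso; apply: nb.
  have cT0 : c^T != 0 by apply: contra_neq c0 => e; rewrite -[c]trmxK e trmx0.
  have [g [c' [gm pc' cE]]] := prim_part_ex cT0.
  have sc' : mxsz k c'.
    apply: mxszW (mxsz_monic_scale gm _); first exact: leq_subr.
    by rewrite -cE => i j; rewrite mxE.
  have [a sa ca] := mx_lead (prim_neq0 pc').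
  have ak : (a < k)%N.
    rewrite ltnNge; apply/negP => ka.
    by rewrite (mxcoef_default sc' ka) eqxx in ca.
  have wc' : w *m c'^T = 0.
    apply: (scalemxI (monic_neq0 gm)); rewrite /= scalemxAr scaler0.
    by rewrite -[g *: c'^T](_ : c = _) // -[c]trmxK cE linearZ.
  have sT : mxsz a.+1 c'^T by move=> i j; rewrite mxE.
  (* Top coefficient of [w *m c'^T = 0], since [w] has leading vector [e1]. *)
  have ca0 : mxcoef a c' 0 0 = 0.
    have := mxcoefM sw sT; rewrite wc' ew => /matrixP/(_ 0 0).
    rewrite !mxE coef0 (bigD1 0)//= big1 ?addr0 => [|i i0].
      by rewrite !mxE eqxx mul1r.
    by rewrite !mxE (negbTE i0) mul0r.
  have [s s0 ns] := norm_lead_scale ca ca0.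
  exists a => //; exists (s%:P *: c').
    split; first split.
    - by move=> i j; rewrite mxE mul_polyC; apply: leq_trans (size_scale_leq _ _) _; exact: sa.
    - by rewrite (_ : mxcoef _ _ = s *: mxcoef a c')//; apply/rowP => i; rewrite !mxE coefCM.
    - have [u cu] := pc'; exists (s^-1%:P *: u).
      by rewrite -scalemxAl -scalemxAr cu scalerA -polyCM mulfV// scale1r.
  by split=> //; split=> //; rewrite linearZ/= -scalemxAr wc' scaler0.
have [sw ew winj] := wg; split; first split=> //.
  have s1 : (size (1%R : {poly F}) <= 3 * k)%N by rewrite size_poly1; lia.
  by have [c _ wc] := row_good_solve k0 wg s1; exists c.
move=> [a ak [c [[sc nc] pc] [[_ _ wc] _]]].
have /winj : mxsz k c^T by move=> i j; rewrite mxE; exact: leq_trans (sc j i) ak.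
move=> /(_ wc) c0; have := prim_neq0 pc.
by rewrite -[c]trmxK c0 trmx0 eqxx.
Qed.

(** Primitive rows minus bad rows: [q ^ (6 k + 3)] times [(q ^ 3 - q) - (q ^ 2 - 1)]. *)
Lemma nb_SB k :
  nb (@SB F k.+1) = (q ^ (6 * k + 3) * ((q - 1) * (q - 1) * (q + 1)))%N.
Proof.
rewrite nb_SB_row_good// -row_good_badE//.
have [fb nbb] := nb_row_bad k.
have fA : finite_set (@lead_e1 F (k.+1 + k.+1) `&` @prim F 3).
  by apply: sub_finite_set (@finite_lead_e1 F (k.+1 + k.+1)) => w [].
have sub : row_bad k.+1 `<=` @lead_e1 F (k.+1 + k.+1) `&` @prim F 3.
  by move=> w [a _ [c _ [[sw ew _] pw]]].
have := nbD fA sub; have := nb_lead_e1_prim F (k + k).+1.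
rewrite -(_ : k.+1 + k.+1 = (k + k).+2)%N; last by lia.
rewrite nbb (_ : (k.+1 + k.+1) * 3 = (6 * k + 3).+3)%N; last by lia.
rewrite (_ : (k + k).+1 * 3 = 6 * k + 3)%N; last by lia.
rewrite !expnS; set x := (q ^ _)%N; have q0 := card_gt0_finField F.
have [r ->] : exists r, q = r.+1 by exists q.-1; rewrite prednK.
rewrite subn1 /=; move: (nb _) (nb _) => A B; nia.
Qed.

End CountSB.

(** * Power series and Laurent series *)
Section Series.
Variable F : fieldType.
Implicit Types (p : {poly F}) (f g : pseries F) (u v : laurent F).

(** Reduction to the residue field, that is, evaluation at [t = oo]. *)
Definition ev0 f : F := pcoef f 0.

Fact ev0_zmod_morphism : zmod_morphism ev0.
Proof. by []. Qed.
Fact ev0_monoid_morphism : monoid_morphism ev0.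
Proof. by split=> // f g; rewrite /ev0 pcoefM big_ord1. Qed.
HB.instance Definition _ := GRing.isZmodMorphism.Build (pseries F) F ev0
  ev0_zmod_morphism.
HB.instance Definition _ := GRing.isMonoidMorphism.Build (pseries F) F ev0
  ev0_monoid_morphism.

Fact ps_const_zmod_morphism : zmod_morphism (@ps_const F).
Proof. by move=> c d; apply: pseriesP => n /=; case: ifP; rewrite ?subr0. Qed.
Fact ps_const_monoid_morphism : monoid_morphism (@ps_const F).
Proof.
split=> // c d; apply: pseriesP => n; rewrite pcoefM big_ord_recl big1 ?addr0 /=.
  by rewrite subn0; case: ifP => _; rewrite ?mulr0.
by move=> i _; rewrite mul0r.
Qed.
HB.instance Definition _ := GRing.isZmodMorphism.Build F (pseries F) (@ps_const F)
  ps_const_zmod_morphism.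
HB.instance Definition _ := GRing.isMonoidMorphism.Build F (pseries F) (@ps_const F)
  ps_const_monoid_morphism.

Lemma unit_ev0 f : (f \is a GRing.unit) = (ev0 f != 0).
Proof. by []. Qed.

Lemma unitmx_ev0 n (A : 'M[pseries F]_n) : (A \in unitmx) = (map_mx ev0 A \in unitmx).
Proof. by rewrite !unitmxE unit_ev0 det_map_mx unitfE. Qed.

Local Notation iota := (@laurent_of_pseries F).
Local Notation t := (@laurent_t F).

Lemma iota_inj : injective iota.
Proof.
move=> f g fg; apply: pseriesP => n.
have := congr1 (fun u => lcoef u (- n%:Z)) fg => /=.
by rewrite oppr_le0 lez_nat leq0n abszN.
Qed.

Lemma texp k : t ^+ k = shift k%:Z 1.
Proof.
have t1 : t = shift 1 1.
  apply: laurentP => -[[|[|n]]|n]; rewrite /= ?coefX //=.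
elim: k => [|k IH]; first by rewrite expr0 shift1.
by rewrite exprS IH t1 [LHS]shiftM mulr1; congr shift; lia.
Qed.

Lemma shiftE k f : t ^+ k * iota f = shift k%:Z f.
Proof. by rewrite texp laurent_of_pseriesE [LHS]shiftM mul1r addr0. Qed.

Definition tau : pseries F := PSeries (fun n => (n == 1)%N%:R).

Lemma t_tau : t * iota tau = 1.
Proof.
rewrite -[t]expr1 shiftE; apply: laurentP => n; rewrite lcoef1 /=.
have [->//|n0] := eqVneq n 0; case: leP => // n1.
by rewrite (_ : (_ == 1)%N = false)//; apply/eqP; lia.
Qed.

Lemma texp_tau k : t ^+ k * iota (tau ^+ k) = 1.
Proof. by rewrite rmorphXn -exprMn t_tau expr1n. Qed.

Lemma ev0_tau k : (0 < k)%N -> ev0 (tau ^+ k) = 0.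
Proof. by case: k => // k _; rewrite rmorphXn /= expr0n. Qed.

(* [t ^ - k * p], which has no pole at infinity when [p] has degree [<= k]. *)
Definition rv k p : pseries F := PSeries (fun i => if (i <= k)%N then p`_(k - i) else 0).

Lemma rvE k p : (size p <= k.+1)%N -> laurent_of_poly p = t ^+ k * iota (rv k p).
Proof.
move=> pk; rewrite shiftE; apply: laurentP => -[n|n] /=.
  case: leP => nk; last by rewrite nth_default//; apply: leq_trans pk _; lia.
  by rewrite ifT; [congr (p`_ _); lia|lia].
by rewrite ifF//; lia.
Qed.

Lemma ev0_rv k p : ev0 (rv k p) = p`_k.
Proof. by rewrite /ev0 /= subn0. Qed.

Lemma poly_series k p f : laurent_of_poly p = t ^+ k * iota f ->
  (size p <= k.+1)%N /\ p`_k = ev0 f.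
Proof.
rewrite shiftE => e; split.
  apply/leq_sizeP => j kj; have := congr1 (fun u => lcoef u j%:Z) e => /= ->.
  by rewrite ifF//; lia.
by have := congr1 (fun u => lcoef u k%:Z) e => /= ->; rewrite lexx subrr.
Qed.

Lemma unit_decomp u : u != 0 -> exists N f, f \is a GRing.unit /\ u = shift N f.
Proof.
move=> u0; have [N [p uE]] := shift_exists u.
have kex : exists k, pcoef p k != 0.
  apply: contrapT => /forallNP p0; move/eqP: u0; apply; rewrite uE.
  apply: laurentP => n; rewrite lcoef0 /=; case: leP => // _.
  by apply/eqP; apply: contrapT => /negP; exact: p0.
case: (ex_minnP kex) => m pm mmin.
exists (N - m%:Z), (PSeries (fun j => pcoef p (j + m)%N)); split.
  by rewrite unit_ev0 /ev0 /= add0n.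
rewrite uE; apply: laurentP => n /=; case: leP => nN.
  case: leP => [nNm|nNm]; first by congr (pcoef _ _); lia.
  by apply: contraTeq nNm => /mmin; lia.
by rewrite ifF//; lia.
Qed.

Lemma shift_unit_eq N M f g : f \is a GRing.unit -> g \is a GRing.unit ->
  shift N f = shift M g -> N = M.
Proof.
rewrite !unit_ev0 => f0 g0 fg.
have key N' M' f' g' : ev0 f' != 0 -> shift N' f' = shift M' g' -> N' <= M'.
  move=> f'0 e; rewrite leNgt; apply/negP => MN.
  have := congr1 (fun u => lcoef u N') e => /=.
  rewrite lexx subrr leNgt MN /= => e0; by move: f'0; rewrite /ev0 e0 eqxx.
by apply/eqP; rewrite eq_le (key _ _ _ _ f0 fg) (key _ _ _ _ g0 (esym fg)).
Qed.

(** Divisibility by [tau ^+ n], read on coefficients. *)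
Definition small n f := forall i, (i < n)%N -> pcoef f i = 0.

Lemma smallD n f g : small n f -> small n g -> small n (f + g).
Proof. by move=> sf sg i ilt; rewrite pcoefD sf// sg// addr0. Qed.

Lemma smallM m n f g : small m f -> small n g -> small (m + n) (f * g).
Proof.
move=> sf sg i ilt; rewrite pcoefM big1// => -[j /= jlt] _.
have [jm|mj] := ltnP j m; first by rewrite sf ?mul0r.
by rewrite sg ?mulr0//; lia.
Qed.

Lemma small_ev0 f : ev0 f = 0 -> small 1 f.
Proof. by move=> f0 [|]. Qed.

Definition mxsmall m n d (A : 'M[pseries F]_(m, n)) := forall i j, small d (A i j).

Lemma mxsmallD m n d (A B : 'M[pseries F]_(m, n)) :
  mxsmall d A -> mxsmall d B -> mxsmall d (A + B).
Proof. by move=> sA sB i j; rewrite mxE; exact: smallD. Qed.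

Lemma mxsmallN m n d (A : 'M[pseries F]_(m, n)) : mxsmall d A -> mxsmall d (- A).
Proof. by move=> sA i j l ld; rewrite mxE pcoefN sA// oppr0. Qed.

Lemma mxsmallM m n r d e (A : 'M[pseries F]_(m, n)) (B : 'M[pseries F]_(n, r)) :
  mxsmall d A -> mxsmall e B -> mxsmall (d + e) (A *m B).
Proof.
move=> sA sB i j l ld; rewrite mxE pcoef_sum big1// => l' _.
exact: (smallM (sA i l') (sB l' j)).
Qed.

Lemma mxsmallMl m n r d (A : 'M[pseries F]_(m, n)) (B : 'M[pseries F]_(n, r)) :
  mxsmall d A -> mxsmall d (A *m B).
Proof. by move=> sA; rewrite -[d]addn0; apply: mxsmallM. Qed.

Lemma mxsmallMr m n r d (A : 'M[pseries F]_(m, n)) (B : 'M[pseries F]_(n, r)) :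
  mxsmall d B -> mxsmall d (A *m B).
Proof. by move=> sB; rewrite -[d]add0n; apply: mxsmallM. Qed.

Lemma mxsmall_eq0 m n (A : 'M[pseries F]_(m, n)) : (forall d, mxsmall d A) -> A = 0.
Proof.
move=> sA; apply/matrixP => i j; apply: pseriesP => l.
by rewrite (sA l.+1 i j)// mxE.
Qed.

(** Each use of the equation gains one factor from the maximal ideal, so [Z] vanishes to every
    order. *)
Lemma contraction_eq0 m n (s : pseries F) (A : 'M[pseries F]_m) (Z : 'M[pseries F]_(m, n))
    (B : 'M[pseries F]_n) : ev0 s = 0 -> Z = s *: (A *m Z *m B) -> Z = 0.
Proof.
move=> s0 ZE; apply: mxsmall_eq0; elim=> // d IH.
rewrite ZE => i j; rewrite mxE -add1n; apply: smallM; first exact: small_ev0.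
by apply: mxsmallMl; exact: mxsmallMr.
Qed.

Lemma mxsmall_ev0 m n (A : 'M[pseries F]_(m, n)) : map_mx ev0 A = 0 -> mxsmall 1 A.
Proof. by move=> /matrixP A0 i j; apply: small_ev0; have := A0 i j; rewrite !mxE. Qed.

End Series.

(** * Lifting idempotents from the residue field *)

Section IdempotentLift.
Variables (F : fieldType) (n : nat) (a : 'M[pseries F]_n.+1).
Local Notation ev := (map_mx (@ev0 F)).

(** Newton iteration for [p ^ 2 = p]: a step multiplies the defect [d] by [d (4 d - 3)]. Keeping the
    iterates as polynomials in [a] makes them commute with whatever commutes with [a]. *)
Fixpoint lift_poly k : {poly pseries F} :=
  if k is k'.+1 then let p := lift_poly k' in 3%:R * p ^+ 2 - 2%:R * p ^+ 3 else 'X.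

Let d k := lift_poly k ^+ 2 - lift_poly k.
Let e k := horner_mx a (lift_poly k).

Lemma idempotent_lift : ev a *m ev a = ev a -> exists S : 'M[pseries F]_n.+1,
  [/\ S *m S = S, ev S = ev a & forall b, b *m a = a *m b -> b *m S = S *m b].
Proof.
move=> aa.
have dS k : d k.+1 = d k * (d k * (4%:R * d k - 3%:R)) by rewrite /d /=; ring.
have eS k : lift_poly k.+1 - lift_poly k = d k * (1 - 2%:R * lift_poly k) by rewrite /d /=; ring.
have sd k : mxsmall k.+1 (horner_mx a (d k)).
  elim: k => [|k IH].
    apply: mxsmall_ev0; rewrite /d /= rmorphB rmorphXn /= horner_mx_X expr2 map_mxB.
    by rewrite -mulmxE map_mxM aa subrr.
  rewrite dS !rmorphM -!mulmxE mulmxA; apply: mxsmallMl.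
  have s1 : mxsmall 1 (horner_mx a (d k)) by move=> i j l ll; apply: IH; lia.
  by rewrite -[k.+2]add1n; exact: mxsmallM.
have se k : mxsmall k.+1 (e k.+1 - e k).
  by rewrite /e -rmorphB eS rmorphM -mulmxE; exact: mxsmallMl.
have stab i j l m : (l <= m)%N -> pcoef (e m i j) l = pcoef (e l i j) l.
  elim: m => [|m IH]; first by rewrite leqn0 => /eqP ->.
  rewrite leq_eqVlt => /predU1P[->//|lm]; rewrite -IH//.
  have := se m i j l lm; rewrite !mxE pcoefD pcoefN => /eqP.
  by rewrite subr_eq0 => /eqP.
(* Diagonal limit: by [stab], coefficient [l] no longer changes from the iterate [l] on. *)
pose S : 'M[pseries F]_n.+1 := \matrix_(i, j) PSeries (fun l => pcoef (e l i j) l).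
have Se k : mxsmall k.+1 (S - e k).
  move=> i j l lk; rewrite !mxE pcoefD pcoefN /=.
  by rewrite (@stab i j l k)// subrr.
exists S; split.
- apply/eqP; rewrite -subr_eq0; apply/eqP; apply: mxsmall_eq0 => k.
  have -> : S *m S - S = (S - e k) *m S + e k *m (S - e k) - (S - e k) + (e k *m e k - e k).
    have zid (A B C D E : 'M[pseries F]_n.+1) : A - D = A - B + (B - C) - (D - E) + (C - E).
      by apply/matrixP => i j; rewrite !mxE; ring.
    by rewrite mulmxBl mulmxBr; exact: zid.
  have -> : e k *m e k - e k = horner_mx a (d k) by rewrite /d rmorphB rmorphXn expr2 mulmxE.
  have Sk : mxsmall k (S - e k) by move=> i j l lk; apply: Se; lia.
  apply: mxsmallD; last by move=> i j l lk; apply: sd; lia.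
  by apply: mxsmallD; [apply: mxsmallD; [exact: mxsmallMl|exact: mxsmallMr]|exact: mxsmallN].
- apply/matrixP => i j; rewrite !mxE /ev0 /= /e /= horner_mx_X //.
- move=> b ba; apply/eqP; rewrite -subr_eq0; apply/eqP; apply: mxsmall_eq0 => k.
  have be : b *m e k = e k *m b.
    by apply: comm_mx_horner; rewrite /comm_mx.
  have -> : b *m S - S *m b = b *m (S - e k) - (S - e k) *m b.
    by rewrite mulmxBr mulmxBl be opprB addrA addrNK.
  by apply: mxsmallD; [apply: mxsmallMr|apply: mxsmallN; apply: mxsmallMl] => i j l lk; apply: Se; lia.
Qed.

End IdempotentLift.

(** * Cycles and axes *)
Section Axis.
Variable F : fieldType.
Local Notation iota := (@laurent_of_pseries F).
Local Notation t := (@laurent_t F).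
Local Notation im := (map_mx (@laurent_of_pseries F)).
Local Notation pm := (map_mx (@laurent_of_poly F)).
Local Notation ev := (map_mx (@ev0 F)).
Local Notation cs := (map_mx (@ps_const F)).
Local Notation GLO := (GL 3 (pseries F)).
Local Notation GLP := (GL 3 {poly F}).
Local Notation GLL := (GL 3 (laurent F)).

Lemma map_E0 (R S : comNzRingType) (f : {rmorphism R -> S}) : map_mx f E0 = E0.
Proof. exact: map_delta_mx. Qed.

Lemma map_Pi0 (R S : comNzRingType) (f : {rmorphism R -> S}) : map_mx f Pi0 = Pi0.
Proof. by rewrite map_mxB map_mx1 map_E0. Qed.

Lemma comm_Pi0 (R : comNzRingType) (A : 'M[R]_3) : A *m E0 = E0 *m A -> A *m Pi0 = Pi0 *m A.
Proof. by move=> AE; rewrite mulmxBr mulmxBl mulmx1 mul1mx AE. Qed.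

Lemma im_inj m n : injective (im : 'M[pseries F]_(m, n) -> 'M[laurent F]_(m, n)).
Proof.
move=> A B /matrixP AB; apply/matrixP => i j; have := AB i j; rewrite !mxE.
exact: iota_inj.
Qed.

Lemma pm_cst m n (A : 'M[F]_(m, n)) : pm (cstmx A) = im (cs A).
Proof.
apply/matrixP => i j; rewrite !mxE; apply: laurentP => -[l|l] /=.
  rewrite coefC; case: l => //= l; by case: ifP.
by [].
Qed.

Lemma t_neq0 : t != 0. Proof. exact: laurent_t_neq0. Qed.

(** The matrix of [a_power (3 * k)] rescaled to determinant one. *)
Definition dg k : 'M[laurent F]_3 := t ^+ (2 * k) *: E0 + t ^- k *: Pi0.

Lemma scaleEPi_mul (R : comNzRingType) (a b c d : R) :
  (a *: E0 + b *: Pi0) *m (c *: E0 + d *: Pi0) = (a * c) *: E0 + (b * d) *: Pi0 :> 'M[R]_3.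
Proof.
rewrite mulmxDl !mulmxDr -!scalemxAl -!scalemxAr !scalerA E0E E0Pi0 Pi0E0 Pi0Pi0.
by rewrite !scaler0 addr0 add0r.
Qed.

Lemma scaleEPi_comm (R : comNzRingType) (a b : R) (A : 'M[R]_3) :
  A *m E0 = E0 *m A -> A *m (a *: E0 + b *: Pi0) = (a *: E0 + b *: Pi0) *m A.
Proof.
by move=> AE; rewrite mulmxDr mulmxDl -!scalemxAl -!scalemxAr AE comm_Pi0.
Qed.

Lemma det_scaleEPi (R : comNzRingType) (a b : R) : \det (a *: E0 + b *: Pi0) = a * b ^+ 2.
Proof.
have -> : a *: E0 + b *: Pi0 = diag_mx (\row_(i < 3) if i == 0 then a else b).
  apply/matrixP => i j; rewrite !mxE; have [->|ij] := eqVneq i j.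
    by case: eqP => _; rewrite /= ?subrr ?subr0 ?mulr1 ?mulr0 ?addr0 ?add0r.
  rewrite mulr0n sub0r; case: eqP => [i0|]; last by rewrite oppr0 !mulr0 addr0.
  by case: eqP => [j0|]; rewrite ?oppr0 ?mulr0 ?addr0//; rewrite i0 j0 eqxx in ij.
by rewrite det_diag !big_ord_recl big_ord0 !mxE /= mulr1 expr2.
Qed.

Lemma dgE k : dg k = t ^- k *: (t ^+ (3 * k) *: E0 + Pi0).
Proof.
rewrite /dg [RHS]scalerDr scalerA; congr (_ *: _ + _).
rewrite (_ : 3 * k = k + 2 * k)%N; last by lia.
by rewrite exprD mulKf// expf_neq0// t_neq0.
Qed.

Lemma a_power_unit n : t ^+ n *: E0 + Pi0 \in unitmx.
Proof.
rewrite -[Pi0]scale1r unitmxE det_scaleEPi expr1n mulr1 unitfE.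
by rewrite expf_neq0// t_neq0.
Qed.
Definition a_power n : GLL := MkGL (a_power_unit n).

Definition flow (g : GLL) : flow_space F := to_dcosets (@Gamma F) (@M3 F) (pgl g).

Lemma iter_T_a n g : iter n (@T_a F) (flow g) = flow (g * a_power n)%g.
Proof.
elim: n => [|n IH].
  rewrite /flow; congr to_dcosets; congr pgl; apply: val_inj => /=.
  by rewrite expr0 scale1r addrC Pi0DE0 mulmx1.
rewrite iterS IH /flow [T_a _]T_aE; congr to_dcosets; rewrite -pglM; congr pgl.
apply: val_inj => /=; rewrite -mulmxA; congr (_ *m _).
have -> : a_mx F = t *: E0 + 1 *: Pi0.
  apply/matrixP => i j; rewrite !mxE; have [->|ij] := eqVneq i j.
    by case: eqP => _; rewrite /= ?subrr ?subr0 ?mulr1 ?mulr0 ?addr0 ?add0r.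
  rewrite mulr0n sub0r; case: eqP => [i0|]; last by rewrite oppr0 !mulr0 addr0.
  by case: eqP => [j0|]; rewrite ?oppr0 ?mulr0 ?addr0//; rewrite i0 j0 eqxx in ij.
by rewrite -[X in _ + X]scale1r scaleEPi_mul mulr1 scale1r -exprSr.
Qed.

Lemma pi_K_flow g : pi_K (flow g) = to_dcosets (@Gamma F) (@K3 F) (pgl g).
Proof. exact: pi_KE. Qed.

Lemma flow_eq g g' : flow g = flow g' <->
  exists (c : laurent F) (P : GLP) (m : GLO), [/\ c != 0, block_shape m &
    gl_mx g' = c *: (pm P *m g *m im m)].
Proof.
split=> [/(to_dcosets_eq _ _ (Gamma_subgroup F) (M3_subgroup F))[h [k [[x _ <-] [A Ab <-]]]]|].
  rewrite -(pgl_repr x) !pgl_mapE -(pglM _ g) -pglM => /esym /pglP[c cu /= cE].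
  by exists c, (repr x), A; split; rewrite // -unitfE.
move=> [c [P [m [c0 mb gE]]]].
apply/(to_dcosets_eq _ _ (Gamma_subgroup F) (M3_subgroup F)).
exists (pgl_map (@laurent_of_poly F) (pgl P)), (pgl_map iota (pgl m)); split.
- by exists (pgl P).
- by exists m.
- by rewrite !pgl_mapE -(pglM _ g) -pglM; apply/esym/pglP; exists c; rewrite ?unitfE//= gE.
Qed.

Lemma origin_eq g : pi_K (flow g) = origin F <->
  exists (c : laurent F) (P : GLP) (m : GLO), c != 0 /\ gl_mx g = c *: (pm P *m im m).
Proof.
rewrite pi_K_flow; split.
  move/esym/(to_dcosets_eq _ _ (Gamma_subgroup F) (K3_subgroup F)) => [h [k [[x _ <-] [y _ <-]]]].
  rewrite -(pgl_repr x) -(pgl_repr y) !pgl_mapE mulg1 -!pglM => /esym /pglP[c cu /= cE].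
  by exists c, (repr x), (repr y); split; rewrite // -unitfE.
move=> [c [P [m [c0 gE]]]]; apply/esym.
apply/(to_dcosets_eq _ _ (Gamma_subgroup F) (K3_subgroup F)).
exists (pgl_map (@laurent_of_poly F) (pgl P)), (pgl_map iota (pgl m)); split.
- by exists (pgl P).
- by exists (pgl m).
- by rewrite !pgl_mapE mulg1 -!pglM; apply/esym/pglP; exists c; rewrite ?unitfE//= gE.
Qed.

(** The equation saying that [T_a] iterated [3 k] times fixes [flowO kap], with the projective
    scalar removed: its power of [t] is in [dg k], its unit part in [mu]. *)
Definition axis k (Q : 'M[{poly F}]_3) (kap mu : GLO) :=
  block_shape mu /\ pm Q *m im kap *m dg k *m im mu = im kap.

Definition flowO (kap : GLO) : flow_space F := flow (gl_map iota kap).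

Lemma pm_det (Q : GLP) : exists2 d : F, d != 0 & \det Q = d%:P.
Proof.
have : \det Q \is a GRing.unit by rewrite -unitmxE gl_unit.
rewrite poly_unitE => /andP[/eqP s1 u0]; exists (\det Q)`_0; first by rewrite -unitfE.
by apply: size1_polyC; rewrite s1.
Qed.

Lemma polyC_shift (d : F) : laurent_of_poly d%:P = shift 0 (ps_const d).
Proof.
rewrite -laurent_of_pseriesE; have /matrixP/(_ 0 0) := pm_cst (d%:M : 'M[F]_1).
by rewrite !mxE.
Qed.

Lemma shift_mul N M (f g : pseries F) : shift N f * shift M g = shift (N + M) (f * g).
Proof. exact: shiftM. Qed.

(** Taking determinants in the fixed point equation, the scalar [d] has degree [N] with
    [3 N + n = 0]. Hence 3 divides [n], and [d] is [t ^- k] times a unit, which [m] absorbs. *)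
Lemma cycles_axis n x : cycles n (origin F) x ->
  exists k (kap mu : GLO) (Q : GLP), [/\ n = (3 * k)%N, x = flowO kap & axis k Q kap mu].
Proof.
move=> [xo xn].
have [g gE] := to_dcosets_surj x.
have {}gE : x = flow (repr g) by rewrite /flow pgl_repr.
rewrite gE in xo; have /origin_eq[c [P [kap [c0 pE]]]] := xo.
have {}gE : x = flowO kap.
  rewrite gE; apply/esym/flow_eq; exists c, P, 1%g; split=> //.
    by apply/block_shapeP; rewrite mulmx1 mul1mx.
  by rewrite /= map_mx1 mulmx1.
move: xn; rewrite gE iter_T_a => /flow_eq [d [Q [m [d0 mb QE]]]].
have [dd dd0 dQ] := pm_det Q.
have [N [u [uu dE]]] := unit_decomp d0.
have uQ : iota (\det kap) != 0.
  rewrite -unitfE; apply: rmorph_unit; rewrite -unitmxE; exact: gl_unit.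
have mu : \det m \is a GRing.unit by rewrite -unitmxE gl_unit.
have detE : d ^+ 3 * laurent_of_poly dd%:P * t ^+ n * iota (\det m) = 1.
  apply: (mulfI uQ); rewrite mulr1.
  have := congr1 determinant QE; rewrite detZ /= !det_mulmx.
  rewrite -[X in t ^+ n *: E0 + X]scale1r det_scaleEPi expr1n mulr1 !det_map_mx dQ => e.
  by rewrite [RHS]e; ring.
have N0 : N + N + N + n%:Z = 0.
  move: detE; rewrite dE polyC_shift texp laurent_of_pseriesE !exprS expr0 mulr1.
  rewrite !shift_mul -[X in _ = X -> _]shift1 !addr0 mulr1 !addrA => e.
  have cdd : ps_const dd \is a GRing.unit by rewrite unit_ev0.
  by apply: (shift_unit_eq _ _ e); rewrite ?unitr1// !unitrM uu cdd mu.
pose k := `|N|%N.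
have kN : N = - k%:Z by rewrite /k; lia.
have n3k : n = (3 * k)%N by rewrite /k; lia.
have dk : d = t ^- k * iota u.
  apply: (mulfI (expf_neq0 k t_neq0)); rewrite mulrA mulfV ?expf_neq0 ?t_neq0// mul1r.
  by rewrite dE texp laurent_of_pseriesE shift_mul mul1r kN subrr.
have umu : u *: gl_mx m \in unitmx by rewrite unitmxZ// gl_unit.
exists k, kap, (MkGL umu), Q; split=> //; split=> [i j ij /=|/=].
  by rewrite mxE mb// mulr0.
rewrite map_mxZ -scalemxAr dgE -scalemxAr -scalemxAl scalerA mulrC -dk.
by rewrite [RHS]QE n3k /= !mulmxA.
Qed.

End Axis.

(* Unification would otherwise see [Pi0] as a difference. *)
Local Opaque E0 Pi0.

Lemma transport_eq (K : fieldType) n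
    (h hi D Di B1 B2 A2 kap dg mu : 'M[K]_n) :
  hi *m h = 1%:M -> Di *m D = 1%:M -> A2 *m B2 = 1%:M ->
  h *m D *m (B2 *m B1) *m hi *m kap *m dg *m mu = kap ->
  B1 *m (hi *m kap) *m dg *m mu = A2 *m Di *m (hi *m kap).
Proof.
move=> hV DV BV e; rewrite -[in RHS]e -!mulmxA (mulmxA hi h) hV mul1mx.
by rewrite (mulmxA Di) DV mul1mx (mulmxA A2) BV mul1mx.
Qed.

(** On the range of [E] the matrix [dg] is the scalar [a], and [mu] can be undone there because it
    commutes with [E]. *)
Lemma restrict_eq (K : fieldType) n (a : K) (X Y dg mu mui E : 'M[K]_n) :
  mu *m mui = 1%:M -> mu *m E = E *m mu -> dg *m E = a *: E -> E *m E = E ->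
  X *m dg *m mu = Y -> Y *m E *m mui *m E = a *: (X *m E).
Proof.
move=> muV muE dE EE <-; rewrite -[_ *m mu *m E]mulmxA muE mulmxA.
rewrite -[_ *m mu *m mui]mulmxA muV mulmx1 -[_ *m E *m E]mulmxA EE.
by rewrite -mulmxA dE scalemxAr.
Qed.

(** * From axes to monoid elements *)

Section AxisCount.
Variable F : fieldType.
Local Notation iota := (@laurent_of_pseries F).
Local Notation t := (@laurent_t F).
Local Notation im := (map_mx (@laurent_of_pseries F)).
Local Notation pm := (map_mx (@laurent_of_poly F)).
Local Notation ev := (map_mx (@ev0 F)).
Local Notation cs := (map_mx (@ps_const F)).
Local Notation GLO := (GL 3 (pseries F)).
Local Notation GLP := (GL 3 {poly F}).
Local Notation s k := (tau F ^+ (3 * k)).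

Lemma blockE (R : comUnitRingType) (A : 'M[R]_3) : block_shape A <-> A *m E0 = E0 *m A.
Proof. exact: block_shapeP. Qed.

Lemma ev_cs m n (A : 'M[F]_(m, n)) : ev (cs A) = A.
Proof. by apply/matrixP => i j; rewrite !mxE. Qed.

Lemma cstmx_unit n (A : 'M[F]_n) : A \in unitmx -> cstmx A \in unitmx.
Proof.
by move=> Au; have [] := @mulmx1_unit _ _ (cstmx A) (cstmx (invmx A)) _;
   rewrite // -cstmxM mulmxV// cstmx1.
Qed.

Lemma im_tau_block k : im (E0 + s k *: Pi0) = (t ^+ k * iota (s k)) *: dg F k.
Proof.
rewrite dgE scalerA mulrAC mulfV ?expf_neq0 ?t_neq0// mul1r [RHS]scalerDr scalerA.
rewrite [_ * t ^+ _]mulrC texp_tau scale1r map_mxD map_mxZ.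
by rewrite (map_E0 iota) (map_Pi0 iota).
Qed.

Lemma dg_inv k : dg F k *m (t ^+ k *: im (s k *: E0 + Pi0)) = 1%:M.
Proof.
rewrite dgE -scalemxAl -scalemxAr scalerA mulVf ?expf_neq0 ?t_neq0// scale1r.
rewrite map_mxD map_mxZ (map_E0 iota) (map_Pi0 iota) -[X in _ + X]scale1r.
rewrite -[X in _ *m (_ + X)]scale1r scaleEPi_mul texp_tau mulr1 !scale1r.
by rewrite addrC Pi0DE0.
Qed.

(** The quotient [lam] of [kap'] by [kap] intertwines [E0 + s Pi0] up to block units. As [s] lies in
    the maximal ideal, both off-diagonal blocks of [lam] satisfy a contraction equation and vanish,
    so [lam] lies in [M]. *)
Lemma axis_inj k (Q : GLP) (kap kap' mu mu' : GLO) : (0 < k)%N ->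
  axis k Q kap mu -> axis k Q kap' mu' -> flowO kap = flowO kap'.
Proof.
move=> k0 [/blockE mb e] [/blockE mb' e'].
have [lam lamE] : exists lam : GLO, gl_mx kap *m gl_mx lam = kap'.
  by exists (kap^-1 * kap')%g; rewrite /= mulmxA mulmxV ?mul1mx ?gl_unit.
have Qku : pm Q *m im kap \in unitmx.
  by rewrite unitmx_mul (gl_unit (gl_map (@laurent_of_poly F) Q)) (gl_unit (gl_map iota kap)).
have eq1 : dg F k *m im mu *m im lam = im lam *m dg F k *m im mu'.
  apply: (can_inj (mulKmx Qku)); rewrite !mulmxA e -map_mxM lamE.
  by rewrite -[pm Q *m im kap *m im lam]mulmxA -map_mxM lamE e'.
have tau0 : t ^+ k * iota (s k) != 0.
  rewrite mulf_neq0 ?expf_neq0 ?t_neq0//.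
  by apply/eqP => s0; have := texp_tau F (3 * k); rewrite s0 mulr0 => /esym/eqP; rewrite oner_eq0.
have eq2 : (E0 + s k *: Pi0) *m mu *m lam = gl_mx lam *m (E0 + s k *: Pi0) *m mu'.
  apply: im_inj; rewrite !map_mxM im_tau_block. rewrite -[in RHS]scalemxAr -!scalemxAl.
  by rewrite eq1.
have s0 : ev0 (s k) = 0 by rewrite ev0_tau// muln_gt0.
have NE : (E0 + s k *: Pi0) *m E0 = E0 by rewrite mulmxDl -scalemxAl E0E Pi0E0 scaler0 addr0.
have NP : (E0 + s k *: Pi0) *m Pi0 = s k *: Pi0.
  by rewrite mulmxDl -scalemxAl E0Pi0 Pi0Pi0 add0r.
have EN : E0 *m (E0 + s k *: Pi0) = E0 by rewrite mulmxDr -scalemxAr E0E E0Pi0 scaler0 addr0.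
have PN : Pi0 *m (E0 + s k *: Pi0) = s k *: Pi0.
  by rewrite mulmxDr -scalemxAr Pi0E0 Pi0Pi0 add0r.
have mbP := comm_Pi0 mb; have mbP' := comm_Pi0 mb'.
set N := E0 + s k *: Pi0 in eq2 NE NP EN PN.
have Z1 : Pi0 *m lam *m E0 = 0.
  have h1 : Pi0 *m (N *m mu *m lam) *m E0 = s k *: (mu *m (Pi0 *m lam *m E0)).
    by rewrite !mulmxA PN -!scalemxAl -mbP.
  have h2 : Pi0 *m (lam *m N *m mu') *m E0 = Pi0 *m lam *m E0 *m mu'.
    by rewrite -!mulmxA mb' (mulmxA N) NE.
  apply: (contraction_eq0 (A := mu) (B := invmx mu') s0).
  by rewrite scalemxAl -h1 eq2 h2 mulmxK ?gl_unit.
have Z2 : E0 *m lam *m Pi0 = 0.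
  have h1 : E0 *m (N *m mu *m lam) *m Pi0 = mu *m (E0 *m lam *m Pi0).
    by rewrite !mulmxA EN -mb.
  have h2 : E0 *m (lam *m N *m mu') *m Pi0 = s k *: (E0 *m lam *m Pi0 *m mu').
    by rewrite -!mulmxA mbP' (mulmxA N) NP -scalemxAl -!scalemxAr.
  apply: (contraction_eq0 (A := invmx mu) (B := mu') s0).
  by rewrite -(mulmxA (invmx mu)) scalemxAr -h2 -eq2 h1 mulKmx ?gl_unit.
have lamb : block_shape lam.
  apply/blockE.
  have -> : lam *m E0 = E0 *m lam *m E0.
    by rewrite -[LHS]mul1mx -{1}(Pi0DE0 (pseries F)) mulmxDl !mulmxA Z1 add0r.
  have {2}-> : E0 *m lam = E0 *m lam *m (Pi0 + E0) by rewrite Pi0DE0 mulmx1.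
  by rewrite mulmxDr Z2 add0r.
apply/flow_eq; exists 1, 1%g, lam; split=> //; first exact: oner_neq0.
by rewrite scale1r /= map_mx1 mul1mx -map_mxM lamE.
Qed.

Lemma cst_mul2 k (L R : 'M[F]_3) (Q : 'M[{poly F}]_3) : mxsz k.+1 Q ->
  mxsz k.+1 (cstmx L *m Q *m cstmx R) /\
  mxcoef k (cstmx L *m Q *m cstmx R) = L *m mxcoef k Q *m R.
Proof.
move=> Qs; have Ls := mxsz_cst L; have Rs := mxsz_cst R.
have LQ := mxszM Ls Qs; rewrite add0n in LQ.
have := mxszM LQ Rs; have := mxcoefM LQ Rs; have := mxcoefM Ls Qs.
by rewrite add0n addn0 !mxcoef_cst => -> ->.
Qed.

(** The axis equation gives [Q = t ^ k W] with [W] integral, so [Q] has degree at most [k] and its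
    leading matrix is the reduction of [W], conjugate to a unit times [Pi0]. A constant factor
    brings this to [Pi0] and the determinant to 1. *)
Lemma axis_SB k (Q : GLP) (kap mu : GLO) : (0 < k)%N -> axis k Q kap mu ->
  exists (D : 'M[F]_3) (B : 'M[{poly F}]_3), [/\ D \in unitmx, SB k B &
    gl_mx Q = cstmx (ev kap) *m cstmx D *m B *m cstmx (invmx (ev kap))].
Proof.
move=> k0 [/blockE mb e].
have ku := gl_unit kap; have muu := gl_unit mu.
have hu : ev kap \in unitmx by rewrite -unitmx_ev0.
have nu : ev (invmx mu) \in unitmx by rewrite -unitmx_ev0 unitmx_inv.
pose W := kap *m invmx mu *m (s k *: E0 + Pi0) *m invmx kap.
have QW : pm Q = t ^+ k *: im W.
  have := congr1 (fun A => A *m im (invmx mu) *m (t ^+ k *: im (s k *: E0 + Pi0)) *m im (invmx kap)) e.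
  rewrite -[_ *m im mu *m im (invmx mu)]mulmxA -map_mxM mulmxV// map_mx1 mulmx1.
  rewrite -[_ *m dg F k *m _]mulmxA dg_inv mulmx1 -mulmxA -map_mxM mulmxV// map_mx1 mulmx1.
  by move=> ->; rewrite /W !map_mxM -scalemxAr -scalemxAl.
have QWij i j : laurent_of_poly (gl_mx Q i j) = t ^+ k * iota (W i j).
  by have /matrixP/(_ i j) := QW; rewrite !mxE.
have Qs : mxsz k.+1 (gl_mx Q) by move=> i j; have [] := poly_series (QWij i j).
have Qc : mxcoef k (gl_mx Q) = ev kap *m ev (invmx mu) *m Pi0 *m ev (invmx kap).
  have -> : mxcoef k (gl_mx Q) = ev W.
    by apply/matrixP => i j; have [_] := poly_series (QWij i j); rewrite !mxE.
  rewrite /W !map_mxM map_mxD map_mxZ (map_E0 (@ev0 F)) (map_Pi0 (@ev0 F)) /=.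
  by rewrite ev0_tau ?muln_gt0// scale0r add0r.
have hV : ev (invmx kap) = invmx (ev kap).
  by apply: (can_inj (mulKmx hu)); rewrite -map_mxM !mulmxV// map_mx1.
rewrite hV in Qc.
have [d d0 dQ] := pm_det Q.
have nd0 : \det (ev (invmx mu)) != 0 by rewrite -unitfE -unitmxE.
(* The [E0] coefficient does not affect [D *m Pi0]; it is chosen to give [D] the determinant of
   [Q]. *)
pose D := ev (invmx mu) *m ((d / \det (ev (invmx mu))) *: E0 + 1 *: Pi0).
have DP : D *m Pi0 = ev (invmx mu) *m Pi0.
  by rewrite -mulmxA mulmxDl -!scalemxAl E0Pi0 Pi0Pi0 scaler0 add0r scale1r.
have dD : \det D = d by rewrite det_mulmx det_scaleEPi expr1n mulr1 mulrC divfK.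
have Du : D \in unitmx by rewrite unitmxE dD unitfE.
clearbody D.
have [Bs Bc] := cst_mul2 (invmx D *m invmx (ev kap)) (ev kap) Qs.
exists D, (cstmx (invmx D *m invmx (ev kap)) *m gl_mx Q *m cstmx (ev kap)); split=> //.
- split=> //.
  + by rewrite Bc Qc !mulmxA !mulmxKV// -mulmxA -DP mulKmx.
  + rewrite !det_mulmx !det_map_mx det_mulmx !det_inv dD dQ /= -!polyCM.
    have h0 : \det (ev kap) != 0 by rewrite -unitfE -unitmxE.
    by rewrite -(det_map_mx (@ev0 F)) -polyC1; congr polyC; field; rewrite d0 h0.
- have e1 : cstmx (ev kap) *m cstmx D *m cstmx (invmx D *m invmx (ev kap)) = 1%:M.
    by rewrite -!cstmxM !mulmxA mulmxK// mulmxV// cstmx1.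
  have e2 : cstmx (ev kap) *m cstmx (invmx (ev kap)) = 1%:M.
    by rewrite -cstmxM mulmxV// cstmx1.
  by rewrite !mulmxA e1 mul1mx -mulmxA e2 mulmx1.
Qed.

(* The hypothesis [B = B2 *m B1] says that the geodesic passes through the
   vertex [B1^-1] of the orbit of the base point. *)
Lemma axis_return k j (h D : 'M[F]_3) (B1 B2 : 'M[{poly F}]_3) (kap mu : GLO) (Q : GLP) :
  (j <= k)%N -> SB j B1 -> SB (k - j) B2 -> h \in unitmx -> D \in unitmx ->
  gl_mx Q = cstmx h *m cstmx D *m (B2 *m B1) *m cstmx (invmx h) ->
  axis k Q kap mu -> pi_K (iter (3 * j) (@T_a F) (flowO kap)) = origin F.
Proof.
move=> jk S1 S2 hu Du QE [/blockE mb e].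
have [sB1 _ dB1] := S1; have [_ _ rA1 lA1] := SB_adj S1.
have [sA2 _ rA2 lA2] := SB_adj S2.
have ku := gl_unit kap; have muu := gl_unit mu.
pose b1 := map_mx (rv j) B1; pose a2 := map_mx (rv ((k - j) + (k - j))) (\adj B2).
have b1E : pm B1 = t ^+ j *: im b1.
  by apply/matrixP => r c; rewrite !mxE; exact: rvE.
have a2E : pm (\adj B2) = t ^+ ((k - j) + (k - j)) *: im a2.
  by apply/matrixP => r c; have := rvE (sA2 r c); rewrite !mxE.
pose k' := cs (invmx h) *m kap.
(* An integral expression for [B1 k' (dg j)]. On the [Pi0] columns [t ^- j B1] is already integral;
   on the [E0] column the axis equation trades [B1] for the inverse of [B2], of degree only
   [2 (k - j)]. *)
pose X := b1 *m k' *m Pi0 + a2 *m cs (invmx D) *m k' *m E0 *m invmx mu *m E0.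
have imk' : im k' = pm (cstmx (invmx h)) *m im kap by rewrite map_mxM pm_cst.
have hh : pm (cstmx h) *m pm (cstmx (invmx h)) = 1%:M.
  by rewrite -map_mxM -cstmxM mulmxV// cstmx1 map_mx1.
have DD : pm (cstmx (invmx D)) *m pm (cstmx D) = 1%:M.
  by rewrite -map_mxM -cstmxM mulVmx// cstmx1 map_mx1.
have vh : pm (cstmx (invmx h)) *m pm (cstmx h) = 1%:M.
  by rewrite -map_mxM -cstmxM mulVmx// cstmx1 map_mx1.
have BV : pm (\adj B2) *m pm B2 = 1%:M by rewrite -map_mxM lA2 map_mx1.
have e' : pm B1 *m im k' *m dg F k *m im mu = pm (\adj B2) *m pm (cstmx (invmx D)) *m im k'.
  rewrite imk'; apply: (transport_eq vh DD BV).
  by rewrite -[RHS]e QE !map_mxM.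
have muE : im mu *m E0 = E0 *m im mu by rewrite -(map_E0 iota) -!map_mxM mb.
have muV : E0 *m invmx mu = invmx mu *m E0.
  by apply: (can_inj (mulKmx muu)); rewrite mulmxA mb mulmxK// mulKVmx.
have dE : dg F k *m E0 = t ^+ (2 * k) *: E0.
  by rewrite mulmxDl -!scalemxAl E0E Pi0E0 scaler0 addr0.
have XE1 : im (b1 *m k' *m Pi0) = t ^- j *: (pm B1 *m im k' *m Pi0).
  rewrite b1E -!scalemxAl scalerA mulVf ?expf_neq0 ?t_neq0// scale1r.
  by rewrite !map_mxM (map_Pi0 iota).
have XE2 : im (a2 *m cs (invmx D) *m k' *m E0 *m invmx mu *m E0) =
    t ^+ (2 * j) *: (pm B1 *m im k' *m E0).
  have muVV : im mu *m im (invmx mu) = 1%:M by rewrite -map_mxM mulmxV// map_mx1.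
  have := restrict_eq muVV muE dE (E0E _) e'.
  rewrite a2E -!scalemxAl pm_cst -[in X in X = _ -> _](map_E0 iota) -!map_mxM => e2.
  have t0 := expf_neq0 (k - j + (k - j)) (t_neq0 F).
  apply: (scalemxI t0); rewrite /= e2 scalerA -exprD.
  by congr (_ ^+ _ *: _); lia.
have XE : im X = pm B1 *m im k' *m dg F j.
  by rewrite map_mxD XE1 XE2 [RHS]mulmxDr -!scalemxAr addrC.
have dXu : X \in unitmx.
  have k'u : k' \in unitmx.
    by rewrite unitmx_mul ku andbT unitmx_ev0 ev_cs unitmx_inv.
  (* Both [B1] and [dg j] have determinant 1, so [X] is invertible over the power series. *)
  have dX : \det X = \det k'.
    apply: (@iota_inj F); rewrite -!(det_map_mx iota) XE !det_mulmx det_scaleEPi.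
    rewrite (det_map_mx (@laurent_of_poly F)) dB1 rmorph1 mul1r exprVn -exprM mulnC mulfV ?mulr1//.
    by rewrite expf_neq0 ?t_neq0.
  by rewrite unitmxE dX -unitmxE.
have Pu : cstmx h *m \adj B1 \in unitmx.
  rewrite unitmx_mul; apply/andP; split; last by have [] := mulmx1_unit rA1.
  exact: cstmx_unit.
rewrite iter_T_a; apply/origin_eq.
exists (t ^+ j), (MkGL Pu), (MkGL dXu); split; first by rewrite expf_neq0 ?t_neq0.
rewrite /= XE imk' [pm (_ *m _)]map_mxM !mulmxA.
rewrite -[pm (cstmx h) *m pm (\adj B1) *m pm B1]mulmxA -map_mxM lA1 map_mx1 mulmx1 hh mul1mx.
by rewrite dgE -scalemxAr scalerA mulfV ?expf_neq0 ?t_neq0// scale1r.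
Qed.

End AxisCount.

(** For two axes through the same point, [dg] cancels because [A] commutes with it; what remains of
    [Q' P Qi] is integral up to the factor [P]. *)
Lemma conjugate_eq (K : fieldType) n (c : K)
    (Q Qi Q' P kap kapi kap' dg A Ai mu mui mu' mui' : 'M[K]_n) :
  c != 0 -> Qi *m Q = 1%:M -> mu *m mui = 1%:M -> mui *m mu = 1%:M ->
  mu' *m mui' = 1%:M -> A *m Ai = 1%:M -> kap *m kapi = 1%:M -> A *m dg = dg *m A ->
  kap' = c *: (P *m kap *m A) -> Q *m kap *m dg *m mu = kap ->
  Q' *m kap' *m dg *m mu' = kap' ->
  Q' *m P *m Qi = P *m kap *m A *m mui' *m Ai *m mu *m kapi.
Proof.
move=> c0 QiQ muV muV' muV2 AV kV Adg kE e e'.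
have e2 : Q' *m P *m kap *m dg *m A *m mu' = P *m kap *m A.
  apply: (can_inj (scalerK c0)); rewrite /= -kE -[RHS]e' kE -scalemxAr -!scalemxAl.
  by rewrite -!mulmxA (mulmxA dg) -Adg !mulmxA.
have e3 : kap *m dg = Qi *m kap *m mui.
  by rewrite -[in RHS]e -!mulmxA muV mulmx1 (mulmxA Qi) QiQ mul1mx.
rewrite -e2 -[_ *m mu' *m mui']mulmxA muV2 mulmx1 -[_ *m A *m Ai]mulmxA AV mulmx1.
rewrite -[_ *m kap *m dg]mulmxA e3 !mulmxA -[_ *m mui *m mu]mulmxA muV' mulmx1.
by rewrite -[_ *m kap *m kapi]mulmxA kV mulmx1.
Qed.

(** * From monoid elements back to axes *)

Section Lower.
Variable F : fieldType.
Local Notation iota := (@laurent_of_pseries F).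
Local Notation t := (@laurent_t F).
Local Notation im := (map_mx (@laurent_of_pseries F)).
Local Notation pm := (map_mx (@laurent_of_poly F)).
Local Notation ev := (map_mx (@ev0 F)).
Local Notation cs := (map_mx (@ps_const F)).
Local Notation GLO := (GL 3 (pseries F)).
Local Notation GLP := (GL 3 {poly F}).
Local Notation s k := (tau F ^+ (3 * k)).

Lemma ev_unit (A : 'M[pseries F]_3) : ev A = 1%:M -> A \in unitmx.
Proof. by move=> A1; rewrite unitmx_ev0 A1 unitmx1. Qed.

Lemma ev_inv (A : 'M[pseries F]_3) : ev A = 1%:M -> ev (invmx A) = 1%:M.
Proof.
move=> A1; have Au := ev_unit A1.
by rewrite -[LHS]mul1mx -A1 -map_mxM mulmxV// map_mx1.
Qed.

(** The integral matrices [b = t ^- k B] and [a = t ^- (2 k) B^-1] commute and multiply to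
    [tau ^ (3 k)], and [a] reduces to [E0]. Lifting this idempotent to [S] and conjugating [S] to
    [E0] by [kap] makes both block shaped, and [mu] is read off from the blocks. *)
Lemma SB_axis k B : (0 < k)%N -> SB k B -> exists (kap mu : GLO), axis k B kap mu.
Proof.
move=> k0 SkB; have [sB cB dB] := SkB; have [sA cA rA lA] := SB_adj SkB.
pose b := map_mx (rv k) B; pose a := map_mx (rv (k + k)) (\adj B).
have bE : pm B = t ^+ k *: im b.
  by apply/matrixP => r c; rewrite !mxE; exact: rvE.
have aE : pm (\adj B) = t ^+ (k + k) *: im a.
  by apply/matrixP => r c; have := rvE (sA r c); rewrite !mxE.
have evb : ev b = Pi0.
  by rewrite -cB; apply/matrixP => r c; rewrite !mxE ev0_rv.
have eva : ev a = E0.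
  by rewrite -cA; apply/matrixP => r c; have := ev0_rv (k + k) (\adj B r c); rewrite !mxE.
clearbody a b.
have t3 : t ^+ (3 * k) != 0 by rewrite expf_neq0 ?t_neq0.
have imS : im ((s k)%:M : 'M[pseries F]_3) = iota (s k) *: 1%:M.
  by apply/matrixP => i j; rewrite !mxE -mulr_natr rmorphM rmorph_nat.
have ba : b *m a = (s k)%:M.
  apply: im_inj; apply: (scalemxI t3); rewrite /= imS scalerA texp_tau scale1r.
  rewrite map_mxM -(map_mx1 (@laurent_of_poly F)) -rA map_mxM bE aE -scalemxAl -scalemxAr scalerA -exprD.
  by congr (_ ^+ _ *: _); lia.
have ab : a *m b = (s k)%:M.
  apply: im_inj; apply: (scalemxI t3); rewrite /= imS scalerA texp_tau scale1r.
  rewrite map_mxM -(map_mx1 (@laurent_of_poly F)) -lA map_mxM bE aE -scalemxAl -scalemxAr scalerA -exprD.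
  by congr (_ ^+ _ *: _); lia.
have [S [SS evS Sc]] : exists S : 'M[pseries F]_3,
    [/\ S *m S = S, ev S = ev a & forall b, b *m a = a *m b -> b *m S = S *m b].
  by apply: (@idempotent_lift F 2 a); rewrite eva E0E.
have Sa : a *m S = S *m a by exact: Sc.
have Sb : b *m S = S *m b by apply: Sc; rewrite ab.
(* Intertwines [S] with [E0]; it reduces to the identity, hence is invertible. *)
pose kap := S *m E0 + (1%:M - S) *m Pi0.
have evk : ev kap = 1%:M.
  rewrite map_mxD !map_mxM map_mxB evS eva map_mx1 (map_E0 (@ev0 F)) (map_Pi0 (@ev0 F)).
  by rewrite E0E mulmxBl mul1mx E0Pi0 subr0 addrC Pi0DE0.
have SR : S *m (1%:M - S) = 0 by rewrite mulmxBr mulmx1 SS subrr.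
have kE : S *m kap = kap *m E0.
  transitivity (S *m E0).
    by rewrite [LHS]mulmxDr !mulmxA SS SR mul0mx addr0.
  by rewrite [RHS]mulmxDl -!mulmxA E0E Pi0E0 mulmx0 addr0.
clearbody kap.
have ku := ev_unit evk.
have kV : E0 *m invmx kap = invmx kap *m S.
  apply: (can_inj (mulKmx ku)); rewrite mulmxA -kE.
  by rewrite mulmxK// mulKVmx.
have evkV := ev_inv evk.
have conj c : c *m S = S *m c ->
    (invmx kap *m c *m kap) *m E0 = E0 *m (invmx kap *m c *m kap).
  move=> cS; rewrite -mulmxA -kE !mulmxA kV; congr (_ *m _).
  by rewrite -mulmxA cS mulmxA.
pose a' := invmx kap *m a *m kap; pose b' := invmx kap *m b *m kap.
have a'E : a' *m E0 = E0 *m a' by exact: conj.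
have b'E : b' *m E0 = E0 *m b' by exact: conj.
have eva' : ev a' = E0 by rewrite !map_mxM evkV evk mul1mx mulmx1.
have evb' : ev b' = Pi0 by rewrite !map_mxM evkV evk mul1mx mulmx1.
have b'a' : b' *m a' = (s k)%:M.
  by rewrite /a' /b' !mulmxA mulmxK// -(mulmxA _ b) ba mul_mx_scalar -scalemxAl mulVmx// scalemx1.
have kb : b *m kap = kap *m b' by rewrite /b' !mulmxA mulmxV// mul1mx.
clearbody a' b'.
pose W := a' *m E0 + Pi0.
have evW : ev W = 1%:M.
  by rewrite map_mxD map_mxM eva' (map_E0 (@ev0 F)) (map_Pi0 (@ev0 F)) E0E addrC Pi0DE0.
have WE : W *m E0 = a' *m E0 by rewrite mulmxDl -mulmxA E0E Pi0E0 addr0.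
have WE' : E0 *m W = a' *m E0 by rewrite mulmxDr E0Pi0 addr0 mulmxA -a'E -mulmxA E0E.
clearbody W.
have Wu := ev_unit evW; have evWV := ev_inv evW.
have WV : E0 *m invmx W = invmx W *m E0.
  by apply: (can_inj (mulKmx Wu)); rewrite mulmxA WE -WE' mulmxK// mulKVmx.
have aW : a' *m (invmx W *m E0) = E0 by rewrite -WV mulmxA -WE' mulmxK.
(* This is [t ^ k b' (dg k)]: on the [E0] block [b'] is [tau ^ (3 k)] times the inverse of [a'], and
   [W] completes that block of [a'] to an invertible matrix. The witness for [mu] is the inverse of
   [V]. *)
pose V := invmx W *m E0 + b' *m Pi0.
have evV : ev V = 1%:M.
  rewrite map_mxD !map_mxM evWV evb' (map_E0 (@ev0 F)) (map_Pi0 (@ev0 F)).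
  by rewrite Pi0Pi0 mul1mx addrC Pi0DE0.
have VE : V *m E0 = E0 *m V.
  transitivity (invmx W *m E0).
    by rewrite /V [LHS]mulmxDl -!mulmxA E0E Pi0E0 mulmx0 addr0.
  rewrite /V [RHS]mulmxDr (comm_Pi0 b'E) !mulmxA E0Pi0 mul0mx addr0 WV.
  by rewrite -mulmxA E0E.
have Vu := ev_unit evV.
have VV : invmx V *m E0 = E0 *m invmx V.
  by apply: (can_inj (mulKmx Vu)); rewrite mulKVmx// mulmxA VE mulmxK.
have VVu : invmx V \in unitmx by rewrite unitmx_inv.
exists (MkGL ku), (MkGL VVu); split; first by apply/blockE.
have bE0 : b' *m E0 = s k *: (invmx W *m E0).
  by rewrite -[in LHS]aW mulmxA b'a' mul_scalar_mx.
have bdg : t ^+ k *: (im b' *m dg F k) = im V.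
  rewrite dgE -scalemxAr scalerA mulfV ?expf_neq0 ?t_neq0// scale1r mulmxDr -scalemxAr.
  rewrite map_mxD [in RHS]map_mxM [im (b' *m _)]map_mxM (map_E0 iota) (map_Pi0 iota).
  congr (_ + _); have -> : im b' *m E0 = iota (s k) *: im (invmx W *m E0).
    by rewrite -(map_E0 iota) -map_mxM bE0 map_mxZ.
  by rewrite scalerA texp_tau scale1r map_mxM (map_E0 iota).
rewrite /= bE -!scalemxAl -map_mxM kb map_mxM -!mulmxA scalemxAr.
rewrite (mulmxA (im b')) scalemxAl bdg -map_mxM mulmxV// map_mx1 mulmx1.
by [].
Qed.

(** A polynomial without pole at infinity is constant. *)
Lemma pm_im_cst (P : 'M[{poly F}]_3) X : pm P = im X -> P = cstmx (ev X).
Proof.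
move=> /matrixP PX; apply/matrixP => i j; rewrite !mxE.
have [s1 <-] : (size (P i j) <= 1)%N /\ (P i j)`_0 = ev0 (X i j).
  by apply: (@poly_series _ 0); rewrite expr0 mul1r; have := PX i j; rewrite !mxE.
exact: size1_polyC.
Qed.

(** Both [P] and [Q' P Q^-1] are polynomial and integral at once, hence constant. This bounds the
    number of monoid elements giving one cycle. *)
Lemma axis_fibre k (Q Q' : GLP) (kap kap' mu mu' : GLO) :
  axis k Q kap mu -> axis k Q' kap' mu' -> flowO kap = flowO kap' ->
  exists h1 h2 : 'M[F]_3, gl_mx Q' = cstmx h1 *m Q *m cstmx h2.
Proof.
move=> [/blockE mb e] [/blockE mb' e'] /flow_eq[c [P [A [c0 /blockE Ab /= kE]]]].
have [N [u [uu cE]]] := unit_decomp c0.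
have ku := gl_unit kap; have ku' := gl_unit kap'; have Au := gl_unit A.
have muu := gl_unit mu; have muu' := gl_unit mu'.
(* Determinants on both sides are units up to [c ^ 3], so the scalar has degree 0. *)
have N0 : N = 0.
  have [d d0 dP] := pm_det P.
  have := congr1 determinant kE; rewrite detZ !det_mulmx !det_map_mx dP cE /= polyC_shift.
  rewrite !exprS expr0 mulr1 !laurent_of_pseriesE !shift_mul => e1.
  have : 0 = N + (N + N) + (0 + 0 + 0).
    apply: (shift_unit_eq _ _ e1); first by rewrite -unitmxE.
    by rewrite !unitrM uu -!unitmxE ku Au unit_ev0 d0.
  lia.
have cu : c = iota u by rewrite cE N0 laurent_of_pseriesE.
have PX : pm P = im (u^-1 *: (kap' *m invmx A *m invmx kap)).
  have iu : iota u * iota u^-1 = 1 by rewrite -rmorphM mulrV// rmorph1.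
  rewrite map_mxZ !map_mxM kE cu -!scalemxAl scalerA mulrC iu scale1r.
  rewrite -[_ *m im A *m im (invmx A)]mulmxA -map_mxM mulmxV// map_mx1 mulmx1.
  by rewrite -mulmxA -map_mxM mulmxV// map_mx1 mulmx1.
have PE := pm_im_cst PX; set P0 := ev _ in PE.
have P0u : P0 \in unitmx.
  have := gl_unit P; rewrite PE unitmxE det_map_mx poly_unitE coefC eqxx => /andP[_].
  by rewrite -unitmxE.
have Adg : im A *m dg F k = dg F k *m im A.
  by apply: scaleEPi_comm; rewrite -(map_E0 iota) -!map_mxM Ab.
pose C := cs P0 *m kap *m A *m invmx mu' *m invmx A *m mu *m invmx kap.
have imV (X : 'M[pseries F]_3) : X \in unitmx ->
    im X *m im (invmx X) = 1%:M /\ im (invmx X) *m im X = 1%:M.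
  by move=> Xu; rewrite -!map_mxM mulmxV// mulVmx// map_mx1.
have [mV mV'] := imV _ muu; have [mV2 _] := imV _ muu'.
have [AV _] := imV _ Au; have [kV _] := imV _ ku.
have QV : pm (invmx Q) *m pm Q = 1%:M by rewrite -map_mxM mulVmx ?gl_unit// map_mx1.
have QC : pm (Q' *m P *m invmx Q) = im C.
  rewrite !map_mxM (conjugate_eq c0 QV mV mV' mV2 AV kV Adg kE e e').
  by rewrite {1}PE pm_cst.
have := pm_im_cst QC; rewrite {1}PE => QE.
exists (ev C), (invmx P0).
rewrite -QE mulmxKV ?gl_unit// -mulmxA -cstmxM mulmxV// cstmx1 mulmx1.
by [].
Qed.

End Lower.

(** * Counting cycles *)
Section CountCycles.
Variable F : finFieldType.
Local Notation q := #|F|.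
Local Notation im := (map_mx (@laurent_of_pseries F)).
Local Notation pm := (map_mx (@laurent_of_poly F)).
Local Notation GLO := (GL 3 (pseries F)).
Local Notation GLP := (GL 3 {poly F}).
Local Notation o := (origin F).

Lemma SB_unit k (B : 'M[{poly F}]_3) : SB k B -> B \in unitmx.
Proof. by move=> [_ _ dB]; rewrite unitmxE dB unitr1. Qed.

Lemma cycles_encode k (x : flow_space F) : (0 < k)%N -> cycles (3 * k) o x ->
  exists e : 'M[F]_3 * 'M[F]_3 * 'M[{poly F}]_3,
  exists (kap mu : GLO) (Q : GLP), [/\ e.1.1 \in unitmx, e.1.2 \in unitmx, SB k e.2,
    x = flowO kap /\ axis k Q kap mu &
    gl_mx Q = cstmx e.1.1 *m cstmx e.1.2 *m e.2 *m cstmx (invmx e.1.1)].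
Proof.
move=> k0 /cycles_axis[k' [kap [mu [Q [kk xE ax]]]]].
have {kk} kk : k' = k by lia.
rewrite kk in ax; have [D [B [Du SkB QE]]] := axis_SB k0 ax.
exists (map_mx (@ev0 F) kap, D, B), kap, mu, Q; split=> //.
by rewrite -unitmx_ev0 gl_unit.
Qed.

(** A cycle is encoded by constant matrices [h], [D] and a monoid element [B]. These determine [Q],
    and [Q] determines the cycle by [axis_inj]; the factors [q ^ 9] count the constant matrices. *)
Lemma nb_cycles_encoded k (Z : set (flow_space F)) (X : set 'M[{poly F}]_3) :
  (0 < k)%N -> Z `<=` cycles (3 * k) o -> X `<=` SB k ->
  (forall x h D B (kap mu : GLO) (Q : GLP), Z x -> h \in unitmx -> D \in unitmx ->
    SB k B -> x = flowO kap -> axis k Q kap mu ->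
    gl_mx Q = cstmx h *m cstmx D *m B *m cstmx (invmx h) -> X B) ->
  finite_set Z /\ (nb Z <= q ^ 9 * q ^ 9 * nb X)%N.
Proof.
move=> k0 Zc XS ZX.
have Xf : finite_set X by apply: sub_finite_set (finite_SB F k).
pose T := ('M[F]_3 * 'M[F]_3 * 'M[{poly F}]_3)%type.
pose P x (e : T) := exists (kap mu : GLO) (Q : GLP), [/\ e.1.1 \in unitmx, e.1.2 \in unitmx, SB k e.2,
    x = flowO kap /\ axis k Q kap mu &
    gl_mx Q = cstmx e.1.1 *m cstmx e.1.2 *m e.2 *m cstmx (invmx e.1.1)].
have /choice[f fP] x : exists e : T, Z x -> P x e.
  have [Zx|?] := pselect (Z x); last by exists (0, 0, 0).
  by have [e ?] := cycles_encode k0 (Zc x Zx); exists e.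
have M3 : nb [set` 'M[F]_3] = (q ^ 9)%N by rewrite nb_setT card_mx.
have finM : finite_set [set` 'M[F]_3] by exact: finite_finpred.
rewrite -M3 -nbX// -nbX//; last exact: finite_setX.
apply: (@nb_inj _ _ f).
- by apply: finite_setX => //; exact: finite_setX.
- move=> x Zx; have [kap [mu [Q [hu Du Sk [xE ax] QE]]]] := fP x Zx.
  by split=> //; exact: (ZX x _ _ _ kap mu Q Zx hu Du Sk xE ax QE).
- move=> x y Zx Zy fxy.
  have [kap [mu [Q [_ _ _ [xE ax] QE]]]] := fP x Zx.
  have [kap' [mu' [Q' [_ _ _ [yE ay] QE']]]] := fP y Zy.
  rewrite -fxy -QE in QE'; rewrite QE' in ay.
  by rewrite xE yE; exact: axis_inj ax ay.
Qed.

Lemma nb_cycles_le k : (0 < k)%N -> finite_set (@cycles F (3 * k) o) /\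
  (nb (@cycles F (3 * k) o) <= q ^ 9 * q ^ 9 * nb (@SB F k))%N.
Proof.
move=> k0; apply: (@nb_cycles_encoded k _ (@SB F k)) => //.
Qed.

(** A factorization of [B] would bring the cycle back to the base point earlier, by [axis_return],
    so first returns are encoded by indecomposables. *)
Lemma nb_first_return_le k : (0 < k)%N -> finite_set (@first_return_cycles F (3 * k)) /\
  (nb (@first_return_cycles F (3 * k)) <= q ^ 9 * q ^ 9 * nb (@indec F k))%N.
Proof.
move=> k0.
have Zc : @first_return_cycles F (3 * k) `<=` cycles (3 * k) o.
  by move=> x [xo xn _]; split.
have XS : @indec F k `<=` SB k by move=> B [].
apply: (nb_cycles_encoded k0 Zc XS) => x h D B kap mu Q [xo xn [_ xmin]] hu Du SkB xE ax QE.
split=> // j B1 B2 /andP[j0 jk] S1 S2 BE; rewrite BE in QE.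
have := axis_return (ltnW jk) S1 S2 hu Du QE ax; rewrite -xE => xj.
have : (0 < 3 * j)%N /\ pi_K (iter (3 * j) (@T_a F) x) = o by split=> //; rewrite muln_gt0.
by move=> /xmin; lia.
Qed.

Lemma first_return_empty n : (forall k, (0 < k)%N -> n <> 3 * k)%N ->
  @first_return_cycles F n = set0.
Proof.
move=> n3; apply/seteqP; split=> // x [xo xn [[n0 _] _]].
have [k [_ [_ [_ [nk _ _]]]]] := cycles_axis (conj xo xn : cycles n o x).
by apply: (n3 k _ nk); lia.
Qed.

Lemma axis_cycles k (Q : GLP) (kap mu : GLO) : axis k Q kap mu ->
  cycles (3 * k) o (flowO kap).
Proof.
move=> [mb e]; split.
  apply/origin_eq; exists 1, 1%g, kap; split; first exact: oner_neq0.
  by rewrite scale1r /= map_mx1 mul1mx.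
rewrite iter_T_a; apply/flow_eq.
exists ((laurent_t F) ^- k), Q, mu; split=> //; first by rewrite invr_eq0 expf_neq0 ?t_neq0.
by rewrite /= -[LHS]e dgE -scalemxAr -scalemxAl !mulmxA.
Qed.

(** By [axis_fibre], a monoid element is recovered from its cycle together with two constant
    matrices. *)
Lemma nb_cycles_ge k : (0 < k)%N ->
  (nb (@SB F k) <= q ^ 9 * q ^ 9 * nb (@cycles F (3 * k) o))%N.
Proof.
move=> k0; have [fc _] := nb_cycles_le k0.
have /choice[kp kpP] (B : 'M[{poly F}]_3) : exists kap : GLO, SB k B -> exists mu, axis k B kap mu.
  have [SkB|?] := pselect (SB k B); last by exists 1%g.
  by have [kap [mu ax]] := SB_axis k0 SkB; exists kap => _; exists mu.
pose xf B := flowO (kp B).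
(* [rp x] is a reference monoid element over the cycle [x]; all others over [x] are compared with
   it. *)
have /choice[rp rpP] (x : flow_space F) : exists B, (exists2 B', SB k B' & xf B' = x) -> SB k B /\ xf B = x.
  have [[B SkB Bx]|?] := pselect (exists2 B', SB k B' & xf B' = x); last by exists 0.
  by exists B.
have /choice[hh hhP] (B : 'M[{poly F}]_3) : exists h : 'M[F]_3 * 'M[F]_3, SB k B ->
    B = cstmx h.1 *m rp (xf B) *m cstmx h.2.
  have [SkB|?] := pselect (SB k B); last by exists (0, 0).
  have [SkR xR] := rpP (xf B) (ex_intro2 _ _ B SkB erefl).
  have [mu ax] := kpP B SkB; have [mu' ax'] := kpP _ SkR.
  have [h1 [h2 BE]] := @axis_fibre _ k (MkGL (SB_unit SkR)) (MkGL (SB_unit SkB)) _ _ _ _ ax' ax xR.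
  by exists (h1, h2).
have M3 : nb [set` 'M[F]_3] = (q ^ 9)%N by rewrite nb_setT card_mx.
have finM : finite_set [set` 'M[F]_3] by exact: finite_finpred.
rewrite -M3 -nbX// -nbX//; last exact: finite_setX.
apply: (@nb_inj _ _ (fun B => (hh B, xf B)) _ _ _ _ _).2.
- by apply: finite_setX => //; exact: finite_setX.
- move=> B SkB; split=> //=; have [mu ax] := kpP B SkB.
  exact: (@axis_cycles k (MkGL (SB_unit SkB)) _ mu).
- move=> B B' SkB SkB' e; have /= eh := congr1 fst e; have /= ex := congr1 snd e.
  by rewrite (hhP B SkB) (hhP B' SkB') eh ex.
Qed.

End CountCycles.

(** * Growth rates *)
Section Growth.
Variable R : realType.

Lemma archi_div (C e : R) : 0 < e -> exists N, forall n, (N < n)%N -> C / n%:R <= e.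
Proof.
move=> e0; exists (Num.bound (`|C| / e)) => n Nn.
have n0 : 0 < n%:R :> R by rewrite ltr0n; exact: leq_ltn_trans Nn.
have := archi_boundP (divr_ge0 (normr_ge0 C) (ltW e0)).
rewrite ltr_pdivrMr// => Ce; rewrite ler_pdivrMr//.
apply: le_trans (ler_norm C) _; apply: le_trans (ltW Ce) _.
by rewrite mulrC ler_pM2l// ler_nat ltnW.
Qed.

(** The gap [m - l] absorbs [C / n] on a tail, whose supremum bounds the upper limit. *)
Lemma limn_esup_le_bound (u : nat -> \bar R) (C l m : R) : l < m ->
  (forall n, (0 < n)%N -> (u n <= (C / n%:R + l)%:E)%E) ->
  (limn_esup u <= m%:E)%E.
Proof.
move=> lm ub; have ml0 : 0 < m - l by rewrite subr_gt0.
have [N NP] := archi_div C ml0.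
apply: (@le_trans _ _ (ereal_sup (u @` [set n | (N < n)%N]))).
  apply: ereal_inf_lbound; exists [set n | (N < n)%N] => //.
  by exists N.+1.
apply: ge_ereal_sup => _ [n /= Nn <-].
apply: le_trans (ub n (leq_ltn_trans (leq0n N) Nn)) _.
by rewrite lee_fin -lerBrDr; exact: NP.
Qed.

Lemma cvg_log_growth (u : nat -> \bar R) (x : nat -> R) (K l : R) :
  (forall n, (0 < n)%N -> u n = (x n)%:E) ->
  (forall n, (0 < n)%N -> `|x n - l| <= K / n%:R) -> u @ \oo --> l%:E.
Proof.
move=> ux xl; apply: cvg_EFin.
  by exists 1%N => // n /= n0; rewrite ux.
apply/cvgrPdist_le => e e0; have [N NP] := archi_div K e0.
exists N.+1 => // n /= Nn; have n0 : (0 < n)%N by exact: leq_ltn_trans Nn.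
by rewrite ux//= distrC; apply: le_trans (xl n n0) _; exact: NP.
Qed.

End Growth.

(** * The entropy and the rate of first returns *)

Section Entropy.
Variables (R : realType) (F : finFieldType).
Local Notation q := #|F|.
Local Notation Q := (q%:R : R).
Let s1 := nb (@SB F 1).
(** Growth factor of the indecomposables per degree, that is, per three steps of the flow; by
    [nb_SB1] it equals [q ^ 5 + q ^ 4 - q ^ 3]. *)
Let theta := (q ^ 6 - s1)%N.

Lemma q_gt1 : (1 < q)%N. Proof. exact: card_finNzRing_gt1. Qed.

Lemma nb_SB1 : s1 = (q ^ 3 * ((q - 1) * (q - 1) * (q + 1)))%N.
Proof. by rewrite /s1 nb_SB muln0. Qed.

Lemma nb_SBS k : (0 < k)%N -> nb (@SB F k.+1) = (q ^ 6 * nb (@SB F k))%N.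
Proof.
case: k => // k _; rewrite !nb_SB [RHS]mulnA -expnD; congr (_ ^ _ * _)%N; lia.
Qed.

Lemma s1_bounds : (0 < s1)%N /\ (s1 < q ^ 6)%N.
Proof.
have q1 := q_gt1; rewrite nb_SB1; split.
  by rewrite muln_gt0 expn_gt0 !muln_gt0 !subn_gt0 addn_gt0 q1 (ltnW q1).
rewrite (_ : 6 = 3 + 3)%N // expnD ltn_pmul2l ?expn_gt0 ?(ltnW q1)//.
have [r ->] : exists r, q = r.+2 by exists (q - 2)%N; lia.
rewrite !expnS expn0; nia.
Qed.

Lemma theta_gt0 : (0 < theta)%N.
Proof. by rewrite /theta subn_gt0; have [] := s1_bounds. Qed.

Lemma theta_lt : (theta < q ^ 6)%N.
Proof. by rewrite /theta; have := s1_bounds; lia. Qed.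

Lemma nb_indec_le k : (0 < k)%N -> (nb (@indec F k) <= s1 * theta ^ k)%N.
Proof.
case: k => // k _; rewrite (nb_indecE nb_SBS); last by have [_ /ltnW] := s1_bounds.
by rewrite leq_mul2l; apply/orP; right; rewrite leq_pexp2l ?theta_gt0.
Qed.

Lemma ln_theta : ln (theta%:R : R) / 3%:R < 2%:R * ln Q.
Proof.
have q0 : 0 < Q by rewrite ltr0n (ltnW q_gt1).
rewrite ltr_pdivrMr//; apply: (@lt_le_trans _ _ (ln (Q ^+ 6))).
  by rewrite ltr_ln ?posrE ?exprn_gt0// ?ltr0n ?theta_gt0// -natrX ltr_nat theta_lt.
rewrite lnXn// -[_ *+ 6]mulr_natl; lra.
Qed.

Lemma first_return_le n : (0 < n)%N ->
  ((n%:R^-1)%:E * lne (nb_first_return_cycles F R n) <=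
   (ln ((q ^ 9 * q ^ 9 * s1)%:R : R) / n%:R + ln (theta%:R : R) / 3%:R)%:E)%E.
Proof.
move=> n0; have n0R : 0 < n%:R :> R by rewrite ltr0n.
(* Empty sets of first returns contribute [-oo]; this covers every [n] not divisible by 3. *)
have Ny : ((n%:R^-1)%:E * -oo = -oo :> \bar R)%E by rewrite gt0_muleNy// lte_fin invr_gt0.
have [[k k0 nk]|n3] := pselect (exists2 k, (0 < k)%N & n = (3 * k)%N); last first.
  rewrite /nb_first_return_cycles first_return_empty; last by move=> k k0 nk; apply: n3; exists k.
  by rewrite /counting ifT; [rewrite fset_set0 cardfs0 /lne lexx Ny leNye|exact/asboolP].
have [ff fle] := nb_first_return_le F k0.
rewrite /nb_first_return_cycles nk /counting ifT; last exact/asboolP.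
rewrite -/(nb _) -nk.
have [f0|f0] := posnP (nb (@first_return_cycles F n)).
  by rewrite f0 /lne lexx Ny leNye.
rewrite lne_EFin ?ltr0n// -EFinM lee_fin mulrC ler_pdivrMr// mulrDl divfK ?gt_eqF//.
have kn : (n%:R : R) = 3%:R * k%:R by rewrite nk natrM.
rewrite (_ : ln theta%:R / 3%:R * n%:R = ln (theta%:R ^+ k)); last first.
  by rewrite lnXn ?ltr0n ?theta_gt0// kn -[RHS]mulr_natl; field.
have [s0 _] := s1_bounds.
have c0 : (0 < q ^ 9 * q ^ 9 * s1)%N by rewrite muln_gt0 s0 andbT muln_gt0 !expn_gt0 (ltnW q_gt1).
rewrite -lnM ?posrE ?exprn_gt0 ?ltr0n ?theta_gt0//.
rewrite ler_ln ?posrE ?mulr_gt0 ?exprn_gt0 ?ltr0n ?theta_gt0//.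
rewrite -natrX -natrM ler_nat nk; apply: leq_trans fle _.
by rewrite -[leqRHS]mulnA leq_mul2l nb_indec_le ?orbT.
Qed.

(** Up to the bounded factor [q ^ 18], the cycles of length [3 n] number [q ^ (6 n)] times a
    constant, and the logarithm is divided by [3 n]. *)
Lemma gurevich_entropyE : gurevich_entropy R (origin F) = (2%:R * ln Q)%:E.
Proof.
have q0 : (0 < q)%N by exact: ltnW q_gt1.
have Q0 : 0 < Q by rewrite ltr0n.
have Q1 : 1 <= Q by rewrite ler1n.
pose c := ((q - 1) * (q - 1) * (q + 1))%N.
have c0 : (0 < c)%N by have q1 := q_gt1; rewrite !muln_gt0 !subn_gt0 addn_gt0 q1 q0.
have lc : 0 <= ln (c%:R : R) by rewrite ln_ge0// ler1n.
have lq : 0 <= ln Q by rewrite ln_ge0.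
pose g n := nb (@cycles F (3 * n) (origin F)).
apply/cvg_lim => //.
(* In the error constant, 18 comes from the two sets of constant matrices and [c] from the factor of
   [nb_SB] independent of the degree. *)
apply: (@cvg_log_growth R _ (fun n => (3 * n)%N%:R^-1 * ln (g n)%:R) (ln c%:R + 18%:R * ln Q)).
  move=> n n0; have [fc _] := nb_cycles_le F n0.
  have g0 : (0 < g n)%N.
    have := nb_cycles_ge F n0; rewrite -/(g n); case: posnP => // ->; rewrite muln0 leqn0.
    case: n n0 {fc} => // n _; rewrite nb_SB -/c muln_eq0 expn_eq0 => /orP[/andP[]|]; lia.
  by rewrite /nb_cycles /counting ifT; [rewrite -/(nb _) -/(g n) lne_EFin ?ltr0n|exact/asboolP].
move=> n n0; have [fc gle] := nb_cycles_le F n0; have gge := nb_cycles_ge F n0.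
rewrite -/(g n) in gle gge.
have lnS : ln ((nb (@SB F n))%:R : R) = (6 * n)%N%:R * ln Q - 3%:R * ln Q + ln c%:R.
  case: n n0 {fc gle gge} => // n _; rewrite nb_SB -/c natrM natrX lnM ?posrE ?exprn_gt0 ?ltr0n//.
  rewrite lnXn// -[_ *+ _]mulr_natl (_ : 6 * n.+1 = 6 * n + 3 + 3)%N; last by lia.
  by rewrite !natrD; ring.
have S0 : (0 < nb (@SB F n))%N.
  by case: n n0 {fc gle gge lnS} => // n _; rewrite nb_SB -/c muln_gt0 expn_gt0 q0 c0.
have g0 : (0 < g n)%N.
  by move: gge; case: (posnP (g n)) => // ->; rewrite muln0 leqNgt S0.
have q18 : (q ^ 9 * q ^ 9 = q ^ 18)%N by rewrite -expnD.
rewrite q18 in gle gge.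
have up : ln (g n)%:R <= 18%:R * ln Q + ln ((nb (@SB F n))%:R : R).
  rewrite mulr_natl -lnXn// -lnM ?posrE ?exprn_gt0 ?ltr0n//.
  by rewrite ler_ln ?posrE ?mulr_gt0 ?exprn_gt0 ?ltr0n// -natrX -natrM ler_nat.
have lo : ln ((nb (@SB F n))%:R : R) <= 18%:R * ln Q + ln (g n)%:R.
  rewrite mulr_natl -lnXn// -lnM ?posrE ?exprn_gt0 ?ltr0n//.
  by rewrite ler_ln ?posrE ?mulr_gt0 ?exprn_gt0 ?ltr0n// -natrX -natrM ler_nat.
have n0R : 0 < n%:R :> R by rewrite ltr0n.
rewrite ler_pdivlMr// -[X in _ * X](gtr0_norm n0R) -normrM mulrBl.
have -> : (3 * n)%N%:R^-1 * ln (g n)%:R * n%:R = ln (g n)%:R / 3%:R :> R.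
  by rewrite natrM; field; rewrite gt_eqF.
move: up lo; rewrite lnS natrM; move: (ln Q) (ln _) (ln (g n)%:R) lq lc => a b d a0 b0 up lo.
rewrite ler_norml; apply/andP; split; lra.
Qed.

End Entropy.

Local Open Scope ereal_scope.

Theorem theorem1p1 (R : realType) (F : finFieldType) :
  limn_esup (fun n : nat =>
    (n%:R^-1)%:E * lne (nb_first_return_cycles F R n))
  < gurevich_entropy R (origin F).
Proof.
rewrite gurevich_entropyE; have := ln_theta R F.
set l := (_ / _)%R; set h := (_ * _)%R => lh.
(* The midpoint leaves room on both sides: [limn_esup_le_bound] asks for a bound strictly above the
   rate. *)
apply: (@le_lt_trans _ _ ((l + h) / 2%:R)%R%:E); last by rewrite lte_fin; lra.
apply: limn_esup_le_bound (@first_return_le R F); rewrite -/l; lra.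
Qed.
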